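(* 1) Let $\xi$ be a real algebraic number with $d=\deg\xi$, and let $L\ge 3$ be a real number with $L(\xi)\le L$. Then $$|\pi-\xi|\ge\exp\bigl\{-1.2\cdot10^6\, d\,(\log L+d\log d)(1+\log d)\bigr\}.$$ 2) Let $d\ge1$ be an integer and $L\ge3$ a real number. If $P\in\mathbb{Z}[x]$, $P\neq0$, $\deg P\le d$ and $L(P)\le L$, then $$|P(\pi)|\ge\exp\bigl\{-2\cdot10^6\, d\,(\log L+d\log d)(1+\log d)\bigr\}.$$
   Context: For a polynomial $P=\sum_{i=0}^d a_ix^i\in\mathbb{Z}[x]$ its length is $L(P)=\sum_{i=0}^d|a_i|$. For an algebraic number $\xi$, $L(\xi)$ denotes the length of its minimal polynomial in $\mathbb{Z}[x]$ (irreducible with coprime integer coefficients). Logarithms are natural. *)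

(* Defs.v *)
From HB Require Import structures.
From mathcomp Require Import all_boot all_order all_algebra.
From mathcomp Require Import all_classical all_reals all_analysis.

Set Implicit Arguments.
Unset Strict Implicit.
Unset Printing Implicit Defensive.

Import Order.TTheory GRing.Theory Num.Theory.
Local Open Scope ring_scope.

Definition poly_length (P : {poly int}) : int := \sum_(i < size P) `|P`_i|.

(* On {poly int}, divisibility is pseudo-divisibility, so [irreducible_poly P] *)
(* only says that P is nonconstant and irreducible over the rationals (see    *)
(* [irreducible_rat_int]). Together with [zcontents P = 1], i.e., coprime     *)
(* coefficients and a positive leading coefficient (by the sign convention of *)
(* [zcontents]), it is irreducibility in Z[x], with the sign fixed.           *)
Definition is_minpolyZ (R : realType) (xi : R) (P : {poly int}) : Prop :=
  [/\ irreducible_poly P, zcontents P = 1 & root (map_poly intr P) xi].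

(* The default value 0 is only taken for transcendental xi: see               *)
(* [minpolyZP] and [minpolyZ_unique].                                         *)
Definition minpolyZ (R : realType) (xi : R) : {poly int} :=
  xget 0 [set P : {poly int} | is_minpolyZ xi P]%classic.

Definition alg_degree (R : realType) (xi : R) : nat := (size (minpolyZ xi)).-1.

Definition alg_length (R : realType) (xi : R) : int :=
  poly_length (minpolyZ xi).

Lemma minpolyZ_exists (R : realType) (xi : R) :
  algebraicOver (ratr : rat -> R) xi -> exists P, is_minpolyZ xi P.
Proof.
case=> p p_neq0 rootp.
have [q [a a0 pE]] := rat_poly_scale p.
have rq : root (map_poly intr q) xi.
  move: rootp; rewrite pE map_polyZ /= rootZ; last first.
    by rewrite fmorph_eq0 invr_eq0 intr_eq0.
  by rewrite -map_poly_comp (eq_map_poly (fun z => ratr_int R z)).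
have q0 : q != 0.
  by apply: contraNneq p_neq0 => q0; rewrite pE q0 map_polyC /= scaler0.
pose Q n := `[< exists P : {poly int},
  [/\ P != 0, size P = n & root (map_poly intr P) xi] >].
have exQ : exists n, Q n by exists (size q); apply/asboolP; exists q.
have := ex_minnP exQ => -[n /asboolP[P [P0 sP rP]] nmin].
have minP S : S != 0 -> root (map_poly intr S) xi -> (size P <= size S)%N.
  by move=> S0 rS; rewrite sP; apply: nmin; apply/asboolP; exists S.
have rprim S : root (map_poly intr S) xi ->
    S != 0 -> root (map_poly intr (zprimitive S)) xi.
  move=> + S0; rewrite {1}(zpolyEprim S) map_polyZ /= rootZ //.
  by rewrite intr_eq0 zcontents_eq0.
exists (zprimitive P); split; last exact: rprim.
- split.
    rewrite size_zprimitive ltnNge; apply/negP => /size1_polyC PE.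
    move: rP P0; rewrite PE map_polyC /= rootC intr_eq0 => /eqP ->.
    by rewrite eqxx.
  move=> S S1 dS; have /dvdpP_int[T TE] := dS.
  have zP0 : zprimitive P != 0 by rewrite zprimitive_eq0.
  have S0 : S != 0 by apply: contraNneq zP0 => S0; rewrite TE S0 zprimitive0 mul0r.
  have T0 : T != 0 by apply: contraNneq zP0 => T0; rewrite TE T0 mulr0.
  have sPE : size P = (size S + size T).-1.
    by rewrite -size_zprimitive TE size_mul ?zprimitive_eq0// size_zprimitive.
  have sS : (0 < size S)%N by rewrite size_poly_gt0.
  have := rprim _ rP P0; rewrite TE rmorphM /= rootM => /orP[rS|rT].
    rewrite -TE -dvdp_size_eqp// eqn_leq dvdp_leq//= size_zprimitive.
    by rewrite -(size_zprimitive S) minP// zprimitive_eq0.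
  have := minP _ T0 rT; rewrite sPE.
  by case: (size S) S1 sS => [|[|k]]//= _ _; rewrite addSn /= leqNgt ltnS leq_addl.
- by rewrite zcontents_primitive P0.
Qed.

Lemma minpolyZP (R : realType) (xi : R) :
  algebraicOver (ratr : rat -> R) xi -> is_minpolyZ xi (minpolyZ xi).
Proof.
move=> /minpolyZ_exists hP.
exact: (@xgetPex _ 0 [set P | is_minpolyZ xi P]%classic hP).
Qed.

Lemma is_minpolyZ_inj (R : realType) (xi : R) (P Q : {poly int}) :
  is_minpolyZ xi P -> is_minpolyZ xi Q -> P = Q.
Proof.
move=> [iP cP rP] [iQ cQ rQ].
pose ZQ := map_poly (intr : int -> rat).
have toR S : map_poly intr S = map_poly (ratr : rat -> R) (ZQ S).
  by rewrite -map_poly_comp; apply: eq_map_poly => z /=; rewrite ratr_int.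
have PQ : P %| Q.
  rewrite -dvdp_rat_int; apply/negPn.
  rewrite -(irreducible_poly_coprime (p := ZQ P)); last exact/irreducible_rat_int.
  apply/negP; rewrite -(coprimep_map (ratr : {rmorphism rat -> R})) -!toR.
  by move=> /coprimep_root/(_ rP); rewrite (rootP rQ) eqxx.
have : P %= Q by apply: (apply_irredp iQ) PQ; rewrite neq_ltn iP.1 orbT.
move=> /eqpP[[a b] /= /andP[a0 b0] /(congr1 zprimitive)].
rewrite !zprimitiveZ// => E.
by rewrite (zpolyEprim P) (zpolyEprim Q) cP cQ !scale1r.
Qed.

Lemma minpolyZ_unique (R : realType) (xi : R) (P : {poly int}) :
  is_minpolyZ xi P -> minpolyZ xi = P.
Proof.
move=> hP; apply: (is_minpolyZ_inj (xi := xi)) => //.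
exact: (@xgetPex _ 0 [set P | is_minpolyZ xi P]%classic (ex_intro _ P hP)).
Qed.

(* Main.v *)
Require Import Defs.
From mathcomp Require Import all_boot all_order all_algebra.
From mathcomp Require Import perm algC complex.
From mathcomp Require Import all_classical all_reals all_analysis.
From mathcomp Require Import ring lra zify.

(** Feldman's method.  Let xi be a root of an irreducible P of degree d close  *)
(** to pi.  By the pigeonhole principle there are small integers p_{kljb} such *)
(** that f(x) = sum p_{kljb} pi^j i^b x^k e^{i(l-L0)x} has small Taylor        *)
(** coefficients at 0; since e^{2 pi i s} = 1, the derivatives of f at the     *)
(** points 2 pi s, |s| <= S0, are values at pi and i of integer polynomials,   *)
(** and they are small.  Taking B_t(d/dx) with B_t = binomial(z, t) in place   *)
(** of (d/dx)^t trades t! for a denominator of size e^{O(t log K)}.  Replacing *)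
(** pi by xi turns f into a nonzero polynomial in X and Y = e^{ix} with the    *)
(** formal derivation Y d/dY - i d/dX, and a zero estimate shows that one of   *)
(** these values does not vanish at xi.  The corresponding integer polynomial  *)
(** Q is then coprime to P, and the resultant of P and Q, a nonzero integer,   *)
(** is at most a combination of |P(pi)| and |Q(pi)|; as |Q(pi)| is small,      *)
(** |P(pi)| is bounded below.  A general polynomial is a product of            *)
(** irreducible ones, whose lengths are controlled by the multiplicativity of  *)
(** the Mahler measure M and 2^{-deg P} L(P) <= M(P) <= L(P); a real algebraic *)
(** number is compared with the value at pi of its minimal polynomial.         *)

Set Implicit Arguments.
Unset Strict Implicit.
Unset Printing Implicit Defensive.

Import Order.TTheory GRing.Theory Num.Theory.
Import numFieldNormedType.Exports.

(** * Least common multiples and integer-valued polynomials *)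

Local Open Scope nat_scope.

(** Let [P] be irreducible of degree [d] with P(0) nonzero, and let xi be any complex root of [P].
    [small_linear_forms] gives f whose first [M] = K L0 Taylor coefficients are tiny. The operator
    B_t(-i d/dx) then makes f small at the points 2 pi s ([twist_combination_le]): the first [M]
    coefficients are small by construction, the others by the factorial decay of the exponential
    series ([exp_tail_le]). After multiplication by [denom], such a value is Q_re(pi) + i Q_im(pi)
    with integer polynomials of controlled length ([value_polyE], [length_value_poly]).

    The same values with xi in place of pi are derivatives, along Y d/dY - i d/dX, of a nonzero
    polynomial F(X, Y) at the points (2 s xi, 1). By [zero_estimate] they cannot all vanish: the
    matrix of the first size F derivatives of F has a nonzero determinant, of bounded degree in Y,
    and vanishing would force a high power of Y - 1 to divide it. So some Q_re or Q_im is nonzero at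
    xi, its resultant with [P] is a nonzero integer, and [resultant_le] yields [criterion].

    The balance is struck in [horner_pi_ge]. There are 2d times as many unknowns as M, up to a small
    surplus per real equation count, so the forms gain a factor of order H^(2d), while Q contributes
    only H^d to the resultant. If H^d is about e^g, where e^g collects all the other losses, the
    term with Q(pi) is at most 1/2 and |P(pi)| >= e^(-2g), provided the Taylor tail is also below
    e^(-2g). The latter asks for 2g <= 5/4 (M - K) and is met by S0 near 64 Y and L0 near 100 Y + 4
    log L, where Y = d (1 + (log d) / 3); then 5/4 (M - K) is at most 10^6 d (log L + d log d)(1 +
    log d), which is [irreducible_measure].

    For an algebraic number the passage from |P(pi)| to |pi - xi| costs a factor L d 5^d, absorbed
    by 0.2 of the constant 1.2 ([algebraic_measure]). For a general polynomial the lengths of the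
    irreducible factors multiply to at most 3^d L ([prod_length_le]), which doubles the constant
    ([sum_exponent_le]). *)

Definition lcm_upto (n : nat) : nat := \big[lcmn/1]_(1 <= i < n.+1) i.

Lemma lcm_upto_gt0 n : 0 < lcm_upto n.
Proof.
rewrite /lcm_upto big_nat; elim/big_ind: _ => // [x y x0 y0|i /andP[]//].
by rewrite lcmn_gt0 x0.
Qed.

Lemma dvdn_lcm_upto n i : 0 < i <= n -> i %| lcm_upto n.
Proof.
move=> /andP[i0 ilen]; rewrite /lcm_upto.
rewrite (bigD1_seq i) ?iota_uniq ?mem_index_iota ?i0//=.
exact: dvdn_lcml.
Qed.

Lemma lcm_upto_dvd n m : (forall i, 0 < i <= n -> i %| m) -> lcm_upto n %| m.
Proof.
move=> h; rewrite /lcm_upto big_nat; elim/big_ind: _ => // x y xm ym.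
by rewrite dvdn_lcm xm.
Qed.

Lemma logn_fact_wide p n m : prime p -> n <= m ->
  logn p n`! = \sum_(1 <= k < m.+1) n %/ p ^ k.
Proof.
move=> pp nm; rewrite logn_fact // (big_cat_nat (n := n.+1) (p := m.+1)) //=.
rewrite [X in _ + X]big1_seq ?addn0// => k; rewrite mem_index_iota => /andP[_ /andP[nk _]].
by rewrite divn_small// (leq_trans nk)// ltnW// ltn_expl// prime_gt1.
Qed.

(* For b < p^k <= a + b, Legendre's formula gives the binomial coefficient a *)
(* factor p that lcm(1..b) lacks.                                            *)
Lemma lcm_upto_binomial_dvd a b : a <= b ->
  lcm_upto (a + b) %| lcm_upto b * 'C(a + b, a).
Proof.
move=> ab; apply: lcm_upto_dvd => j /andP[j0 jab].
have C0 : 0 < 'C(a + b, a) by rewrite bin_gt0 leq_addr.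
have l0 := lcm_upto_gt0 b.
apply/dvdn_partP => // p; rewrite mem_primes => /and3P[pp _ _].
rewrite p_part pfactor_dvdn ?muln_gt0 ?l0// lognM//.
set i := logn p j.
have pij : p ^ i <= a + b by rewrite (leq_trans _ jab)// dvdn_leq// pfactor_dvdnn.
have hC : \sum_(1 <= k < (a + b).+1) ((b < p ^ k) && (p ^ k <= a + b))
          <= logn p 'C(a + b, a).
  have := congr1 (logn p) (bin_fact (leq_addr b a)).
  rewrite addKn !lognM ?fact_gt0 ?muln_gt0 ?fact_gt0//.
  rewrite (@logn_fact_wide p a (a + b)) ?leq_addr//.
  rewrite (@logn_fact_wide p b (a + b)) ?leq_addl//.
  rewrite (@logn_fact_wide p (a + b) (a + b))// -big_split/= => e.
  rewrite -(leq_add2r (\sum_(1 <= k < (a + b).+1) (a %/ p ^ k + b %/ p ^ k))).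
  rewrite e -big_split /= leq_sum// => k _.
  have pk : 0 < p ^ k by rewrite expn_gt0 prime_gt0.
  case: (boolP ((b < p ^ k) && _)) => [/andP[bk kab]|_]; last first.
    by rewrite add0n leq_divRL// mulnDl leq_add// leq_trunc_div.
  by rewrite (divn_small (leq_ltn_trans ab bk)) (divn_small bk) divn_gt0.
have [e peb le] : exists2 e, e <= logn p (lcm_upto b) & b < p ^ e.+1.
  have [->|b0] := posnP b; first by exists 0; rewrite ?expn_gt0 ?prime_gt0.
  exists (trunc_log p b); last by rewrite trunc_log_ltn ?prime_gt1.
  rewrite -pfactor_dvdn// dvdn_lcm_upto// trunc_logP ?prime_gt1// andbT.
  by rewrite expn_gt0 prime_gt0.
have [ie|ei] := leqP i e; first by rewrite (leq_trans ie)// (leq_trans peb)// leq_addr.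
rewrite -(subnKC (ltnW ei)) leq_add// (leq_trans _ hC)//.
have iab : i < (a + b).+1 by rewrite ltnS (leq_trans _ pij)// ltnW// ltn_expl// prime_gt1.
rewrite (big_cat_nat (n := e.+1)) ?ltnS//=; last exact: leq_trans ei (ltnW iab).
rewrite (leq_trans _ (leq_addl _ _))//.
rewrite (big_cat_nat (n := i.+1)) ?ltnS ?(ltnW ei)//=.
rewrite (leq_trans _ (leq_addr _ _))//.
rewrite -[X in X <= _]muln1 -subSS -sum_nat_const_nat big_nat_cond [X in _ <= X]big_nat_cond.
apply: leq_sum => k /andP[/andP[ek ki] _].
rewrite lt0b (leq_trans le) ?leq_exp2l ?prime_gt1//= (leq_trans _ pij)//.
by rewrite leq_exp2l ?prime_gt1.
Qed.

(** For b = a the coefficient is one term of the row sum 2^(2a); for b = a + 1 it occurs twice in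
    the row sum 2^(2a+1). *)
Lemma central_binomial_le a b : a <= b <= a.+1 -> 'C(a + b, a) <= 4 ^ a.
Proof.
have sumC n : \sum_(i < n.+1) 'C(n, i) = 2 ^ n.
  rewrite -[2]/(1 + 1) expnDn; apply: eq_bigr => i _.
  by rewrite !exp1n !muln1.
have le1 n i : i <= n -> 'C(n, i) <= 2 ^ n.
  move=> le_in; rewrite -(sumC n) -ltnS in le_in *.
  by rewrite (bigD1 (Ordinal le_in)) //= leq_addr.
have e4 : 4 ^ a = 2 ^ (a + a) by rewrite addnn -mul2n expnM.
rewrite leq_eqVlt => /andP[/orP[/eqP<-|ab] ba]; first by rewrite e4 le1 ?leq_addr.
have -> : b = a.+1 by apply/eqP; rewrite eqn_leq ba.
have h0 : a < (a + a.+1).+1 by lia.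
have h1 : a.+1 < (a + a.+1).+1 by lia.
rewrite -(@leq_pmul2l 2)// e4 -expnS -addnS -(sumC (a + a.+1)).
rewrite (bigD1 (Ordinal h0)) //= (bigD1 (Ordinal h1)) /=; last first.
  by rewrite -val_eqE /= gtn_eqF.
rewrite addnA (leq_trans _ (leq_addr _ _))// mul2n -addnn leq_add2l.
by rewrite -(@bin_sub _ a) ?leq_addr// addKn.
Qed.

(** Halving induction: with a = n/2 rounded down and b = n - a, the left side divides lcm(1..b) C(n,
    a), whose factors are at most 4^b and 4^a. *)
Lemma lcm_upto_le n : lcm_upto n <= 4 ^ n.
Proof.
elim/ltn_ind: n => n IH.
case: (ltnP 1 n) => [n1|]; last first.
  by case: n {IH} => [|[|//]] _; rewrite /lcm_upto; [rewrite big_geq|rewrite big_nat1].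
pose a := n./2; pose b := n - a.
have nE : n = a + b by rewrite subnKC// -leq_double -[n in _ <= n.*2]odd_double_half; lia.
have ab : a <= b by lia.
have C0 : 0 < 'C(a + b, a) by rewrite bin_gt0 leq_addr.
rewrite {1}nE (leq_trans (dvdn_leq _ (lcm_upto_binomial_dvd ab)))//.
  by rewrite muln_gt0 lcm_upto_gt0.
rewrite nE expnD mulnC leq_mul//; last by apply: IH; lia.
by apply: central_binomial_le; lia.
Qed.

(** Common denominator, at integers, for the derivatives of order below [K] of the binomial
    polynomials of degree at most [T]. These denominators are products of fewer than [K] positive
    integers of sum at most [T], the i-th largest of which is at most T/i. *)
Definition denom (T K : nat) : nat := \prod_(1 <= i < K) lcm_upto (T %/ i).

Lemma denom_gt0 T K : 0 < denom T K.
Proof. by apply: prodn_cond_gt0 => i _; exact: lcm_upto_gt0. Qed.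

(* The smallest of j positive integers of sum at most T is at most T / j. *)
Lemma prod_dvd_denom T K (s : seq nat) : all (fun n => 0 < n) s ->
  size s < K -> sumn s <= T -> \prod_(n <- s) n %| denom T K.
Proof.
move=> s0 sK sT.
have -> : denom T K = denom T (size s).+1 * \prod_((size s).+1 <= i < K) lcm_upto (T %/ i).
  by rewrite /denom -big_cat_nat.
apply: dvdn_mulr; move E : (size s) => j {sK}.
elim: j s E s0 sT => [|j IH] s sj s0 sT.
  by rewrite (size0nil sj) big_nil dvd1n.
have [m ms mmin] : exists2 m, m \in s & m * size s <= sumn s.
  have h0 : 0 < size s by rewrite sj.
  have [i _ imin] := @arg_minnP _ (Ordinal h0) xpredT (fun i => nth 0 s i) isT.
  exists (nth 0 s i); first exact: mem_nth.
  rewrite sumnE (big_nth 0) big_mkord mulnC -[X in X * _]card_ord -sum_nat_const.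
  by apply: leq_sum => k _; exact: imin.
rewrite (big_rem m)//= /denom big_nat_recr//= mulnC dvdn_mul//; last first.
  apply: dvdn_lcm_upto; rewrite (allP s0 _ ms)/= leq_divRL//.
  by rewrite -sj (leq_trans mmin).
apply: IH; first by rewrite size_rem// sj.
  by apply/allP => x /mem_rem /(allP s0).
by rewrite (leq_trans _ sT)// (sumnE s) (big_rem m)//= -sumnE leq_addl.
Qed.

Local Open Scope ring_scope.

(** * Binomial polynomials and their derivatives *)

Definition int_valued (F : numFieldType) (x : F) := exists m : int, x = m%:~R.

Definition binp (F : numFieldType) (t : nat) : {poly F} :=
  t`!%:R^-1 *: \prod_(i < t) ('X - i%:R%:P).

Section BinomialPolynomial.
Variable F : numFieldType.
Implicit Types (t n j : nat) (x : F).

Lemma int_valuedB x y : int_valued x -> int_valued y -> int_valued (x - y).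
Proof. by move=> [m ->] [n ->]; exists (m - n); rewrite rmorphB. Qed.

Lemma int_valuedD x y : int_valued x -> int_valued y -> int_valued (x + y).
Proof. by move=> [m ->] [n ->]; exists (m + n); rewrite rmorphD. Qed.

Lemma int_valuedM x y : int_valued x -> int_valued y -> int_valued (x * y).
Proof. by move=> [m ->] [n ->]; exists (m * n); rewrite rmorphM. Qed.

Lemma int_valued_int (m : int) : int_valued (m%:~R : F). Proof. by exists m. Qed.

Lemma int_valued_sum (I : finType) (f : I -> F) :
  (forall i, int_valued (f i)) -> int_valued (\sum_i f i).
Proof.
move=> h; elim/big_ind: _ => //; first exact: (int_valued_int 0).
exact: int_valuedD.
Qed.

Lemma binp0 : binp F 0 = 1.
Proof. by rewrite /binp big_ord0 fact0 invr1 scale1r. Qed.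

Lemma binpS t : t.+1%:R *: binp F t.+1 = binp F t * ('X - t%:R%:P).
Proof.
rewrite /binp big_ord_recr /= factS natrM invfM scalerA mulrA divff ?pnatr_eq0//.
by rewrite mul1r -scalerAl.
Qed.

Lemma size_binp t : size (binp F t) = t.+1.
Proof.
rewrite /binp size_scale ?invr_eq0 ?pnatr_eq0 -?lt0n ?fact_gt0//.
by rewrite size_prod_XsubC /index_enum -enumT size_enum_ord.
Qed.

(** This is D = log(1 + Delta), where the forward difference Delta lowers the index of a binomial
    polynomial by one. The proof differentiates (t+1) binom(z, t+1) = (z - t) binom(z, t). *)
Lemma deriv_binp t : (binp F t)^`() =
  \sum_(n < t) ((-1) ^+ n / n.+1%:R) *: binp F (t - n.+1).
Proof.
elim: t => [|t IH]; first by rewrite binp0 big_ord0 derivC.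
have t0 : t.+1%:R != 0 :> F by rewrite pnatr_eq0.
apply: (scalerI t0); rewrite -derivZ binpS derivM IH derivXsubC mulr1 addrC.
rewrite mulr_suml.
transitivity (binp F t + \sum_(n < t) ((((-1) ^+ n / n.+1%:R) * (t - n)%:R) *: binp F (t - n)
   - (-1) ^+ n *: binp F (t - n.+1))).
  congr (_ + _); apply: eq_bigr => n _.
  have nE : (t - n = (t - n.+1).+1)%N by rewrite subnSK.
  rewrite -scalerAl [in RHS]nE -scalerA binpS.
  set u := (t - n.+1)%N.
  (* The first part of this splitting raises the index through [binpS]; the second cancels the
     denominator n + 1. *)
  have -> : 'X - t%:R%:P = ('X - u%:R%:P) - n.+1%:R%:P :> {poly F}.
    by rewrite -addrA -opprD -polyCD -natrD subnK.
  rewrite mulrBr scalerBr; congr (_ - _).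
  by rewrite [_ * _%:P]mulrC mul_polyC scalerA divfK ?pnatr_eq0.
rewrite big_split /= sumrN addrA addrAC.
have -> : \sum_(n < t) ((-1) ^+ n / n.+1%:R * (t - n)%:R) *: binp F (t - n) =
          \sum_(n < t.+1) ((-1) ^+ n / n.+1%:R * (t - n)%:R) *: binp F (t - n).
  by rewrite big_ord_recr /= subnn mulr0 scale0r addr0.
have -> : binp F t - \sum_(n < t) (-1) ^+ n *: binp F (t - n.+1) =
          \sum_(n < t.+1) (-1) ^+ n *: binp F (t - n).
  rewrite big_ord_recl /= expr0 scale1r subn0; congr (_ + _).
  by rewrite -sumrN; apply: eq_bigr => i _; rewrite exprS mulN1r scaleNr.
rewrite -big_split /= scaler_sumr; apply: eq_bigr => n _.
rewrite -scalerDl [in RHS]scalerA subSS; congr (_ *: binp F _).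
have nt : (n <= t)%N by rewrite -ltnS.
rewrite natrB// -[t.+1%:R]natr1; field.
by rewrite nat1r pnatr_eq0.
Qed.

Lemma binp_pascal t x :
  (binp F t.+1).[x + 1] = (binp F t.+1).[x] + (binp F t).[x].
Proof.
have E : forall y, (\prod_(i < t) ('X - i%:R%:P : {poly F})).[y] = \prod_(i < t) (y - i%:R).
  by move=> y; rewrite horner_prod; apply: eq_bigr => i _; rewrite !hornerE.
have E' : forall y, (\prod_(i < t.+1) ('X - i%:R%:P : {poly F})).[y] = \prod_(i < t.+1) (y - i%:R).
  by move=> y; rewrite horner_prod; apply: eq_bigr => i _; rewrite !hornerE.
rewrite /binp !hornerZ E !E' big_ord_recl [in RHS]big_ord_recr /=.
have -> : \prod_(i < t) (x + 1 - (lift ord0 i)%:R) = \prod_(i < t) (x - i%:R).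
  by apply: eq_bigr => i _; rewrite lift0 -natr1 opprD addrACA [1 - _]subrr addr0.
rewrite factS natrM invfM subr0.
set A := t`!%:R^-1; set P := \prod_(i < t) _.
rewrite -[t.+1%:R]natr1; field.
by rewrite natr1 pnatr_eq0.
Qed.

Lemma binp_at0 t : (binp F t.+1).[0] = 0.
Proof.
by rewrite /binp hornerZ big_ord_recl hornerM hornerXsubC subrr mul0r mulr0.
Qed.

(** Pascal's rule, upwards from 0: each unit step at most doubles the bound, whatever t is. *)
Lemma binp_nat_int t (n : nat) :
  int_valued (binp F t).[n%:R] /\ `|(binp F t).[n%:R]| <= 2 ^+ n.
Proof.
elim: n t => [|n IH] [|t].
- by rewrite binp0 hornerC normr1 expr0; split => //; exact: (int_valued_int 1).
- by rewrite binp_at0 normr0; split; [exact: (int_valued_int 0)|rewrite exprn_ge0].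
- rewrite binp0 hornerC normr1 exprn_ege1 ?ler1n//; split => //.
  exact: (int_valued_int 1).
rewrite -natr1 binp_pascal; split.
  by apply: int_valuedD; [have [] := IH t.+1|have [] := IH t].
rewrite (le_trans (ler_normD _ _))// exprS mulr2n mulrDl !mul1r.
by rewrite lerD ?(IH _).2.
Qed.

Lemma binp_opp_nat_int t (n : nat) :
  int_valued (binp F t).[- n%:R] /\ `|(binp F t).[- n%:R]| <= 2 ^+ (t + n).
Proof.
elim: n t => [|n IH] t.
  rewrite oppr0 addn0; have [h1 h2] := binp_nat_int t 0; split => //.
  by rewrite (le_trans h2)// ler_weXn2l ?ler1n.
elim: t => [|t [IH1 IH2]].
  rewrite binp0 hornerC normr1 exprn_ege1 ?ler1n//; split => //.
  exact: (int_valued_int 1).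
have := binp_pascal t (- n.+1%:R).
have -> : - n.+1%:R + 1 = - n%:R :> F by rewrite -natr1 opprD addrNK.
have [h1 h2] := IH t.+1 => e.
have -> : (binp F t.+1).[- n.+1%:R] = (binp F t.+1).[- n%:R] - (binp F t).[- n.+1%:R].
  by rewrite e addrK.
split; first exact: int_valuedB.
rewrite (le_trans (ler_normB _ _))// addnS exprS mulr2n mulrDl !mul1r addSnnS.
by rewrite lerD// addnS -addSn.
Qed.

Lemma binp_int t (z : int) :
  int_valued (binp F t).[z%:~R] /\ `|(binp F t).[z%:~R]| <= 2 ^+ (t + `|z|).
Proof.
case: (intP z) => [|n|n].
- have [h1 h2] := binp_nat_int t 0; split => //.
  by rewrite (le_trans h2)// ler_weXn2l ?ler1n.
- have [h1 h2] := binp_nat_int t n.+1; split => //.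
  by rewrite (le_trans h2)// ler_weXn2l ?ler1n// leq_addl.
- have := binp_opp_nat_int t n.+1; rewrite abszN /= mulrNz; exact.
Qed.

(** Iterating [deriv_binp] writes the j-th derivative as a signed sum of binom(z, t - n_1 - ... -
    n_j) / (n_1 ... n_j), so it suffices that every product n_1 ... n_j divides m. The induction
    uses up one factor at a time. *)
Lemma binp_derivn_int j t (m : nat) (z : int) :
  (forall s : seq nat, all (fun n => 0 < n)%N s -> (size s <= j)%N ->
     (sumn s <= t)%N -> (\prod_(n <- s) n %| m)%N) ->
  int_valued (m%:R * (binp F t)^`(j).[z%:~R]).
Proof.
elim: j t m => [|j IH] t m mP; first by rewrite derivn0; apply: int_valuedM;
  [exact: (int_valued_int m) | have [] := binp_int t z].
rewrite derivSn deriv_binp linear_sum horner_sum mulr_sumr.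
apply: int_valued_sum => n.
rewrite linearZ /= hornerZ.
have nm : (n.+1 %| m)%N.
  by have := mP [:: n.+1]; rewrite big_seq1 /= addn0 ltn_ord; apply.
set b := horner _ _.
have -> : m%:R * ((-1) ^+ n / n.+1%:R * b) = (-1) ^+ n * ((m %/ n.+1)%:R * b).
  rewrite -[in LHS](divnK nm) natrM; field.
  by rewrite nat1r pnatr_eq0.
apply: int_valuedM.
  by exists ((-1) ^+ n); rewrite rmorphXn rmorphN1.
apply: IH => s s0 sj st.
rewrite dvdn_divRL//; have := mP (n.+1 :: s); rewrite /= s0 big_cons mulnC; apply => //.
by rewrite -leq_subRL.
Qed.

Lemma sum_half_pow_le t : \sum_(n < t) 2 ^+ (t - n.+1) <= 2 ^+ t :> F.
Proof.
elim: t => [|t IH]; first by rewrite big_ord0.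
rewrite big_ord_recl /= subn1 /= exprS mulr2n mulrDl mul1r lerD2l.
exact: IH.
Qed.

(** In [deriv_binp] the weights are at most 1 in absolute value and the powers 2^(t-n-1) sum to at
    most 2^t, so differentiation does not worsen the bound for binom(z, t) itself. *)
Lemma binp_derivn_le j t (z : int) :
  `|(binp F t)^`(j).[z%:~R]| <= 2 ^+ (t + `|z|).
Proof.
elim: j t => [|j IH] t; first by rewrite derivn0 (binp_int t z).2.
rewrite derivSn deriv_binp linear_sum horner_sum (le_trans (ler_norm_sum _ _ _))//.
rewrite exprD (le_trans _ (ler_wpM2r _ (sum_half_pow_le t))) ?exprn_ge0//.
rewrite mulr_suml ler_sum// => n _; rewrite linearZ /= hornerZ normrM -exprD.
rewrite -[leRHS]mul1r ler_pM// normrM normrX normrN1 expr1n mul1r.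
by rewrite ger0_norm ?invr_ge0// invf_le1 ?ler1n ?ltr0n.
Qed.

End BinomialPolynomial.

(** * The pigeonhole principle *)

Local Open Scope ring_scope.

(** Dirichlet's box principle: two of the (H+1)^|A| vectors with entries in 0..H fall into the same
    of (q+1)^m boxes, and [p] is their difference. *)
Lemma small_linear_forms (R : archiRealFieldType) (A : finType) (m H q : nat)
    (u : 'I_m -> A -> R) (B : R) :
  0 < B -> (forall i, \sum_a `|u i a| <= B) -> (0 < q)%N ->
  (q.+1 ^ m < H.+1 ^ #|A|)%N ->
  exists p : A -> int, [/\ exists a, p a != 0, forall a, `|p a| <= H%:Z &
    forall i, `|\sum_a (p a)%:~R * u i a| <= H%:R * B / q%:R].
Proof.
move=> B0 uB q0 cardH.
have H0 : (0 < H)%N.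
  by case: H cardH => //; rewrite exp1n ltnNge expn_gt0.
have HB0 : 0 < H%:R * B by rewrite mulr_gt0 ?ltr0n.
have q0' : 0 < q%:R :> R by rewrite ltr0n.
(* Shifting by the negative parts makes every value lie in [0, H B]. *)
pose y (v : {ffun A -> 'I_H.+1}) i : R :=
  \sum_a ((v a)%:R * u i a + H%:R * ((`|u i a| - u i a) / 2)).
have y_itv v i : 0 <= y v i <= H%:R * B.
  have vH a : 0 <= (v a)%:R :> R /\ (v a)%:R <= H%:R :> R.
    by rewrite ler0n ler_nat -ltnS ltn_ord; split.
  apply/andP; split.
    apply: sumr_ge0 => a _; have [v1 v2] := vH a.
    by case: (ger0P (u i a)) => ua; nra.
  rewrite (le_trans _ (ler_wpM2l (ler0n _ _) (uB i)))// mulr_sumr ler_sum// => a _.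
  have [v1 v2] := vH a.
  by case: (ger0P (u i a)) => ua; nra.
pose z v i := y v i * q%:R / (H%:R * B).
have z_itv v i : 0 <= z v i <= q%:R.
  have /andP[y1 y2] := y_itv v i.
  apply/andP; split; first by rewrite divr_ge0 ?mulr_ge0// ltW.
  by rewrite /z ler_pdivrMr// mulrC ler_wpM2l// ltW.
(* Truncation of a value in [0, q] gives one of q + 1 integers, the endpoint q included. *)
pose box v : {ffun 'I_m -> 'I_q.+1} := [ffun i => inord (Num.truncn (z v i))].
have /injectivePn[v [w vw bvw]] : ~~ injectiveb box.
  apply/negP => /injectiveP/leq_card; rewrite !card_ffun !card_ord.
  by rewrite leqNgt cardH.
exists (fun a => (v a)%:Z - (w a)%:Z); split.
- apply/existsP; rewrite -negb_forall; apply: contra vw => /forallP h.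
  apply/eqP/ffunP => a; apply/val_inj; have := h a.
  by rewrite subr_eq0 => /eqP [].
- by move=> a; have := ltn_ord (v a); have := ltn_ord (w a); lia.
move=> i; have -> : \sum_a ((v a)%:Z - (w a)%:Z)%:~R * u i a = y v i - y w i.
  rewrite /y -sumrB; apply: eq_bigr => a _.
  by rewrite rmorphB /= !pmulrn; ring.
have zE s : y s i = z s i * (H%:R * B) / q%:R.
  by rewrite /z; field; rewrite !gt_eqF// ltr0n.
have /andP[zv0 zvq] := z_itv v i; have /andP[zw0 zwq] := z_itv w i.
have zvw : `|z v i - z w i| <= 1.
  have := congr1 (fun f : {ffun _ -> _} => val (f i)) bvw; rewrite /= !ffunE.
  have tq s : (Num.truncn (z s i) < q.+1)%N.
    have /andP[zs0 zsq] := z_itv s i.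
    by rewrite ltnS -(ler_nat R) (le_trans _ zsq)// truncn_le.
  rewrite !inordK ?tq// => e.
  have /andP[a1 a2] := truncn_itv zv0; have /andP[b1 b2] := truncn_itv zw0.
  rewrite e -natr1 in a1 a2; rewrite -natr1 in b2.
  by rewrite ler_norml; lra.
have -> : y v i - y w i = (z v i - z w i) * (H%:R * B / q%:R).
  by rewrite !zE -!(mulrA _ (H%:R * B)) -mulrBl.
rewrite normrM [X in _ * X]ger0_norm; last by rewrite divr_ge0// ltW.
by rewrite -[leRHS]mul1r ler_wpM2r// divr_ge0// ltW.
Qed.

(** * Zero estimate *)

Section ZeroEstimate.
Variable C : numFieldType.
Implicit Types (p q g h : {poly C}) (F G : {poly {poly C}}).

Definition theta p : {poly C} := 'X * p^`().

Lemma coef_theta p i : (theta p)`_i = p`_i *+ i.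
Proof. by rewrite /theta coefXM; case: i => [|i]; rewrite ?mulr0n// coef_deriv. Qed.

Lemma thetaM p q : theta (p * q) = theta p * q + p * theta q.
Proof. by rewrite /theta derivM; ring. Qed.

Lemma theta0 : theta 0 = 0.
Proof. by rewrite /theta deriv0 mulr0. Qed.

Lemma size_theta p : (size (theta p) <= size p)%N.
Proof.
by apply/leq_sizeP => i /leq_sizeP h; rewrite coef_theta h ?mul0rn.
Qed.

(* The derivation Y d/dY + c d/dX, with X the outer and Y the inner variable. *)
Definition dxy (c : C) F : {poly {poly C}} :=
  \poly_(k < size F) theta F`_k + c%:P *: F^`().

Variable c : C.

Lemma coef_dxy F k : (dxy c F)`_k = theta F`_k + c *: F`_k.+1 *+ k.+1.
Proof.
rewrite coefD coef_poly coefZ coef_deriv mul_polyC; congr (_ + _).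
  by case: ltnP => // /leq_sizeP ->; rewrite ?theta0.
by rewrite scalerMnr.
Qed.

Lemma dxyZ p F : dxy c (p *: F) = theta p *: F + p *: dxy c F.
Proof.
apply/polyP => k; rewrite coef_dxy !coefD !coefZ coef_dxy thetaM -addrA; congr (_ + _).
by rewrite mulrDr mulrnAr scalerAr.
Qed.

Lemma dxyD F G : dxy c (F + G) = dxy c F + dxy c G.
Proof.
apply/polyP => k; rewrite coefD !coef_dxy !coefD /theta derivD mulrDr scalerDr mulrnDl.
by rewrite addrACA.
Qed.

Lemma dxy0 : dxy c 0 = 0.
Proof. by apply/polyP => k; rewrite coef_dxy !coef0 theta0 scaler0 mul0rn addr0. Qed.

Lemma dxy_sum (I : finType) (f : I -> {poly {poly C}}) :
  dxy c (\sum_i f i) = \sum_i dxy c (f i).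
Proof. exact: (big_morph _ dxyD dxy0). Qed.

Lemma size_dxy F : (size (dxy c F) <= size F)%N.
Proof.
apply/leq_sizeP => k /leq_sizeP hk.
by rewrite coef_dxy !hk ?theta0 ?scaler0 ?mul0rn ?addr0// ltnW.
Qed.

Lemma size_iter_dxy F j : (size (iter j (dxy c) F) <= size F)%N.
Proof. by elim: j => //= j IH; exact: leq_trans (size_dxy _) IH. Qed.

Lemma size_coef_dxy F L : (forall k, size (F`_k)%R <= L)%N ->
  forall k, (size ((dxy c F)`_k)%R <= L)%N.
Proof.
move=> FL k; rewrite coef_dxy (leq_trans (size_polyD _ _))// geq_max.
rewrite (leq_trans (size_theta _))//= -scaler_nat.
by rewrite (leq_trans (size_scale_leq _ _))// (leq_trans (size_scale_leq _ _)).
Qed.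

Lemma size_coef_iter_dxy F L j : (forall k, size (F`_k)%R <= L)%N ->
  forall k, (size ((iter j (dxy c) F)`_k)%R <= L)%N.
Proof. by move=> FL; elim: j => //= j IH; exact: size_coef_dxy. Qed.

Lemma coefM_top (R : nzRingType) (p q : {poly R}) m n :
  (size p <= m.+1)%N -> (size q <= n.+1)%N -> (p * q)`_(m + n) = p`_m * q`_n.
Proof.
move=> /leq_sizeP pm /leq_sizeP qn; rewrite coefM.
have mlt : (m < (m + n).+1)%N by rewrite ltnS leq_addr.
rewrite (bigD1 (Ordinal mlt))//= addKn big1 ?addr0// => i.
rewrite -val_eqE /= => im; have [mi|mi] := ltnP m i; first by rewrite pm ?mul0r.
by rewrite qn ?mulr0//; lia.
Qed.

(* This is the fact that the logarithm is not a rational function: *)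
(* c + Y (h/g)' vanishes for no g, h.                             *)
Lemma log_not_rational (a : C) g h : a != 0 -> g != 0 ->
  a *: g ^+ 2 + (g * theta h - theta g * h) != 0.
Proof.
move=> a0 g0; apply/eqP => e0.
have [m sg] : exists m, size g = m.+1.
  by exists (size g).-1; rewrite prednK// size_poly_gt0.
have gm : g`_m != 0 by rewrite -[m]/(m.+1.-1) -sg -lead_coefE lead_coef_eq0.
have sg' : (size g <= m.+1)%N by rewrite sg.
have stg : (size (theta g) <= m.+1)%N by rewrite -sg size_theta.
(* If deg h <= m = deg g, the coefficient of Y^(2m) is a g_m^2, since the two products contribute m
   g_m h_m with opposite signs. If n = deg h > m, the coefficient of Y^(m+n) is (n - m) g_m h_n. *)
have [hm|hm] := leqP (size h) m.+1.
  have := congr1 (fun p => p`_(m + m)) e0; rewrite !coefE expr2.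
  rewrite !coefM_top ?(leq_trans (size_theta h) hm)//.
  rewrite !coef_theta mulrnAl mulrnAr subrr addr0 => /eqP.
  by rewrite !mulf_eq0 (negPf a0) (negPf gm).
have [n sh mn] : exists2 n, size h = n.+1 & (m < n)%N.
  by exists (size h).-1; lia.
have hn : h`_n != 0.
  by rewrite -[n]/(n.+1.-1) -sh -lead_coefE lead_coef_eq0 -size_poly_gt0 sh.
have := congr1 (fun p => p`_(m + n)) e0; rewrite !coefE expr2.
rewrite !coefM_top ?sh -?sh ?size_theta//; last first.
  by rewrite sg sh; apply: leq_trans mn _.
rewrite !coef_theta [g`_n]nth_default ?sg// !mulr0 add0r mulrnAl mulrnAr -mulrnBr 1?ltnW//.
move=> /eqP; rewrite mulrn_eq0 mulf_eq0 (negPf gm) (negPf hn) orbF subn_eq0.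
by rewrite leqNgt mn.
Qed.


(** Elimination of the top power of X. If G has top coefficients g and h in X-degrees n+1 and n,
    then g DG - (theta g) G loses exactly one degree: its new leading coefficient is c(n+1) g^2 + g
    theta h - h theta g, nonzero by [log_not_rational]. *)
Lemma dxy_descent F m : c != 0 -> size F = m.+1 -> forall i, (i <= m)%N ->
  exists b : nat -> {poly C},
    size (\sum_(j < i.+1) b j *: iter j (dxy c) F) = (m.+1 - i)%N.
Proof.
move=> c0 sF; elim=> [|i IH] im.
  by exists (fun=> 1) => //; rewrite big_ord1 scale1r.
have [b sG] := IH (ltnW im).
set G := \sum_(j < i.+1) _ in sG.
have [n mi] : exists n, (m.+1 - i = n.+2)%N by exists (m - i.+1)%N; lia.
rewrite mi in sG.
pose g := G`_n.+1; pose h := G`_n.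
have g0 : g != 0.
  rewrite /g -[n.+1]/(n.+2.-1) -sG -lead_coefE lead_coef_eq0.
  by rewrite -size_poly_gt0 sG.
pose G' := g *: dxy c G - theta g *: G.
have sG' : size G' = n.+1.
  have top k : G'`_k = g * ((theta G`_k) + c *: G`_k.+1 *+ k.+1) - theta g * G`_k.
    by rewrite coefB !coefZ coef_dxy.
  apply/eqP; rewrite eqn_leq; apply/andP; split.
    apply/leq_sizeP => k; rewrite leq_eqVlt => /orP[/eqP<-|nk].
      by rewrite top [G`_n.+2]nth_default ?sG// scaler0 mul0rn addr0 -/g mulrC subrr.
    by rewrite top !(nth_default 0) ?sG ?(leq_trans nk)// theta0 scaler0 mul0rn addr0 !mulr0 subrr.
  rewrite ltnNge; apply/negP => /leq_sizeP/(_ n (leqnn _)).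
  rewrite top -/g -/h => e.
  have := @log_not_rational (c *+ n.+1) g h _ g0.
  rewrite mulrn_eq0 (negPf c0) => /(_ isT)/eqP; apply; rewrite -[RHS]e.
  by rewrite mulrDr -scalerMnl expr2 mulrnAr -scalerAr addrC addrAC.
exists (fun j => g * ((if (j <= i)%N then theta (b j) else 0) + (if j is j'.+1 then b j' else 0))
   - theta g * (if (j <= i)%N then b j else 0)) => //.
rewrite subnS mi /= -sG'; congr (size (polyseq _)).
have GE : \sum_(j < i.+2) (if (j <= i)%N then b j else 0) *: iter j (dxy c) F = G.
  rewrite big_ord_recr /= ltnn scale0r addr0 /G; apply: eq_bigr => j _.
  by rewrite -ltnS ltn_ord.
have DGE : dxy c G = \sum_(j < i.+2)
   ((if (j <= i)%N then theta (b j) else 0) + (if nat_of_ord j is j'.+1 then b j' else 0)) *: iter j (dxy c) F.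
  rewrite /G dxy_sum; under eq_bigr do rewrite dxyZ.
  rewrite big_split /=; under [RHS]eq_bigr do rewrite scalerDl.
  rewrite big_split /=; congr (_ + _).
    rewrite [RHS]big_ord_recr /= ltnn scale0r addr0; apply: eq_bigr => j _.
    by rewrite -ltnS ltn_ord.
  by rewrite [RHS]big_ord_recl /= scale0r add0r.
rewrite /G' DGE -[X in _ - _ *: X]GE !scaler_sumr -sumrB; by under [RHS]eq_bigr do rewrite !scalerA -scalerBl.
Qed.

Definition dxy_mx n F : 'M[{poly C}]_n := \matrix_(j, k) (iter j (dxy c) F)`_k.

(** The combinations produced by [dxy_descent] have sizes 1, ..., m+1, so some left multiple of the
    matrix is triangular with nonzero diagonal. *)
Lemma det_dxy_mx_neq0 F : c != 0 -> \det (dxy_mx (size F) F) != 0.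
Proof.
move=> c0; case: (posnP (size F)) => [->|]; first by rewrite det_mx00 oner_neq0.
case E : (size F) => [//|m] _.
have /fin_all_exists[b hb] (i : 'I_m.+1) : exists b : nat -> {poly C},
    size (\sum_(j < m.+1) b j *: iter j (dxy c) F) = i.+1.
  have im : (m - i <= m)%N by rewrite leq_subr.
  have [b sG] := dxy_descent c0 E im.
  exists (fun j => if (j <= m - i)%N then b j else 0).
  have <- : (m.+1 - (m - i) = i.+1)%N by have := ltn_ord i; lia.
  rewrite -sG; congr (size (polyseq _)).
  rewrite (big_ord_widen m.+1 (fun j => b j *: iter j (dxy c) F)) ?ltnS//.
  rewrite [RHS]big_mkcond; apply: eq_bigr => j _; rewrite ltnS.
  by case: ifP => // _; rewrite scale0r.
pose G (i : 'I_m.+1) := \sum_(j < m.+1) b i j *: iter j (dxy c) F.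
have sG i : size (G i) = i.+1 by rewrite /G.
pose Gam : 'M[{poly C}]_m.+1 := \matrix_(i, k) (G i)`_k.
have GamE : Gam = (\matrix_(i, j) b i j : 'M[{poly C}]_m.+1) *m dxy_mx m.+1 F.
  apply/matrixP => i k; rewrite !mxE /G coef_sum; apply: eq_bigr => j _.
  by rewrite !mxE coefZ.
have : \det Gam != 0.
  rewrite det_trig; last first.
    by apply/is_trig_mxP => i k ik; rewrite mxE nth_default// sG.
  apply/prodf_neq0 => i _; rewrite mxE.
  have -> : (G i)`_i = lead_coef (G i) by rewrite lead_coefE sG.
  by rewrite lead_coef_eq0 -size_poly_gt0 sG.
by rewrite GamE det_mulmx mulf_eq0 negb_or => /andP[_].
Qed.

Lemma size_det_le n L (A : 'M[{poly C}]_n) :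
  (forall i j, size (A i j) <= L.+1)%N -> (size (\det A) <= (n * L).+1)%N.
Proof.
move=> AL; apply: (big_ind (fun p => size p <= (n * L).+1)%N) => [|p q hp hq|s _].
- by rewrite size_poly0.
- by rewrite (leq_trans (size_polyD _ _))// geq_max hp.
rewrite -signr_odd; have -> : forall (b : bool) (p : {poly C}), size ((-1) ^+ b * p) = size p.
  by case=> p; rewrite ?expr1 ?mulN1r ?size_polyN// expr0 mul1r.
rewrite (leq_trans (size_prod_leq _ _))// card_ord.
rewrite leq_subLR addnS ltnS -mulnS -[X in (_ <= X * _)%N]card_ord -sum_nat_const.
exact: leq_sum.
Qed.

Lemma dvdp_exp_deriv p k : root p 1 ->
  ('X - 1%:P) ^+ k %| p^`() -> ('X - 1%:P) ^+ k.+1 %| p.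
Proof.
move=> p1; elim: k => [|k IH] dk; first by rewrite expr1 dvdp_XsubCl.
have /IH/dvdpP[s sE] : ('X - 1%:P) ^+ k %| p^`().
  by apply: dvdp_trans dk; rewrite exprS dvdp_mull.
move: dk; rewrite sE derivM deriv_exp derivXsubC mul1r /=.
have -> : s^`() * ('X - 1%:P) ^+ k.+1 + s * (('X - 1%:P) ^+ k *+ k.+1) =
   (s^`() * ('X - 1%:P) + s *+ k.+1) * ('X - 1%:P) ^+ k :> {poly C}.
  by move: ('X - 1%:P) => u; rewrite exprS mulrDl mulrA mulrnAl mulrnAr.
rewrite exprS dvdp_mul2r ?expf_neq0 ?polyXsubC_eq0//.
rewrite (dvdp_addr _ (dvdp_mull _ (dvdpp _))) -scaler_nat dvdpZr ?pnatr_eq0// => us.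
by rewrite [_ ^+ k.+2]exprS [_ ^+ k.+1]exprS dvdp_mul.
Qed.

(** The witness is the Taylor polynomial of log Y at 1: Y times its derivative is a geometric sum
    equal to 1 - (1 - Y)^T. *)
Lemma truncated_log T : exists ell : {poly C},
  ell.[1] = 0 /\ ('X - 1%:P) ^+ T %| theta ell - 1.
Proof.
exists (\sum_(k < T) ((-1) ^+ k / k.+1%:R) *: ('X - 1%:P) ^+ k.+1); split.
  rewrite horner_sum big1// => k _.
  by rewrite hornerZ horner_exp hornerXsubC subrr expr0n mulr0.
have -> : theta (\sum_(k < T) ((-1) ^+ k / k.+1%:R) *: ('X - 1%:P) ^+ k.+1)
   = 1 - (- ('X - 1%:P)) ^+ T.
  rewrite /theta linear_sum /= -[RHS]opprB subrX1 -mulNr; congr (_ * _).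
    by rewrite opprB opprK addrCA subrr addr0.
  apply: eq_bigr => k _; rewrite derivZ deriv_exp derivXsubC mul1r /=.
  rewrite -[('X - 1%:P) ^+ k *+ _]scaler_nat scalerA divfK ?pnatr_eq0// [in RHS]exprNn -mul_polyC.
  by rewrite polyC_exp polyCN.
by rewrite addrAC subrr add0r dvdpNr exprNn dvdp_mull.
Qed.

Lemma dxyMXaddC G p :
  dxy c (G * 'X + p%:P) = dxy c G * 'X + c%:P *: G + (theta p)%:P.
Proof.
apply/polyP => k; rewrite coef_dxy !coefD !coefMX !coefC coefZ mul_polyC.
case: k => [|k] /=; first by rewrite !add0r addr0 addrC.
rewrite !addr0 coef_dxy -addrA; congr (_ + _).
by rewrite [in LHS]mulrSr.
Qed.

(** Chain rule along the curve X = a(Y). The last term measures how far the curve is from an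
    integral curve of the derivation, for which Y a' = c. *)
Lemma theta_horner G a :
  theta G.[a] = (dxy c G).[a] + G^`().[a] * (theta a - c%:P).
Proof.
elim/poly_ind: G => [|G p IH].
  by rewrite !horner0 dxy0 deriv0 !horner0 theta0 mul0r addr0.
rewrite dxyMXaddC derivMXaddC; move: (dxy c G) IH => dG IH; rewrite !hornerE.
have thetaD (q1 q2 : {poly C}) : theta (q1 + q2) = theta q1 + theta q2.
  by rewrite /theta derivD mulrDr.
by rewrite thetaD thetaM IH; ring.
Qed.

Lemma horner_hornerC G a (y : C) : G.[a].[y] = G.[(a.[y])%:P].[y].
Proof.
elim/poly_ind: G => [|G p IH]; first by rewrite !horner0.
by rewrite !hornerE IH.
Qed.

(** X = x + c ell(Y) is an integral curve of the derivation through (x, 1) up to order T in Y - 1.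
    Descending induction on j: the restriction of D^j F vanishes at Y = 1, and applying [theta] to
    it gives the restriction of D^(j+1) F modulo (Y-1)^T, so each derivation costs one order of
    contact. *)
Lemma vanishing_along_leaf F (x : C) T ell :
  ell.[1] = 0 -> ('X - 1%:P) ^+ T %| theta ell - 1 ->
  (forall t, (t < T)%N -> (iter t (dxy c) F).[x%:P].[1] = 0) ->
  forall j, (j <= T)%N ->
    ('X - 1%:P) ^+ (T - j) %| (iter j (dxy c) F).[x%:P + c *: ell].
Proof.
move=> ell1 dell van j; move: {2}(T - j)%N (erefl (T - j)%N) => n.
elim: n j => [|n IH] j nE jT; first by rewrite nE expr0 dvd1p.
have jlt : (j < T)%N by lia.
rewrite nE; apply: dvdp_exp_deriv.
  rewrite /root horner_hornerC !hornerE ell1 mulr0 addr0.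
  by rewrite van.
have jn : (T - j.+1 = n)%N by lia.
have step : ('X - 1%:P) ^+ n %| theta (iter j (dxy c) F).[x%:P + c *: ell].
  rewrite theta_horner dvdp_add//; first by rewrite -jn -iterS IH.
  apply: dvdp_mull; apply: dvdp_trans (_ : _ %| ('X - 1%:P) ^+ T) _.
    by apply: dvdp_exp2l; lia.
  have -> : theta (x%:P + c *: ell) - c%:P = c *: (theta ell - 1).
    rewrite /theta derivD derivC add0r derivZ -scalerAr scalerBr.
    by rewrite -[c *: 1]mul_polyC mulr1.
  by rewrite -mul_polyC dvdp_mull.
move: step; rewrite /theta Gauss_dvdpr// coprimep_expl// coprimep_sym.
by rewrite coprimep_XsubC /root hornerX oner_neq0.
Qed.

(** Multiplication by Vandermonde columns in the points x_i + c ell(Y) turns columns of the matrix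
    into restrictions of the D^j F, j < size F, to the curves through (x_i, 1); each such column is
    divisible by (Y-1)^(T - size F + 1). The Vandermonde determinant is a nonzero constant because
    ell cancels in the differences. *)
Lemma dxy_mx_det_dvd F (x : seq C) T : uniq x -> (size x <= size F)%N ->
  (size F <= T.+1)%N ->
  (forall y, y \in x -> forall t, (t < T)%N -> (iter t (dxy c) F).[y%:P].[1] = 0) ->
  ('X - 1%:P) ^+ (size x * (T - (size F).-1)) %| \det (dxy_mx (size F) F).
Proof.
move=> ux xF FT van; set n := size F; set r := size x.
have [ell [ell1 dell]] := truncated_log T.
have [n' nE] : exists n', n = (r + n')%N by exists (n - r)%N; rewrite subnKC.
have sF j : (size (iter j (dxy c) F) <= r + n')%N by rewrite -nE size_iter_dxy.
rewrite nE; set s := (T - _)%N.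
pose a : 'rV[{poly C}]_r := \row_i ((nth 0 x i)%:P + c *: ell).
pose V : 'M[{poly C}]_(r + n') := row_mx (Vandermonde (r + n') a) (col_mx 0 1%:M).
have detV : exists2 v : C, v != 0 & \det V = v%:P.
  have -> : V = block_mx (Vandermonde r a) 0 (\matrix_(i, j) a 0 j ^+ (r + i)) 1%:M.
    rewrite /V block_mxEh; congr row_mx; apply/matrixP => i j; rewrite !mxE.
    by case: splitP => k ik; rewrite !mxE ik.
  rewrite det_lblock det1 mulr1 det_Vandermonde.
  exists (\prod_(i < r) \prod_(j < r | (i < j)%N) (nth 0 x j - nth 0 x i)).
    apply/prodf_neq0 => i _; apply/prodf_neq0 => j ij.
    by rewrite subr_eq0 nth_uniq// neq_ltn ij orbT.
  rewrite rmorph_prod; apply: eq_bigr => i _; rewrite rmorph_prod.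
  by apply: eq_bigr => j _; rewrite !mxE rmorphB /= opprD addrACA subrr addr0.
have [v v0 vE] := detV.
set A := dxy_mx _ F.
pose e : 'rV[{poly C}]_(r + n') := \row_i (if (i < r)%N then ('X - 1%:P) ^+ s else 1).
have AVdvd i j : e 0 j %| (A *m V) i j.
  rewrite mxE; case: ltnP => jr; last exact: dvd1p.
  have -> : (A *m V) i j = (iter i (dxy c) F).[(nth 0 x j)%:P + c *: ell].
    rewrite (horner_coef_wide _ (sF i)) mxE; apply: eq_bigr => k _.
    rewrite !mxE; case: splitP => l lE; first by rewrite !mxE lE.
    by rewrite lE ltnNge leq_addr in jr.
  apply: dvdp_trans (_ : _ %| ('X - 1%:P) ^+ (T - i)) _.
    by apply: dvdp_exp2l; rewrite /s; have := ltn_ord i; lia.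
  apply: vanishing_along_leaf => //; last by have := ltn_ord i; lia.
  by apply: van; rewrite mem_nth.
have AVE : A *m V = (\matrix_(i, j) ((A *m V) i j %/ e 0 j)) *m diag_mx e.
  by apply/matrixP => i j; rewrite mul_mx_diag [RHS]mxE [X in _ = X * _]mxE divpK// AVdvd.
have := congr1 determinant AVE; rewrite !det_mulmx det_diag vE => dE.
have : ('X - 1%:P) ^+ (r * s) %| \det A * v%:P.
  rewrite dE dvdp_mull// big_split_ord /=.
  rewrite [X in X * _](eq_bigr (fun=> ('X - 1%:P) ^+ s)); last first.
    by move=> i _; rewrite mxE /= ltn_ord.
  by rewrite prodr_const card_ord -exprM mulnC dvdp_mulr.
by rewrite mulrC mul_polyC dvdpZr.
Qed.

(* The determinant of the first n = size F derivatives of F has degree at    *)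
(* most n L in Y; it vanishes at Y = 1 once per vanishing condition, up to a *)
(* loss of n orders at each point.                                           *)
Lemma zero_estimate F (x : seq C) T L : c != 0 -> F != 0 -> uniq x ->
  (forall k, size (F`_k)%R <= L.+1)%N -> (size F <= T.+1)%N ->
  (forall y, y \in x -> forall t, (t < T)%N -> (iter t (dxy c) F).[y%:P].[1] = 0) ->
  (minn (size x) (size F) * (T - (size F).-1) <= size F * L)%N.
Proof.
move=> c0 F0 ux FL FT van.
pose x' := take (size F) x.
have sx' : size x' = minn (size x) (size F).
  by rewrite size_take minnC /minn.
have dvd : ('X - 1%:P) ^+ (size x' * (T - (size F).-1)) %| \det (dxy_mx (size F) F).
  apply: dxy_mx_det_dvd => //; first exact: take_uniq.
    by rewrite sx' geq_minr.
  by move=> y /mem_take; exact: van.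
have := dvdp_leq (det_dxy_mx_neq0 _ c0) dvd.
rewrite size_exp_XsubC sx' => h.
rewrite -ltnS (leq_trans h)// size_det_le// => i j.
by rewrite mxE size_coef_iter_dxy.
Qed.

End ZeroEstimate.

(** * Differential operators on exponential polynomials *)

Section Twist.
Variables (C : numFieldType) (c : C).
Implicit Types (x a w : C) (B G p q : {poly C}) (F : {poly {poly C}}).

(* (x + c d/dz)^k B: evaluated at l it is the value at (x, 1) of             *)
(* B(Y d/dY + c d/dX) applied to X^k Y^l.                                    *)
Definition twist x k B : {poly C} := iter k (fun B => x *: B + c *: B^`()) B.

Lemma twistD x k p q : twist x k (p + q) = twist x k p + twist x k q.
Proof.
by elim: k => //= k ->; rewrite derivD !scalerDr addrACA.
Qed.

Lemma twistZ x k a p : twist x k (a *: p) = a *: twist x k p.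
Proof.
by elim: k => //= k ->; rewrite derivZ scalerDr !scalerA ![a * _]mulrC.
Qed.

Lemma twistE x k B :
  twist x k B = \sum_(j < k.+1) ('C(k, j)%:R * x ^+ (k - j) * c ^+ j) *: B^`(j).
Proof.
elim: k => [|k IH]; first by rewrite big_ord1 bin0 !expr0 !mulr1 scale1r.
rewrite /twist iterS -/(twist x k B) IH.
rewrite [in X in _ + X](linear_sum deriv) !scaler_sumr.
rewrite [in RHS]big_ord_recl /= bin0 subn0 expr0 mulr1 mul1r.
under [in RHS]eq_bigr => j _ do
  rewrite /= binS natrD !mulrDl scalerDl.
rewrite big_split /= addrA; congr (_ + _).
  rewrite big_ord_recl /= bin0 subn0 expr0 mulr1 mul1r scalerA -exprS.
  congr (_ + _); rewrite [in RHS]big_ord_recr /= bin_small// !mul0r scale0r addr0.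
  apply: eq_bigr => j _; rewrite ?lift0 scalerA; congr (_ *: _).
  have jk : (k - j = (k - j.+1).+1)%N by rewrite subnSK.
  by rewrite subSS jk exprS; ring.
apply: eq_bigr => j _; rewrite linearZ /= -derivnS scalerA; congr (_ *: _).
by rewrite subSS exprS; ring.
Qed.

(** The commutator of x + c d/dz with multiplication by z is the constant c. *)
Lemma twist_MXaddC x k a B : twist x k (('X + a%:P) * B) =
  ('X + a%:P) * twist x k B + (k%:R * c) *: twist x k.-1 B.
Proof.
elim: k => [|k IH]; first by rewrite mul0r scale0r addr0.
rewrite /twist iterS -/(twist x k _) IH /= -/(twist x k B).
rewrite derivD derivM derivD derivX derivC addr0 mul1r derivZ.
set p := twist x k B.
have pE : k%:R *: p = k%:R *: (x *: twist x k.-1 B + c *: (twist x k.-1 B)^`()).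
  by rewrite /p; case: (k) => [|k']; rewrite ?scale0r.
have -> : (k.+1%:R * c) *: p = c *: p + c *: (k%:R *: p).
  by rewrite -natr1 !scalerA -scalerDl; congr (_ *: _); ring.
rewrite pE -!mul_polyC !rmorphM /=; ring.
Qed.

(* The pairing is the value at (x, 1) of B(Y d/dY + c d/dX) applied to Y^-a F. *)
Definition pairing (K L : nat) a F x B : C :=
  \sum_(k < K) \sum_(l < L) F`_k`_l * (twist x k B).[l%:R - a].

(** On X^k Y^l, the part Y d/dY multiplies by l, which is z + a at z = l - a, and c d/dX yields c k
    X^(k-1), the commutator term of [twist_MXaddC]. *)
Lemma pairing_dxy K L a F x B : (size F <= K.+1)%N ->
  pairing K.+1 L a (dxy c F) x B = pairing K.+1 L a F x (('X + a%:P) * B).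
Proof.
move=> FK; rewrite /pairing exchange_big [RHS]exchange_big /=; apply: eq_bigr => l _.
transitivity (\sum_(k < K.+1) (F`_k`_l *+ l * (twist x k B).[l%:R - a]
    + (c * F`_k.+1`_l *+ k.+1) * (twist x k B).[l%:R - a])).
  apply: eq_bigr => k _.
  by rewrite coef_dxy coefD mulrDl coef_theta coefMn coefZ.
transitivity (\sum_(k < K.+1) (F`_k`_l *+ l * (twist x k B).[l%:R - a]
    + F`_k`_l * (k%:R * c * (twist x k.-1 B).[l%:R - a]))); last first.
  apply: eq_bigr => k _.
  rewrite twist_MXaddC hornerD hornerM hornerZ hornerD hornerX hornerC subrK mulrDr.
  ring.
rewrite !big_split /=; congr (_ + _).
rewrite big_ord_recr /= [X in _ + X](_ : _ = 0) ?addr0; last first.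
  by rewrite [F`_K.+1]nth_default// coef0 mulr0 mul0rn mul0r.
rewrite [RHS]big_ord_recl /= !mul0r mulr0 add0r.
by apply: eq_bigr => k _; rewrite /= /bump leq0n add1n add0n -mulr_natr; ring.
Qed.

Lemma pairing_iter_dxy K L a F x t : (size F <= K)%N ->
  (forall k, size (F`_k)%R <= L)%N ->
  (iter t (dxy c) F).[x%:P].[1] = pairing K L a F x (('X + a%:P) ^+ t).
Proof.
case: K => [|K] FK FL.
  have -> : F = 0 by apply/eqP; rewrite -size_poly_leq0.
  rewrite /pairing big_ord0; have -> : iter t (dxy c) 0 = 0.
    by elim: t => //= t ->; rewrite dxy0.
  by rewrite !horner0.
have gen : forall F B, (size F <= K.+1)%N -> pairing K.+1 L a (iter t (dxy c) F) x B =
    pairing K.+1 L a F x (('X + a%:P) ^+ t * B).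
  elim: t => [|t IH] G B GK; first by rewrite mul1r.
  rewrite iterS pairing_dxy ?(leq_trans (size_iter_dxy _ _ _))//.
  by rewrite IH// mulrA -exprSr.
have := gen F 1 FK; rewrite mulr1 => <-.
have sF : (size (iter t (dxy c) F) <= K.+1)%N by rewrite (leq_trans (size_iter_dxy _ _ _)).
rewrite (horner_coef_wide _ sF) horner_sum /pairing; apply: eq_bigr => k _.
have tw1 : twist x k 1 = (x ^+ k)%:P.
  elim: (nat_of_ord k) => //= j ->.
  by rewrite derivC scaler0 addr0 exprS -mul_polyC rmorphM.
rewrite tw1 hornerM -polyC_exp hornerC.
rewrite (horner_coef_wide _ (size_coef_iter_dxy _ _ FL k)) mulr_suml.
by apply: eq_bigr => l _; rewrite expr1n mulr1 hornerC.
Qed.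

Lemma pairingD K L a F x p q :
  pairing K L a F x (p + q) = pairing K L a F x p + pairing K L a F x q.
Proof.
rewrite /pairing -big_split /=; apply: eq_bigr => k _.
by rewrite -big_split /=; apply: eq_bigr => l _; rewrite twistD hornerD mulrDr.
Qed.

Lemma pairingZ K L a F x b p :
  pairing K L a F x (b *: p) = b * pairing K L a F x p.
Proof.
rewrite /pairing mulr_sumr; apply: eq_bigr => k _.
by rewrite mulr_sumr; apply: eq_bigr => l _; rewrite twistZ hornerZ mulrCA.
Qed.

(** The pairing is linear in its last argument, and the binomial polynomials of degree below T span
    all polynomials of size at most T. This lets the zero estimate, stated for iterated derivations,
    use values of binomial operators. *)
Lemma pairing_binp_eq0 K L a F x T :
  (forall t, (t < T)%N -> pairing K L a F x (binp C t) = 0) ->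
  forall B, (size B <= T)%N -> pairing K L a F x B = 0.
Proof.
elim: T => [|T IH] van B.
  rewrite size_poly_leq0 => /eqP ->.
  by have := pairingZ K L a F x 0 0; rewrite scale0r mul0r.
move=> BT; have bT : (binp C T)`_T != 0.
  have <- : lead_coef (binp C T) = (binp C T)`_T by rewrite lead_coefE size_binp.
  by rewrite lead_coef_eq0 -size_poly_gt0 size_binp.
have -> : B = (B - (B`_T / (binp C T)`_T) *: binp C T) + (B`_T / (binp C T)`_T) *: binp C T.
  by rewrite subrK.
rewrite pairingD pairingZ van// mulr0 addr0 IH//; first by move=> t /ltnW; exact: van.
apply/leq_sizeP => j; rewrite leq_eqVlt => /orP[/eqP<-|Tj].
  by rewrite coefB coefZ divfK// subrr.
rewrite coefB coefZ [B`_j]nth_default ?(leq_trans BT)//.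
by rewrite [(binp C T)`_j]nth_default ?size_binp// mulr0 subrr.
Qed.

Lemma dxy_vanishing K L a F x T : (size F <= K)%N ->
  (forall k, size (F`_k)%R <= L)%N ->
  (forall t, (t < T)%N -> pairing K L a F x (binp C t) = 0) ->
  forall t, (t < T)%N -> (iter t (dxy c) F).[x%:P].[1] = 0.
Proof.
move=> FK FL van t tT; rewrite (pairing_iter_dxy a x t FK FL).
apply: (pairing_binp_eq0 van); rewrite -[a]opprK polyCN size_exp_XsubC.
exact: tT.
Qed.

(** The constant-coefficient operator B(c d/dx) applied to [G]. *)
Definition diffop B G : {poly C} := \sum_(r < size B) (B`_r * c ^+ r) *: G^`(r).

Lemma diffop_wide n B G : (size B <= n)%N ->
  diffop B G = \sum_(r < n) (B`_r * c ^+ r) *: G^`(r).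
Proof.
move=> Bn; rewrite /diffop (big_ord_widen n (fun r => (B`_r * c ^+ r) *: G^`(r)))//.
rewrite big_mkcond; apply: eq_bigr => r _; case: ltnP => // h.
by rewrite nth_default// mul0r scale0r.
Qed.

Lemma diffopD B p q : diffop B (p + q) = diffop B p + diffop B q.
Proof.
by rewrite /diffop -big_split /=; apply: eq_bigr => r _; rewrite derivnD scalerDr.
Qed.

Lemma diffopZ B b p : diffop B (b *: p) = b *: diffop B p.
Proof.
rewrite /diffop scaler_sumr; apply: eq_bigr => r _.
by rewrite derivnZ !scalerA mulrC.
Qed.

Lemma diffop0 B : diffop B 0 = 0.
Proof. by have := diffopZ B 0 0; rewrite !scale0r. Qed.

Lemma diffop_sum (I : finType) B (f : I -> {poly C}) :
  diffop B (\sum_i f i) = \sum_i diffop B (f i).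
Proof. exact: (big_morph _ (diffopD B) (diffop0 B)). Qed.

(** By Leibniz, (d/dx)^r (xG) = x G^(r) + r G^(r-1). At the evaluation point x, multiplication of G
    by the variable therefore moves onto B, where it becomes the operator iterated by [twist]. *)
Lemma diffop_MX x B G :
  (diffop B (G * 'X)).[x] = (diffop (x *: B + c *: B^`()) G).[x].
Proof.
set n := size B.
have s1 : (size (x *: B + c *: B^`())%R <= n)%N.
  rewrite (leq_trans (size_polyD _ _))// geq_max !(leq_trans (size_scale_leq _ _))//.
  apply/leq_sizeP => j nj.
  by rewrite coef_deriv nth_default ?mul0rn// ltnW.
rewrite (diffop_wide (n := n.+1)) ?leqnSn// (diffop_wide (n := n.+1)) ?(leq_trans s1)//.
rewrite !horner_sum.
have dMX r : (G * 'X)^`(r) = G^`(r) * 'X + G^`(r.-1) *+ r.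
  case: r => [|r]; first by rewrite !derivn0 mulr0n addr0.
  by have := derivnMXaddC r G 0; rewrite addr0 => ->; rewrite addrC.
under eq_bigr => r _ do
  rewrite dMX scalerDr hornerD !hornerZ hornerMX hornerMn.
under [RHS]eq_bigr => r _ do
  rewrite coefD !coefZ coef_deriv mulrDl scalerDl hornerD !hornerZ.
rewrite !big_split /=; congr (_ + _).
  by apply: eq_bigr => r _; ring.
rewrite big_ord_recl /= mulr0n mulr0 add0r [RHS]big_ord_recr /=.
rewrite [B`_n.+1]nth_default// mul0rn mulr0 !mul0r addr0.
by apply: eq_bigr => r _; rewrite /= /bump leq0n add1n exprS -mulr_natr -[B`_ _ *+ _]mulr_natr; ring.
Qed.

Lemma diffop_MXn x k B G :
  (diffop B (G * 'X^k)).[x] = (diffop (twist x k B) G).[x].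
Proof.
elim: k B G => [|k IH] B G; first by rewrite expr0 mulr1.
by rewrite exprSr mulrA diffop_MX IH /twist -iterSr.
Qed.

Definition partial_exp (N : nat) w : {poly C} := \poly_(m < N) (w ^+ m / m`!%:R).

Lemma derivn_partial_exp N w r :
  (partial_exp N w)^`(r) = w ^+ r *: partial_exp (N - r) w.
Proof.
elim: r => [|r IH]; first by rewrite derivn0 subn0 scale1r.
rewrite derivnS IH derivZ exprSr -scalerA; congr (_ *: _).
rewrite subnS; case: (N - r)%N => [|n] /=.
  by rewrite /partial_exp !poly_def !big_ord0 deriv0 scaler0.
apply/polyP => i; rewrite coef_deriv coefZ !coef_poly ltnS.
case: ltnP => _; last by rewrite mul0rn mulr0.
rewrite factS natrM -mulr_natr exprS; field.
by rewrite nat1r !pnatr_eq0 -lt0n fact_gt0.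
Qed.

Lemma diffop_partial_exp N B w x : (diffop B (partial_exp N w)).[x] =
  \sum_(r < size B) B`_r * (c * w) ^+ r * (partial_exp (N - r) w).[x].
Proof.
rewrite /diffop horner_sum; apply: eq_bigr => r _.
by rewrite derivn_partial_exp scalerA hornerZ exprMn mulrA.
Qed.

(** The coefficient of z^r in binom(z, t) is its r-th derivative at 0 divided by r!, hence at most
    2^t / r!. This 1/r! turns G^(r) into G^(r)/r!, and the binomial theorem sums the result to
    powers of |x| + 1: no factor t! is lost. *)
Lemma norm_diffop_binp_le t G x : `|c| = 1 ->
  `|(diffop (binp C t) G).[x]| <=
    2 ^+ t * \sum_(n < size G) `|G`_n| * (`|x| + 1) ^+ n.
Proof.
move=> c1; rewrite /diffop size_binp horner_sum.
have Ble r : `|(binp C t)`_r| * r`!%:R <= 2 ^+ t.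
  have := binp_derivn_le C r t 0; rewrite addn0 horner_coef0 coef_derivn addn0.
  by rewrite normrMn ffactnn mulr_natr.
have Gle r : `|(G^`(r)).[x]| <= r`!%:R * \sum_(n < size G) `|G`_n| * ('C(n, r)%:R * `|x| ^+ (n - r)).
  rewrite -[G in G^`(r)]coefK poly_def linear_sum horner_sum mulr_sumr.
  rewrite (le_trans (ler_norm_sum _ _ _))// ler_sum// => n _.
  rewrite linearZ /= derivnXn hornerZ hornerMn hornerXn normrM normrMn normrX.
  rewrite -bin_ffact -[_ *+ _]mulr_natr natrM le_eqVlt; apply/orP; left.
  by apply/eqP; ring.
rewrite (le_trans (ler_norm_sum _ _ _))//.
rewrite (@le_trans _ _ (\sum_(r < t.+1) 2 ^+ t *
  \sum_(n < size G) `|G`_n| * ('C(n, r)%:R * `|x| ^+ (n - r))))//.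
  apply: ler_sum => r _; rewrite hornerZ !normrM normrX c1 expr1n mulr1.
  rewrite (le_trans (ler_wpM2l (normr_ge0 _) (Gle r)))// mulrA ler_wpM2r//.
  by apply: sumr_ge0 => n _; rewrite !mulr_ge0 ?exprn_ge0.
rewrite -mulr_sumr ler_wpM2l ?exprn_ge0// exchange_big ler_sum//= => n _.
rewrite -mulr_sumr ler_wpM2l// exprDn.
have [tn|nt] := leqP t n.
  rewrite (big_ord_widen n.+1 (fun r => 'C(n, r)%:R * `|x| ^+ (n - r))) ?ltnS//.
  rewrite big_mkcond ler_sum// => r _; rewrite expr1n mulr1 -[(`|x| ^+ _) *+ _]mulr_natl.
  by case: ifP => _//; rewrite mulr_ge0 ?exprn_ge0.
rewrite [leRHS](_ : _ = \sum_(r < t.+1) 'C(n, r)%:R * `|x| ^+ (n - r))//.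
rewrite (big_ord_widen t.+1 (fun r => (`|x| ^+ (n - r) * 1 ^+ r) *+ 'C(n, r))) ?ltnS 1?ltnW//.
rewrite big_mkcond; apply: eq_bigr => r _; rewrite expr1n mulr1 -[(`|x| ^+ _) *+ _]mulr_natl.
by case: ltnP => // h; rewrite bin_small// mul0r.
Qed.

End Twist.

(** * Limits of sequences and of truncated exponentials *)

Section SequenceLimit.
Variable C : numFieldType.
Implicit Types (u v : nat -> C) (a b : C).

(* R[i] carries no topology, hence this ad hoc notion of convergence. *)
Definition tends_to u a := forall e : C, 0 < e ->
  exists N0 : nat, forall N, (N0 <= N)%N -> `|u N - a| <= e.

Lemma tends_toD u v a b :
  tends_to u a -> tends_to v b -> tends_to (fun N => u N + v N) (a + b).
Proof.
move=> ua vb e e0; have e2 : 0 < e / 2 by rewrite divr_gt0.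
have [N1 h1] := ua _ e2; have [N2 h2] := vb _ e2.
exists (maxn N1 N2) => N; rewrite geq_max => /andP[/h1 k1 /h2 k2].
by rewrite opprD addrACA (le_trans (ler_normD _ _))// [e]splitr lerD.
Qed.

Lemma tends_toM k u a : tends_to u a -> tends_to (fun N => k * u N) (k * a).
Proof.
move=> ua e e0; have k1 : 0 < `|k| + 1 by rewrite ltr_wpDl.
have [N0 h] := ua _ (divr_gt0 e0 k1).
exists N0 => N /h; rewrite ler_pdivlMr// => hN.
by rewrite -mulrBr normrM mulrC (le_trans _ hN)// ler_wpM2l// lerDl ler01.
Qed.

Lemma tends_to_sum (I : finType) (u : I -> nat -> C) (a : I -> C) :
  (forall i, tends_to (u i) (a i)) ->
  tends_to (fun N => \sum_i u i N) (\sum_i a i).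
Proof.
move=> h; have : forall s : seq I, tends_to (fun N => \sum_(i <- s) u i N) (\sum_(i <- s) a i).
  elim=> [|i s IH].
    by rewrite big_nil => e e0; exists 0%N => N _; rewrite big_nil subrr normr0 ltW.
  move=> e e0; have [N0 hN] := tends_toD (h i) IH e0.
  by exists N0 => N /hN; rewrite !big_cons.
exact.
Qed.

Lemma tends_to_shift r u a : tends_to u a -> tends_to (fun N => u (N - r)%N) a.
Proof.
move=> ua e /ua[N0 h]; exists (N0 + r)%N => N hN; apply: h.
by rewrite leq_subRL 1?addnC// (leq_trans (leq_addl N0 r)).
Qed.

Lemma tends_to_norm_le u a (N1 : nat) b : tends_to u a ->
  (forall N, (N1 <= N)%N -> `|u N| <= b) -> `|a| <= b.
Proof.
move=> ua ub; apply/ler_addgt0Pr => e /ua[N0 h].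
have := h _ (leq_maxl N0 N1); have := ub _ (leq_maxr N0 N1).
set z := u _ => zb ze.
rewrite -(subrK z a) (le_trans (ler_normD _ _))// addrC lerD// distrC.
exact: ze.
Qed.

(* Passing to the limit in the action of B(c d/dx) on a combination of      *)
(* x^k e^(w x), at a point where every e^(w x) equals 1.                    *)
Lemma tends_to_diffop (c x : C) (K L : nat) (phi : 'I_K -> 'I_L -> C)
    (w : 'I_L -> C) B :
  (forall l, tends_to (fun N => (partial_exp N (w l)).[x]) 1) ->
  tends_to (fun N => (diffop c B
     (\sum_(k < K) \sum_(l < L) phi k l *: (partial_exp N (w l) * 'X^k))).[x])
   (\sum_(k < K) \sum_(l < L) phi k l * (twist c x k B).[c * w l]).
Proof.
move=> wx.
have -> : (fun N => (diffop c B (\sum_(k < K) \sum_(l < L) phi k l *: (partial_exp N (w l) * 'X^k))).[x]) =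
  (fun N => \sum_(k < K) \sum_(l < L) phi k l * \sum_(r < size (twist c x k B))
     (twist c x k B)`_r * (c * w l) ^+ r * (partial_exp (N - r) (w l)).[x]).
  apply/funext => N; rewrite diffop_sum horner_sum; apply: eq_bigr => k _.
  rewrite diffop_sum horner_sum; apply: eq_bigr => l _.
  by rewrite diffopZ hornerZ diffop_MXn diffop_partial_exp.
apply: tends_to_sum => k; apply: tends_to_sum => l; apply: tends_toM.
rewrite horner_coef; apply: tends_to_sum => r.
rewrite -[X in tends_to _ X]mulr1; apply: tends_toM.
exact: (tends_to_shift r (wx l)).
Qed.

End SequenceLimit.

(** * The exponential series at integer multiples of 2 pi *)

Section ComplexExponential.
Variable R : realType.
Local Notation C := R[i].

Lemma Re_sum (I : finType) (f : I -> C) : complex.Re (\sum_i f i) = \sum_i complex.Re (f i).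
Proof.
by apply: (big_ind2 (fun (z : C) x => complex.Re z = x)) => // -[a b] x [a' b'] y <- <-.
Qed.

Lemma Im_sum (I : finType) (f : I -> C) : complex.Im (\sum_i f i) = \sum_i complex.Im (f i).
Proof.
by apply: (big_ind2 (fun (z : C) x => complex.Im z = x)) => // -[a b] x [a' b'] y <- <-.
Qed.

Lemma norm_Re_Im_le (z : C) (e : R) :
  `|complex.Re z| <= e -> `|complex.Im z| <= e -> `|z| <= (e + e)%:C%C.
Proof.
move=> h1 h2; rewrite [z]complexE (le_trans (ler_normD _ _))// rmorphD lerD//.
  by rewrite normc_def /= expr0n addr0 sqrtr_sqr lecR.
by rewrite normrM !normc_def /= !expr0n /= expr1n add0r addr0 sqrtr1 mul1r sqrtr_sqr lecR.
Qed.

Lemma exp_i_coeff (theta : R) m :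
  (((theta%:C)%C * 'i%C) ^+ m / m`!%:R : C) =
  Complex (cos_coeff theta m) (sin_coeff theta m).
Proof.
have iE : ('i : C)%C ^+ m = Complex ((~~ odd m)%:R * (-1) ^+ m./2) ((odd m)%:R * (-1) ^+ m.-1./2).
  rewrite -[m in LHS]odd_double_half exprD -muln2 mulnC exprM sqr_i.
  have -> : (-1 : C) ^+ m./2 = ((-1) ^+ m./2)%:C%C by rewrite rmorphXn rmorphN1.
  case: (boolP (odd m)) => om /=; last by rewrite expr0 mul1r mul1r mul0r.
  rewrite expr1 mul0r mul1r; have -> : m.-1./2 = m./2 by have := odd_halfK om; lia.
  by apply/eqP; rewrite eq_complex /=; apply/andP; split; apply/eqP; ring.
have natC (n : nat) : (n%:R : C) = (n%:R)%:C%C by rewrite rmorph_nat.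
rewrite exprMn iE natC -rmorphXn -fmorphV.
apply/eqP; rewrite eq_complex /= /cos_coeff /sin_coeff /=.
by apply/andP; split; apply/eqP; rewrite /= -?exprnP; ring.
Qed.

Lemma cos_sin_2piM (n : int) : cos (n%:~R * (pi *+ 2)) = 1 :> R /\ sin (n%:~R * (pi *+ 2)) = 0 :> R.
Proof.
have hn (m : nat) : cos (m%:R * (pi *+ 2)) = 1 :> R /\ sin (m%:R * (pi *+ 2)) = 0 :> R.
  rewrite mulr_natl -[X in cos X]add0r -[X in sin X]add0r.
  by rewrite (periodicn (@cosD2pi R)) (periodicn (@sinD2pi R)) cos0 sin0.
case: (intP n) => [|m|m]; first by rewrite mul0r cos0 sin0.
  exact: (hn m.+1).
by rewrite mulrNz mulNr cosN sinN; have [-> ->] := hn m.+1; rewrite oppr0.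
Qed.

(** Real and imaginary parts of the partial sums are partial sums of the cosine and sine series at 2
    pi l s. *)
Lemma tends_to_exp_2pi_i (l s : int) :
  tends_to (fun N => (partial_exp N (l%:~R * 'i%C : C)).[((s%:~R * (pi *+ 2) : R)%:C)%C]) 1.
Proof.
move=> e; case: e => e e'; rewrite ltcE /= => /andP[/eqP e'0 e0].
rewrite {e'}e'0.
pose theta : R := (l * s)%:~R * (pi *+ 2).
have ccos : (series (cos_coeff theta) @ \oo --> (1 : R))%classic.
  have [<- _] := cos_sin_2piM (l * s); rewrite unlock.
  exact: is_cvg_series_cos_coeff.
have csin : (series (sin_coeff theta) @ \oo --> (0 : R))%classic.
  have [_ <-] := cos_sin_2piM (l * s); rewrite unlock.
  exact: is_cvg_series_sin_coeff.
have e2 : 0 < e / 2 by rewrite divr_gt0.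
move/cvgrPdist_le/(_ _ e2) : ccos => [N1 _ h1].
move/cvgrPdist_le/(_ _ e2) : csin => [N2 _ h2].
exists (maxn N1 N2) => N; rewrite geq_max => /andP[/h1 /= k1 /h2 /= k2].
have -> : (partial_exp N (l%:~R * 'i%C : C)).[((s%:~R * (pi *+ 2) : R)%:C)%C] =
    \sum_(m < N) Complex (cos_coeff theta m) (sin_coeff theta m).
  rewrite horner_poly; apply: eq_bigr => m _; rewrite -exp_i_coeff.
  rewrite mulrAC -exprMn; congr (_ ^+ _ / _).
  rewrite /theta rmorphM rmorph_int rmorphM/= rmorph_int intrM; ring.
rewrite [e]splitr; apply: norm_Re_Im_le.
  rewrite raddfB /= Re_sum /= distrC (le_trans _ k1)//.
  by rewrite /series /= big_mkord.
rewrite raddfB /= Im_sum /= distrC (le_trans _ k2)//.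
by rewrite /series /= big_mkord.
Qed.

End ComplexExponential.

(** * Length and resultants *)

Lemma sum_coef_le_length (P : {poly int}) n :
  \sum_(i < n) `|P`_i| <= poly_length P.
Proof.
rewrite /poly_length; have [nP|Pn] := leqP n (size P).
  rewrite (big_ord_widen (size P) (fun i => `|P`_i|))// big_mkcond ler_sum// => i _.
  by case: ifP.
rewrite (big_ord_widen n (fun i => `|P`_i|) (ltnW Pn)) [leRHS]big_mkcond ler_sum// => i _.
by case: ltnP => // h; rewrite nth_default// normr0.
Qed.

Lemma poly_length_ge0 P : 0 <= poly_length P.
Proof. by apply: sumr_ge0. Qed.

Lemma poly_lengthD P Q : poly_length (P + Q) <= poly_length P + poly_length Q.
Proof.
rewrite {1}/poly_length (le_trans _ (lerD (sum_coef_le_length P (size (P + Q)))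
  (sum_coef_le_length Q (size (P + Q)))))// -big_split ler_sum// => i _.
by rewrite coefD ler_normD.
Qed.

Lemma poly_length0 : poly_length 0 = 0.
Proof. by rewrite /poly_length size_poly0 big_ord0. Qed.

Lemma poly_length_sum (I : Type) (r : seq I) (f : I -> {poly int}) :
  poly_length (\sum_(i <- r) f i) <= \sum_(i <- r) poly_length (f i).
Proof.
elim/big_ind2: _ => [|P x Q y hP hQ|//]; first by rewrite poly_length0.
by rewrite (le_trans (poly_lengthD _ _))// lerD.
Qed.

Lemma poly_lengthZXn (a : int) n : poly_length (a *: 'X^n) <= `|a|.
Proof.
have [->|a0] := eqVneq a 0; first by rewrite scale0r poly_length0.
rewrite /poly_length size_scale// size_polyXn big_ord_recr /= big1 => [|i _].
  by rewrite coefZ coefXn eqxx mulr1 add0r.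
by rewrite coefZ coefXn ltn_eqF// mulr0 normr0.
Qed.

(** Expanded, the right side is a sum over all maps from rows to columns; the injective ones are the
    permutations of the determinant, and the other terms are nonnegative. *)
Lemma norm_det_le (R : numDomainType) n (A : 'M[R]_n) :
  `|\det A| <= \prod_i \sum_j `|A i j|.
Proof.
rewrite bigA_distr_bigA /= (le_trans (ler_norm_sum _ _ _))//.
rewrite [leRHS](bigID (fun f : {ffun 'I_n -> 'I_n} => injectiveb f))/=.
apply: ler_wpDr; first by apply: sumr_ge0 => f _; exact: prodr_ge0.
rewrite (reindex (fun s : 'S_n => val s)) /=; last first.
  pose to_perm := insubd (1%g : 'S_n).
  by exists to_perm => /= f Uf; first apply: val_inj; exact: insubdK.
rewrite le_eqVlt; apply/orP; left; apply/eqP.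
apply: eq_big => [s|s _]; first by rewrite (valP s).
rewrite normrM normrX normrN1 expr1n mul1r normr_prod.
by apply: eq_bigr => k _; rewrite -pvalE.
Qed.

Section ResultantBound.
Variables (R : realFieldType) (P Q : {poly int}) (x A Lam W : R).
Hypotheses (A1 : 1 <= A) (xA : `|x| <= A) (Lam1 : 1 <= Lam) (W1 : 1 <= W).
Hypotheses (PLam : (poly_length P)%:~R <= Lam) (QW : (poly_length Q)%:~R <= W).
Let d := (size P).-1.
Let m := (size Q).-1.
Hypothesis d0 : (0 < d)%N.
Let S : 'M[R]_(m + d) := map_mx intr (Sylvester_mx P Q).

Let SE (i j : 'I_(m + d)) : S i j = match fintype.split i with
  | inl k => (P`_(j - k))%:~R *+ (k <= j)
  | inr k => (Q`_(j - k))%:~R *+ (k <= j) end.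
Proof.
rewrite mxE Sylvester_mxE; by case: fintype.split => k; rewrite rmorphMn.
Qed.

Let shifted_length (T : {poly int}) (k : nat) (B : R) : (poly_length T)%:~R <= B ->
  \sum_(j < m + d) `|(T`_(j - k))%:~R *+ (k <= j) : R| <= B.
Proof.
move=> TB; have := sum_coef_le_length T (m + d - k)%N.
rewrite -(ler_int R) => /le_trans/(_ TB); apply: le_trans.
rewrite -(big_mkord xpredT (fun j => `|T`_j|)).
rewrite -(big_mkord xpredT (fun j => `|(T`_(j - k))%:~R *+ (k <= j) : R|)).
have [km|mk] := leqP k (m + d); last first.
  rewrite big_nat_cond big1 ?ler0z ?sumr_ge0// => j /andP[/andP[_ jm] _].
  by rewrite leqNgt (ltn_trans jm mk) mulr0n normr0.
rewrite (big_cat_nat (n := k))//= big_nat_cond big1 ?add0r; last first.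
  by move=> j /andP[/andP[_ jk] _]; rewrite leqNgt jk mulr0n normr0.
rewrite -{1}(add0n k) big_addn rmorph_sum; apply: ler_sum => j _.
by rewrite addnK leq_addl mulr1n /= intr_norm.
Qed.

Let row_bound (i : 'I_(m + d)) : R := if (i < m)%N then Lam else W.

Let row_bound_gt0 i : 0 < row_bound i.
Proof. by rewrite /row_bound; case: ifP => _; rewrite (lt_le_trans ltr01). Qed.

Let row_sum_le i : \sum_j `|S i j| <= row_bound i.
Proof.
rewrite /row_bound; under eq_bigr do rewrite SE.
by case: fintype.splitP => k _; apply: shifted_length.
Qed.

Let prod_row_bound : \prod_i row_bound i = Lam ^+ m * W ^+ d.
Proof.
rewrite big_split_ord /= /row_bound.
rewrite (eq_bigr (fun=> Lam)) => [|i _]; last by rewrite /= ltn_ord.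
rewrite [X in _ * X](eq_bigr (fun=> W)) => [|i _]; last by rewrite /= ltnNge leq_addr.
by rewrite !prodr_const !card_ord.
Qed.

(** Deleting a column only lowers the row sums, and the division removes the bound of the deleted
    row. *)
Let cofactor_le i j : `|cofactor S i j| <= Lam ^+ m * W ^+ d / row_bound i.
Proof.
rewrite /cofactor normrM normrX normrN1 expr1n mul1r ler_pdivlMr//.
rewrite -prod_row_bound (bigD1_ord i)//= mulrC ler_wpM2l ?(ltW (row_bound_gt0 _))//.
rewrite (le_trans (norm_det_le _))// ler_prod// => k _; rewrite sumr_ge0//=.
rewrite (le_trans _ (row_sum_le _))// [leRHS](bigD1_ord j)//=.
apply: ler_wpDl => //; apply: ler_sum => l _; by rewrite !mxE.
Qed.

Let v : 'cV[R]_(m + d) := \col_j x ^+ j.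

(** The rows of the Sylvester matrix are the coefficients of X^k P and X^k Q, and [v] is the vector
    of powers of x. *)
Let SvE i : (S *m v) i 0 = match fintype.split i with
  | inl k => x ^+ k * (map_poly intr P).[x]
  | inr k => x ^+ k * (map_poly intr Q).[x] end.
Proof.
have key (T : {poly int}) (k : nat) : (k + (size T).-1 < m + d)%N ->
    \sum_(j < m + d) ((T`_(j - k))%:~R *+ (k <= j)) * x ^+ j = x ^+ k * (map_poly intr T).[x] :> R.
  move=> kT; have sT : (size (map_poly intr T : {poly R}) <= m + d - k)%N.
    rewrite (leq_trans (size_poly _ _))//; move: kT; case: (size T) => [|n] /= kT; lia.
  rewrite (horner_coef_wide _ sT) mulr_sumr.
  rewrite -(big_mkord xpredT (fun j => ((T`_(j - k))%:~R *+ (k <= j)) * x ^+ j)).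
  rewrite (big_cat_nat (n := k))//=; last by lia.
  rewrite big_nat_cond big1 ?add0r; last first.
    by move=> j /andP[/andP[_ jk] _]; rewrite leqNgt jk mulr0n mul0r.
  rewrite -{1}(add0n k) big_addn -(big_mkord xpredT (fun j => x ^+ k * ((map_poly intr T)`_j * x ^+ j))).
  apply: eq_bigr => j _.
  by rewrite addnK leq_addl mulr1n coef_map /= exprD; ring.
rewrite mxE; under eq_bigr do rewrite SE [v _ _]mxE.
by case: fintype.split => k; apply: key; have := ltn_ord k; rewrite -/d -/m; lia.
Qed.

(** Cramer's rule: the first entry of [v] is 1, so the determinant is the first entry of adj(S) S v,
    a combination of the x^k P(x) and x^k Q(x) with cofactors as coefficients. It is a nonzero
    integer, whence the 1 on the left. [q] is an upper bound for deg Q. *)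
Lemma resultant_le q : (m <= q)%N -> resultant P Q != 0 ->
  1 <= q%:R * A ^+ q * Lam ^+ q * W ^+ d * `|(map_poly intr P).[x]|
     + d%:R * A ^+ d * Lam ^+ q * W ^+ d.-1 * `|(map_poly intr Q).[x]|.
Proof.
move=> mq res0.
have n0 : (0 < m + d)%N by rewrite addn_gt0 d0 orbT.
pose i0 := Ordinal n0.
have detE : \det S = (resultant P Q)%:~R by rewrite /S det_map_mx.
have one_le : 1 <= `|\det S|.
  by rewrite detE -intr_norm -[1]/(1%:~R) ler_int -gtz0_ge1 normr_gt0.
have det_eq : \det S = \sum_i cofactor S i i0 * (S *m v) i 0.
  have := congr1 (fun M => (M *m v) i0 0) (mul_adj_mx S).
  rewrite mul_scalar_mx [in X in _ = X]mxE [v _ _]mxE expr0 mulr1 => <-.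
  by rewrite -mulmxA mxE; apply: eq_bigr => i _; rewrite [(\adj S) _ _]mxE.
apply: (le_trans one_le); rewrite det_eq (le_trans (ler_norm_sum _ _ _))//.
have A0 : 0 <= A := le_trans ler01 A1.
have Lam0 : 0 < Lam := lt_le_trans ltr01 Lam1.
have W0 : 0 < W := lt_le_trans ltr01 W1.
have Lam0' := ltW Lam0; have W0' := ltW W0.
have xle k n : (k <= n)%N -> `|x| ^+ k <= A ^+ n.
  move=> kn; rewrite (@le_trans _ _ (A ^+ k))//; first by rewrite lerXn2r ?nnegrE.
  by rewrite ler_weXn2l.
rewrite big_split_ord /= lerD//.
  have mE : m%:R * (A ^+ q * Lam ^+ q * W ^+ d * `|(map_poly intr P).[x]|) <=
     q%:R * A ^+ q * Lam ^+ q * W ^+ d * `|(map_poly intr P).[x]|.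
    by rewrite -!mulrA ler_wpM2r ?ler_nat// !mulr_ge0 ?exprn_ge0.
  apply: le_trans mE; rewrite -[X in X%:R * _]card_ord mulr_natl -sumr_const ler_sum// => i _.
  rewrite normrM SvE; case: fintype.splitP => k /= ik; last by have := ltn_ord i; rewrite ik ltnNge leq_addr.
  have := cofactor_le (lshift d i) i0; rewrite /row_bound /= ltn_ord => cle.
  move: (cofactor _ _ _) cle => cof cle; rewrite normrM normrX.
  apply: (le_trans (ler_wpM2r _ cle)); first by rewrite mulr_ge0// exprn_ge0.
  have le1 : Lam ^+ m / Lam <= Lam ^+ q.
    by rewrite ler_pdivrMr// -exprSr ler_weXn2l// leqW.
  have le2 : `|x| ^+ k <= A ^+ q by apply: xle; rewrite (leq_trans _ mq)// ltnW.
  have -> : Lam ^+ m * W ^+ d / Lam * (`|x| ^+ k * `|(map_poly intr P).[x]|) =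
     (`|x| ^+ k * (Lam ^+ m / Lam)) * (W ^+ d * `|(map_poly intr P).[x]|).
    move: (Lam ^+ m) (W ^+ d) Lam^-1 (`|x| ^+ k) `|_| => a1 a2 a3 a4 a5; ring.
  rewrite -[leRHS]mulrA ler_wpM2r ?mulr_ge0 ?exprn_ge0// ler_pM ?exprn_ge0//.
  by rewrite divr_ge0 ?exprn_ge0.
rewrite -!mulrA mulr_natl -[X in _ *+ X]card_ord -sumr_const ler_sum// => i _.
rewrite normrM SvE; case: fintype.splitP => k /= ik; first by have := ltn_ord k; rewrite -ik ltnNge leq_addr.
have := cofactor_le (rshift m i) i0; rewrite /row_bound /= ltnNge leq_addr /= => cle.
move: (cofactor _ _ _) cle => cof cle; rewrite normrM normrX.
apply: (le_trans (ler_wpM2r _ cle)); first by rewrite mulr_ge0// exprn_ge0.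
have le1 : Lam ^+ m <= Lam ^+ q by rewrite ler_weXn2l.
have le2 : `|x| ^+ k <= A ^+ d by apply: xle; rewrite ltnW.
have -> : Lam ^+ m * W ^+ d / W = Lam ^+ m * W ^+ d.-1.
  by rewrite -[in LHS](prednK d0) exprSr mulrA mulfK ?gt_eqF.
have -> : Lam ^+ m * W ^+ d.-1 * (`|x| ^+ k * `|(map_poly intr Q).[x]|) =
  (`|x| ^+ k * Lam ^+ m) * (W ^+ d.-1 * `|(map_poly intr Q).[x]|).
  move: (Lam ^+ m) (W ^+ d.-1) (`|x| ^+ k) `|_| => a1 a2 a3 a4; ring.
rewrite [leRHS]mulrA ler_wpM2r ?mulr_ge0 ?exprn_ge0// ler_pM ?exprn_ge0//.
Qed.

End ResultantBound.

(** * The auxiliary values as integer polynomials *)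

Section IntegerPolynomials.
Variable C : numFieldType.
Variables (d K L0 S0 T H : nat).
Let L := (2 * L0).+1.
Variable p : 'I_K -> 'I_L -> 'I_d -> bool -> int.
Hypothesis pH : forall k l j b, `|p k l j b| <= H%:Z.
Implicit Types (iota xi : C).

(** Coefficient of x^k e^(i(l-L0)x) in the auxiliary function, with pi and i replaced by xi and
    iota. *)
Definition coef_at iota xi (k : 'I_K) (l : 'I_L) : C :=
  \sum_(j < d) \sum_(b : bool) (p k l j b)%:~R * iota ^+ b * xi ^+ j.

(** Real and imaginary parts of i^e, kept as integers so that [iota_expE] holds for either square
    root of -1. *)
Definition re_i4 (e : nat) : int := if odd e then 0 else (-1) ^+ e./2.
Definition im_i4 (e : nat) : int := if odd e then (-1) ^+ e./2 else 0.

Lemma iota_expE iota e : iota ^+ 2 = -1 ->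
  iota ^+ e = (re_i4 e)%:~R + iota * (im_i4 e)%:~R.
Proof.
move=> i2; rewrite -[in LHS](odd_double_half e) exprD -mul2n exprM i2 /re_i4 /im_i4.
by case: odd; rewrite !rmorphXn /= !rmorphN1 ?expr0 ?expr1 ?mulr0 ?mul1r ?addr0 ?add0r.
Qed.

Lemma norm_i4_le1 e : `|re_i4 e| <= 1 /\ `|im_i4 e| <= 1.
Proof.
rewrite /re_i4 /im_i4; case: odd; by rewrite ?normr0 normrX normrN1 expr1n.
Qed.

Lemma denom_binp_int t : (t <= T)%N -> exists m : 'I_L -> 'I_K -> int,
  forall (l : 'I_L) (j : 'I_K), (denom T K)%:R * (binp C t)^`(j).[l%:R - L0%:R] = (m l j)%:~R
    /\ `|m l j| <= ((denom T K) * 2 ^ (T + L0))%N%:Z.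
Proof.
move=> tT.
have h (l : 'I_L) (j : 'I_K) : exists m : int,
   (denom T K)%:R * (binp C t)^`(j).[l%:R - L0%:R] = m%:~R
    /\ `|m| <= ((denom T K) * 2 ^ (T + L0))%N%:Z.
  have zE : l%:R - L0%:R = (l%:Z - L0%:Z)%:~R :> C by rewrite rmorphB.
  have [m mE] : int_valued ((denom T K)%:R * (binp C t)^`(j).[(l%:Z - L0%:Z)%:~R]).
    apply: binp_derivn_int => s s0 sj st.
    by apply: prod_dvd_denom => //; [exact: leq_ltn_trans sj _|exact: leq_trans st tT].
  exists m; rewrite zE; split => //.
  rewrite -(ler_int C) intr_norm -mE normrM normr_nat PoszM rmorphM /= ler_wpM2l//.
  rewrite (le_trans (binp_derivn_le _ _ _ _))// -natrX ler_nat leq_exp2l//.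
  by have := ltn_ord l; rewrite /L; lia.
have /fin_all_exists[m mP] (l : 'I_L) : exists m : 'I_K -> int, forall j : 'I_K,
   (denom T K)%:R * (binp C t)^`(j).[l%:R - L0%:R] = (m j)%:~R
    /\ `|m j| <= ((denom T K) * 2 ^ (T + L0))%N%:Z.
  exact: (fin_all_exists (h l)).
by exists m.
Qed.

Lemma twist_wide c x (k : 'I_K) B : twist c x k B =
  \sum_(j < K) ('C(k, j)%:R * x ^+ (k - j) * c ^+ j) *: B^`(j) :> {poly C}.
Proof.
rewrite twistE (big_ord_widen K (fun j => ('C(k, j)%:R * x ^+ (k - j) * c ^+ j) *: B^`(j)))//.
rewrite big_mkcond; apply: eq_bigr => j _; case: ltnP => // kj.
by rewrite bin_small// !mul0r scale0r.
Qed.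

(** For g = [re_i4] or [im_i4], one of the two integer polynomials that combine to a scaled value in
    [value_polyE]; its variable stands for pi or xi. The exponent b + 3 i collects iota^b from the
    coefficient and (-iota)^i = iota^(3i) from [twist]. *)
Definition value_poly (s : int) (m : 'I_L -> 'I_K -> int) (g : nat -> int) : {poly int} :=
  \sum_(k < K) \sum_(l < L) \sum_(j < d) \sum_(b : bool) \sum_(i < K)
    (p k l j b * ('C(k, i)%:Z * (2 * s) ^+ (k - i)) * m l i * g (b + 3 * i)%N)
      *: 'X^(j + (k - i)).

Lemma size_value_poly s m g : (size (value_poly s m g) <= K + d)%N.
Proof.
apply: (leq_trans (size_sum _ _ _)); apply/bigmax_leqP => k _.
apply: (leq_trans (size_sum _ _ _)); apply/bigmax_leqP => l _.
apply: (leq_trans (size_sum _ _ _)); apply/bigmax_leqP => j _.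
apply: (leq_trans (size_sum _ _ _)); apply/bigmax_leqP => b _.
apply: (leq_trans (size_sum _ _ _)); apply/bigmax_leqP => i _.
rewrite (leq_trans (size_scale_leq _ _))// size_polyXn.
by have := ltn_ord k; have := ltn_ord j; lia.
Qed.

Lemma length_value_poly s m g (B : nat) : `|s| <= S0%:Z ->
  (forall l i, `|m l i| <= B%:Z) -> (forall e, `|g e| <= 1) ->
  poly_length (value_poly s m g) <= (K * (L * (d * (2 * (H * B * (2 * S0).+1 ^ K)))))%N%:Z.
Proof.
move=> sS mB g1.
have sumc n (b : nat) (f : 'I_n -> {poly int}) :
    (forall i, poly_length (f i) <= b%:Z) -> poly_length (\sum_(i < n) f i) <= (n * b)%N%:Z.
  move=> fb; rewrite (le_trans (poly_length_sum _ _))//.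
  by rewrite (le_trans (ler_sum _ (fun i _ => fb i)))// sumr_const card_ord PoszM -mulr_natl natz.
apply: (sumc) => k; apply: (sumc) => l; apply: (sumc) => j.
rewrite big_bool /= (le_trans (poly_lengthD _ _))//.
have hb b : poly_length (\sum_(i < K)
    (p k l j b * ('C(k, i)%:Z * (2 * s) ^+ (k - i)) * m l i * g (b + 3 * i)%N)
      *: 'X^(j + (k - i))) <= (H * B * (2 * S0).+1 ^ K)%N%:Z.
  rewrite (le_trans (poly_length_sum _ _))//.
  have bnd : \sum_(i < K) ('C(k, i) * (2 * S0) ^ (k - i))%N%:Z <= ((2 * S0).+1 ^ K)%N%:Z.
    have -> : \sum_(i < K) ('C(k, i) * (2 * S0) ^ (k - i))%N%:Z =
        (\sum_(i < k.+1) 'C(k, i) * (2 * S0) ^ (k - i))%N%:Z.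
      rewrite -[RHS]natz natr_sum (big_ord_widen K (fun i => ('C(k, i) * (2 * S0) ^ (k - i))%N%:R))//.
      rewrite [RHS]big_mkcond; apply: eq_bigr => i _; rewrite natz; case: ltnP => // ki.
      by rewrite bin_small.
    have -> : (\sum_(i < k.+1) 'C(k, i) * (2 * S0) ^ (k - i) = (2 * S0 + 1) ^ k)%N.
      by rewrite expnDn; apply: eq_bigr => i _; rewrite exp1n muln1.
    by rewrite addn1 lez_nat leq_pexp2l// ltnW.
  rewrite !PoszM -mulrA mulrA (le_trans _ (ler_wpM2l _ bnd)) ?mulr_ge0//.
  rewrite mulr_sumr ler_sum// => i _; rewrite (le_trans (poly_lengthZXn _ _))//.
  rewrite !normrM PoszM.
  have s2 : `|(2 * s) ^+ (k - i)| <= ((2 * S0) ^ (k - i))%N%:Z.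
    rewrite normrX -natz natrX lerXn2r ?nnegrE//; lia.
  have -> : (H%:Z * B%:Z * ('C(k, i)%:Z * ((2 * S0) ^ (k - i))%N%:Z)) =
     H%:Z * ('C(k, i)%:Z * ((2 * S0) ^ (k - i))%N%:Z) * B%:Z * 1 by ring.
  rewrite ler_pM ?mulr_ge0// ler_pM ?mulr_ge0// ler_pM ?mulr_ge0// ler_pM//.
by rewrite mul2n -addnn PoszD lerD.
Qed.

Lemma horner_value_poly s m g xi : (map_poly intr (value_poly s m g)).[xi] =
  \sum_(k < K) \sum_(l < L) \sum_(j < d) \sum_(b : bool) \sum_(i < K)
   (p k l j b)%:~R * ('C(k, i)%:R * (2 * s)%:~R ^+ (k - i)) * (m l i)%:~R
     * (g (b + 3 * i)%N)%:~R * xi ^+ (j + (k - i)) :> C.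
Proof.
rewrite /value_poly.
do 5 (rewrite rmorph_sum horner_sum /=; apply: eq_bigr => ? _).
by rewrite map_polyZ map_polyXn hornerZ hornerXn /= !intrM rmorphXn /= !intrM.
Qed.

Lemma value_polyE s m t iota xi : iota ^+ 2 = -1 ->
  (forall (l : 'I_L) (j : 'I_K), (denom T K)%:R * (binp C t)^`(j).[l%:R - L0%:R] = (m l j)%:~R) ->
  (map_poly intr (value_poly s m re_i4)).[xi]
   + iota * (map_poly intr (value_poly s m im_i4)).[xi] =
  (denom T K)%:R * \sum_(k < K) \sum_(l < L) coef_at iota xi k l
     * (twist (- iota) ((2 * s)%:~R * xi) k (binp C t)).[l%:R - L0%:R].
Proof.
move=> i2 mE; rewrite !horner_value_poly mulr_sumr -big_split mulr_sumr; apply: eq_bigr => k _.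
rewrite !mulr_sumr -big_split /=; apply: eq_bigr => l _.
rewrite /coef_at mulr_suml !mulr_sumr -big_split /=; apply: eq_bigr => j _.
rewrite mulr_suml !mulr_sumr -big_split /=; apply: eq_bigr => b _.
rewrite twist_wide horner_sum !mulr_sumr -big_split /=; apply: eq_bigr => i _.
rewrite hornerZ -mE.
have -> : (- iota) ^+ i = iota ^+ (3 * i).
  by rewrite exprM exprS i2 mulrN1.
have e : (re_i4 (b + 3 * i))%:~R = iota ^+ (b + 3 * i) - iota * (im_i4 (b + 3 * i))%:~R.
  by rewrite iota_expE// addrK.
rewrite e !exprD exprMn; ring.
Qed.

End IntegerPolynomials.

(** * Analytic upper bound *)

Lemma sum_ord_le_support (F : numDomainType) (h : nat -> F) (n N : nat) :
  (forall m, 0 <= h m) -> (forall m, (N <= m)%N -> h m = 0) ->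
  \sum_(m < n) h m <= \sum_(m < N) h m.
Proof.
move=> h0 hN; rewrite (@le_trans _ _ (\sum_(m < n + N) h m))//.
  by rewrite big_split_ord /= lerDl sumr_ge0.
rewrite addnC big_split_ord /= [X in _ + X]big1 ?addr0// => m _.
by rewrite hN// leq_addr.
Qed.

Section ValueBound.
Variable C : numFieldType.
Variables (K L M : nat) (phi : 'I_K -> 'I_L -> C) (w : 'I_L -> C).
Variables (c x R1 Phi Omega eps tau : C).
Hypotheses (c1 : `|c| = 1) (xR1 : `|x| + 1 <= R1).
Hypotheses (Phi0 : 0 <= Phi) (Omega0 : 0 <= Omega).
Hypothesis phi_le : forall k l, `|phi k l| <= Phi.
Hypothesis w_le : forall l, `|w l| <= Omega.
Hypothesis exp_w : forall l, tends_to (fun N => (partial_exp N (w l)).[x]) 1.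
Hypothesis tail_le : forall N,
  \sum_(m < N | (M - K <= m)%N) (Omega * R1) ^+ m / m`!%:R <= tau.

Definition taylor_coef (n : nat) : C := \sum_(k < K) \sum_(l < L)
  phi k l * (if (n < k)%N then 0 else w l ^+ (n - k) / (n - k)`!%:R).

Hypothesis taylor_le : forall n, (n < M)%N -> `|taylor_coef n| * R1 ^+ n <= eps.

Let G N := \sum_(k < K) \sum_(l < L) phi k l *: (partial_exp N (w l) * 'X^k).

Let coefG N n : (G N)`_n = \sum_(k < K) \sum_(l < L) phi k l *
  (if (n < k)%N then 0 else if (n - k < N)%N then w l ^+ (n - k) / (n - k)`!%:R else 0).
Proof.
rewrite coef_sum; apply: eq_bigr => k _; rewrite coef_sum; apply: eq_bigr => l _.
by rewrite coefZ coefMXn coef_poly.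
Qed.

Let R1_ge1 : 1 <= R1.
Proof. by rewrite (le_trans _ xR1)// lerDr. Qed.

Let R1_ge0 : 0 <= R1.
Proof. exact: le_trans ler01 R1_ge1. Qed.

(** After the shift n = k + m, the condition M <= n gives M - K <= m because k < K, and R1^k is at
    most R1^K. *)
Let tail_sum n1 N (k : 'I_K) :
  \sum_(n < n1) (if (M <= n)%N then (if (n < k)%N then 0 else if (n - k < N)%N then
     Omega ^+ (n - k) / (n - k)`!%:R else 0) * R1 ^+ n else 0) <= R1 ^+ K * tau.
Proof.
have term_ge0 m : 0 <= Omega ^+ m / m`!%:R by rewrite divr_ge0 ?exprn_ge0.
apply: le_trans (ler_wpM2l (exprn_ge0 K R1_ge0) (tail_le N)).
pose g n := if (M <= n)%N then (if (n < k)%N then 0 else if (n - k < N)%N then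
     Omega ^+ (n - k) / (n - k)`!%:R else 0) * R1 ^+ n else 0.
rewrite -/(\sum_(n < n1) g n).
have g_ge0 n : 0 <= g n.
  by rewrite /g; case: ifP => // _; rewrite mulr_ge0 ?exprn_ge0//; do 2 case: ifP => // _.
rewrite (@le_trans _ _ (\sum_(m < n1) g (k + m)%N))//.
  rewrite (@le_trans _ _ (\sum_(m < k + n1) g m))//.
    by rewrite addnC big_split_ord /= lerDl sumr_ge0.
  rewrite big_split_ord /= big1 ?add0r// => n _; rewrite /g.
  by case: ifP => // _; rewrite ltn_ord mul0r.
rewrite (le_trans (sum_ord_le_support (h := fun m => g (k + m)%N) (N := N) _ _ _))//.
  move=> m Nm; rewrite /g; case: ifP => // _.
  by rewrite ltnNge leq_addr /= addKn ltnNge Nm mul0r.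
rewrite mulr_sumr [leRHS]big_mkcond ler_sum// => m _; rewrite /g.
case: ifP => [Mm|_]; last by case: ifP => // _; rewrite mulr_ge0 ?exprn_ge0// exprMn mulrAC mulr_ge0 ?exprn_ge0.
have -> : (M - K <= m)%N by have := ltn_ord k; lia.
rewrite ltnNge leq_addr /= addKn ltn_ord exprD exprMn.
have -> : Omega ^+ m / m`!%:R * (R1 ^+ k * R1 ^+ m) =
  R1 ^+ k * (Omega ^+ m * R1 ^+ m / m`!%:R) by ring.
rewrite ler_wpM2r ?ler_weXn2l// 1?ltnW//.
by rewrite mulrAC mulr_ge0 ?exprn_ge0.
Qed.

(** The sum is the limit of B_t(c d/dx) applied to the truncations [G N]. [norm_diffop_binp_le]
    reduces it to the weighted sum of the coefficients of [G N]: the first M are small by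
    [taylor_le], the others form a tail of the exponential series. *)
Lemma twist_combination_le t : (t <= M)%N ->
  `|\sum_(k < K) \sum_(l < L) phi k l * (twist c x k (binp C t)).[c * w l]|
  <= 2 ^+ t * (M%:R * eps + (K * L)%:R * Phi * (R1 ^+ K * tau)).
Proof.
move=> tM; apply: (tends_to_norm_le (N1 := M) (tends_to_diffop c phi (binp C t) exp_w)).
move=> N MN; rewrite -/(G N) (le_trans (norm_diffop_binp_le t (G N) x c1))//.
rewrite ler_wpM2l ?exprn_ge0//.
rewrite (@le_trans _ _ (\sum_(n < M + size (G N)) `|(G N)`_n| * R1 ^+ n))//.
  rewrite addnC big_split_ord /= -[leLHS]addr0 lerD//.
    apply: ler_sum => n _; rewrite ler_wpM2l// lerXn2r// ?nnegrE ?addr_ge0//.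
  by apply: sumr_ge0 => n _; rewrite mulr_ge0 ?exprn_ge0.
rewrite big_split_ord /= lerD//.
  rewrite mulr_natl -[X in _ *+ X]card_ord -sumr_const ler_sum// => n _.
  rewrite (le_trans _ (taylor_le (ltn_ord n)))// le_eqVlt; apply/orP; left; apply/eqP.
  congr (`|_| * _); rewrite coefG; apply: eq_bigr => k _; apply: eq_bigr => l _.
  case: ltnP => // kn; have -> // : (n - k < N)%N.
  by rewrite (leq_trans _ MN)// (leq_ltn_trans (leq_subr _ _)).
pose e (k : 'I_K) n := if (n < k)%N then 0 else if (n - k < N)%N then
     Omega ^+ (n - k) / (n - k)`!%:R else 0.
have Gle n : `|(G N)`_n| <= \sum_(k < K) \sum_(l < L) Phi * e k n.
  rewrite coefG (le_trans (ler_norm_sum _ _ _))// ler_sum// => k _.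
  rewrite (le_trans (ler_norm_sum _ _ _))// ler_sum// => l _.
  rewrite normrM ler_pM// /e; case: ifP => _; first by rewrite normr0.
  case: ifP => _; last by rewrite normr0.
  by rewrite normrM normrX normfV normr_nat ler_wpM2r ?invr_ge0// lerXn2r ?nnegrE.
rewrite (@le_trans _ _ (\sum_(k < K) \sum_(l < L) Phi * (R1 ^+ K * tau)))//; last first.
  by rewrite !sumr_const !card_ord -mulrnA mulnC -[leLHS]mulr_natl mulrA.
rewrite (@le_trans _ _ (\sum_(n < size (G N)) \sum_(k < K) \sum_(l < L)
   Phi * (e k (M + n)%N * R1 ^+ (M + n))))//.
  apply: ler_sum => n _; rewrite (le_trans (ler_wpM2r _ (Gle _))) ?exprn_ge0//.
  rewrite mulr_suml ler_sum// => k _; rewrite mulr_suml ler_sum// => l _.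
  by rewrite mulrA.
rewrite exchange_big ler_sum//= => k _; rewrite exchange_big ler_sum//= => l _.
rewrite -mulr_sumr ler_wpM2l//.
have := tail_sum (M + size (G N))%N N k; rewrite big_split_ord /=.
rewrite big1 ?add0r => [h|n _]; last by rewrite leqNgt ltn_ord.
apply: le_trans h; rewrite le_eqVlt; apply/orP; left; apply/eqP.
by apply: eq_bigr => n _; rewrite leq_addr.
Qed.

End ValueBound.

(** Rankin's trick: a^m = (a/b)^m b^m <= (a/b)^m0 b^m for m >= m0. *)
Lemma exp_tail_le (R : realType) (a b : R) (m0 N : nat) : 0 <= a -> a <= b ->
  \sum_(m < N | (m0 <= m)%N) a ^+ m / m`!%:R <= (a / b) ^+ m0 * expR b.
Proof.
move=> a0 ab; have b0 := le_trans a0 ab.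
have [b00|bn0] := eqVneq b 0.
  have a00 : a = 0 by apply/eqP; rewrite eq_le a0 -b00 ab.
  rewrite b00 expR0 mulr1 a00 mul0r.
  case: m0 => [|m0].
    case: N => [|N]; first by rewrite big_ord0 expr0.
    rewrite big_mkcond big_ord_recl /= big1 ?addr0 ?expr0 ?fact0 ?divr1// => m _.
    by rewrite expr0n /= mul0r.
  rewrite big1 ?exprn_ge0// => m hm; rewrite expr0n gtn_eqF ?mul0r//.
  exact: leq_trans hm.
have bp : 0 < b by rewrite lt_neqAle eq_sym bn0.
have e_le : \sum_(m < N) b ^+ m / m`!%:R <= expR b.
  have -> : \sum_(m < N) b ^+ m / m`!%:R = series (exp_coeff b) N.
    by rewrite /series /= big_mkord.
  rewrite /expR; apply: nondecreasing_cvgn_le; last exact: is_cvg_series_exp_coeff.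
  apply: nondecreasing_series => n _ _; rewrite /exp_coeff /=.
  by rewrite divr_ge0 ?exprn_ge0.
rewrite (le_trans _ (ler_wpM2l _ e_le)) ?exprn_ge0 ?divr_ge0//.
rewrite mulr_sumr big_mkcond ler_sum// => m _; case: leqP => [m0m|_]; last first.
  by rewrite mulr_ge0 ?exprn_ge0 ?divr_ge0 ?exprn_ge0.
rewrite mulrA ler_wpM2r ?invr_ge0//.
rewrite -[in leRHS](subnK m0m) exprD -[in leLHS](subnK m0m) exprD.
have -> : (a / b) ^+ m0 * (b ^+ (m - m0) * b ^+ m0) = b ^+ (m - m0) * a ^+ m0.
  by rewrite expr_div_n mulrCA divfK// expf_neq0.
by rewrite ler_wpM2r ?exprn_ge0// lerXn2r ?nnegrE.
Qed.

(** * The lower bound with free parameters *)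

Lemma double_shift_inj (i j s : nat) :
  2 * (i%:Z - s%:Z) = 2 * (j%:Z - s%:Z) -> i = j.
Proof. lia. Qed.

Lemma shift_norm_le (i s : nat) : (i < (2 * s).+1)%N -> `|i%:Z - s%:Z| <= s%:Z.
Proof. lia. Qed.

(** If P did not divide Q, the two would be coprime over the rationals, hence without common root in
    any extension. *)
Lemma irreducible_coprime_root (F : numFieldType) (P Q : {poly int}) (xi : F) :
  irreducible_poly P -> root (map_poly intr P) xi -> Q != 0 ->
  (P %| Q) = root (map_poly intr Q) xi.
Proof.
move=> irrP rP Q0.
have toF S : map_poly intr S = map_poly (ratr : rat -> F) (map_poly intr S).
  by rewrite -map_poly_comp; apply: eq_map_poly => z /=; rewrite ratr_int.
apply/idP/idP => [PQ|rQ].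
  have : map_poly (ratr : rat -> F) (map_poly intr P) %| map_poly (ratr : rat -> F) (map_poly intr Q).
    by rewrite dvdp_map dvdp_rat_int.
  by rewrite -!toF -!dvdp_XsubCl in rP * => /(dvdp_trans rP).
rewrite -dvdp_rat_int; apply/negPn/negP.
rewrite -(irreducible_poly_coprime (p := map_poly intr P)); last exact/irreducible_rat_int.
rewrite -(coprimep_map (ratr : {rmorphism rat -> F})) -!toF.
by move=> /coprimep_root/(_ rP); rewrite (rootP rQ) eqxx.
Qed.

Lemma irreducible_resultant_neq0 (F : numFieldType) (P Q : {poly int}) (xi : F) :
  irreducible_poly P -> root (map_poly intr P) xi -> ~~ root (map_poly intr Q) xi ->
  resultant P Q != 0.
Proof.
move=> irrP rP rQ; rewrite resultant_eq0; apply/negP => s1.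
have Q0 : Q != 0 by apply: contraNneq rQ => ->; rewrite rmorph0 root0.
have := irrP.2 (Pdiv.Idomain.gcdp P Q); rewrite gtn_eqF// => /(_ isT).
rewrite dvdp_gcdl => /(_ isT) gP; move/negP: rQ; apply.
rewrite -(irreducible_coprime_root irrP rP Q0).
by rewrite -(eqp_dvdl _ gP) dvdp_gcdr.
Qed.

Lemma normC_of_real (R : realType) (r : R) : `|(r%:C)%C| = (`|r|%:C)%C.
Proof. by rewrite normc_def /= expr0n addr0 sqrtr_sqr. Qed.

Lemma Re_Im_le_norm (R : realType) (z : R[i]) (b : R) : `|z| <= (b%:C)%C ->
  `|complex.Re z| <= b /\ `|complex.Im z| <= b.
Proof.
move=> zb; split; rewrite -lecR; apply: le_trans zb; first exact: normc_ge_Re.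
have -> : `|z| = `|z * 'i%C|.
  by rewrite normrM [`|'i%C|]normc_def /= expr0n expr1n add0r sqrtr1 mulr1.
by rewrite (le_trans _ (normc_ge_Re _))// ReiNIm normrN.
Qed.

Lemma pow_div_fact_le_expR (R : realType) (a : R) m : 0 <= a -> a ^+ m / m`!%:R <= expR a.
Proof.
move=> a0; have h := @exp_tail_le R a a m m.+1 a0 (lexx _).
have [->|an0] := eqVneq a 0.
  rewrite expR0 expr0n; case: eqP => [->|_]; last by rewrite mul0r.
  by rewrite fact0 divr1.
move: h; rewrite divff// expr1n mul1r; apply: le_trans.
rewrite big_mkcond big_ord_recr /= leqnn lerDr sumr_ge0// => i _.
by case: ifP => // _; rewrite divr_ge0 ?exprn_ge0.
Qed.

Section Criterion.
Variable R : realType.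
Local Notation C := R[i].
Local Notation toC x := ((x : R)%:C)%C.
Variables (d K S0 L0 T H : nat) (P : {poly int}).
Let L := (2 * L0).+1.
Let M := (K * L0)%N.
Let M' := (M - K)%N.
(** Since pi <= 4, this bounds |2 pi s| + 1 for |s| <= S0. *)
Let R1 : R := (8 * S0).+1%:R.
(** With q + 1 = (H+1)^(2d), the pigeonhole condition for 2M real forms in 2 d K L unknowns compares
    the exponents 4 d K L0 and 4 d K L0 + 2 d K. *)
Let q := ((H.+1) ^ (2 * d)).-1.
Let B : R := (K * L * d * 2)%:R * (4 ^+ d * (R1 ^+ K * expR (L0%:R * R1))).
Let eps : R := H%:R * B / q%:R.
Let Phi : R := (d * 2)%:R * (H%:R * 4 ^+ d).
Let tau : R := (L0%:R * R1 / M'%:R) ^+ M' * expR M'%:R.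
(** [W] bounds the lengths of the integer polynomials and [V] their values at pi. *)
Let W := (K * (L * (d * (2 * (H * (denom T K * 2 ^ (T + L0)) * (2 * S0).+1 ^ K)))))%N.
Let V : R := (denom T K)%:R *
  (2 ^+ T * (M%:R * (eps + eps) + (K * L)%:R * Phi * (R1 ^+ K * tau))).

Hypotheses (d0 : (0 < d)%N) (K0 : (0 < K)%N) (H0 : (0 < H)%N).
Hypothesis (TM : (T <= M)%N).
Hypothesis L0R1 : L0%:R * R1 <= M'%:R.

Let R1_ge1 : 1 <= R1. Proof. by rewrite /R1 ler1n. Qed.
Let R1_ge0 : 0 <= R1. Proof. exact: le_trans ler01 R1_ge1. Qed.

Let pi4 : (pi : R) <= 4.
Proof. by have := pihalf_lt2 R; lra. Qed.

Let pi0 : 0 <= (pi : R). Proof. exact: pi_ge0. Qed.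

Let w (l : 'I_L) : C := (l%:Z - L0%:Z)%:~R * 'i%C.

Let norm_i : `|'i%C : C| = 1.
Proof. by rewrite normc_def /= expr0n expr1n add0r sqrtr1. Qed.

Let w_le l : `|w l| <= toC L0%:R.
Proof.
rewrite /w normrM norm_i mulr1 -intr_norm rmorph_nat -[L0%:R]/((L0%:Z)%:~R) ler_int.
by have := ltn_ord l; rewrite /L; lia.
Qed.

(** Contribution of the unknown [p k l j b] to the n-th Taylor coefficient of the auxiliary
    function, weighted by R1^n. *)
Let unit_coef (n : nat) (k : 'I_K) (l : 'I_L) (j : 'I_d) (b : bool) : C :=
  'i%C ^+ b * toC pi ^+ j * (if (n < k)%N then 0 else w l ^+ (n - k) / (n - k)`!%:R) * toC R1 ^+ n.

Let unit_coef_le n k l j b :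
  `|unit_coef n k l j b| <= toC (4 ^+ d * (R1 ^+ K * expR (L0%:R * R1))).
Proof.
rewrite /unit_coef !normrM !normrX norm_i expr1n mul1r !normC_of_real (ger0_norm pi0) (ger0_norm R1_ge0).
have p4 : toC pi ^+ j <= toC (4 ^+ d).
  rewrite -rmorphXn lecR (@le_trans _ _ (4 ^+ j))//; first by rewrite lerXn2r ?nnegrE.
  by rewrite ler_weXn2l// ?ler1n// ltnW.
have piC : 0 <= toC pi by rewrite ler0c.
have R1C : 0 <= toC R1 by rewrite ler0c.
rewrite -mulrA [X in _ <= X]rmorphM; apply: ler_pM => //.
- exact: exprn_ge0.
- by rewrite mulr_ge0 ?exprn_ge0.
case: ltnP => nk.
  by rewrite normr0 mul0r ler0c mulr_ge0 ?exprn_ge0 ?expR_ge0.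
rewrite normrM normrX normfV normr_nat -[in X in _ * X](subnK nk) exprD.
have wl : `|w l| ^+ (n - k) <= toC (L0%:R ^+ (n - k)).
  by rewrite rmorphXn lerXn2r ?nnegrE ?w_le// ler0c.
apply: (@le_trans _ _ (toC (L0%:R ^+ (n - k)) / (n - k)`!%:R * (toC R1 ^+ (n - k) * toC R1 ^+ k))).
  by rewrite ler_wpM2r ?mulr_ge0 ?exprn_ge0 ?ler0c// ler_wpM2r// invr_ge0.
have natC (a : nat) : (a%:R : C) = toC a%:R by rewrite rmorph_nat.
have -> : toC (L0%:R ^+ (n - k)) / (n - k)`!%:R * (toC R1 ^+ (n - k) * toC R1 ^+ k) =
    toC (L0%:R ^+ (n - k) / (n - k)`!%:R * (R1 ^+ (n - k) * R1 ^+ k)).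
  by rewrite natC !rmorphM fmorphV !rmorphXn.
rewrite lecR; have -> : L0%:R ^+ (n - k) / (n - k)`!%:R * (R1 ^+ (n - k) * R1 ^+ k) =
   R1 ^+ k * ((L0%:R * R1) ^+ (n - k) / (n - k)`!%:R) by rewrite exprMn; ring.
rewrite ler_pM ?exprn_ge0 ?divr_ge0 ?exprn_ge0 ?mulr_ge0//.
  by rewrite ler_weXn2l// ltnW.
by apply: pow_div_fact_le_expR; rewrite mulr_ge0.
Qed.

Let idx := ('I_K * 'I_L * 'I_d * bool)%type.

(** The pigeonhole principle is applied to real and imaginary parts separately, hence 2M forms and
    the bound eps + eps. *)
Let small_coefficients : exists p : 'I_K -> 'I_L -> 'I_d -> bool -> int,
  [/\ exists k l j b, p k l j b != 0,
      forall k l j b, `|p k l j b| <= H%:Z &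
      forall n, (n < M)%N ->
        `|taylor_coef (coef_at p 'i%C (toC pi)) w n| * toC R1 ^+ n <= toC (eps + eps)].
Proof.
pose u (i : 'I_(M + M)) (a : idx) : R :=
  match fintype.split i with
  | inl n => complex.Re (unit_coef n a.1.1.1 a.1.1.2 a.1.2 a.2)
  | inr n => complex.Im (unit_coef n a.1.1.1 a.1.1.2 a.1.2 a.2)
  end.
have L_gt0 : (0 < L)%N by [].
have B0 : 0 < B.
  by rewrite /B !mulr_gt0 ?ltr0n ?muln_gt0 ?K0 ?d0 ?exprn_gt0 ?expR_gt0//.
have Hp : (1 < H.+1 ^ (2 * d))%N 
  by have := @ltn_exp2r 1 H.+1 (2 * d); rewrite exp1n ltnS H0 muln_gt0 d0 => ->.
have uB i : \sum_a `|u i a| <= B.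
  rewrite /B.
  have -> : (K * L * d * 2)%:R * (4 ^+ d * (R1 ^+ K * expR (L0%:R * R1))) =
     \sum_(a : idx) (4 ^+ d * (R1 ^+ K * expR (L0%:R * R1))) :> R.
    by rewrite sumr_const !card_prod !card_ord card_bool mulr_natl.
  rewrite ler_sum// => a _.
  have [h1 h2] := Re_Im_le_norm (unit_coef_le
    (if fintype.split i is inl n then n else if fintype.split i is inr n then n else 0%N)
    a.1.1.1 a.1.1.2 a.1.2 a.2).
  by rewrite /u; move: h1 h2; case: (fintype.split i) => n.
have q0 : (0 < q)%N by rewrite /q -ltnS prednK// ltnW.
have card : (q.+1 ^ (M + M) < H.+1 ^ #|{: idx}|)%N.
  rewrite /q prednK ?(ltnW Hp)// -expnM !card_prod !card_ord card_bool ltn_exp2l//.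
  by rewrite /M /L; nia.
have [p [[a pa] pH pu]] := small_linear_forms B0 uB q0 card.
exists (fun k l j b => p (k, l, j, b)); split => [| |n nM].
- by case: a pa => [[[k l] j] b] pa; exists k, l, j, b.
- by move=> *; exact: pH.
have tE : taylor_coef (coef_at (fun k l j b => p (k, l, j, b)) 'i%C (toC pi)) w n * toC R1 ^+ n
   = \sum_(a : idx) (p a)%:~R * unit_coef n a.1.1.1 a.1.1.2 a.1.2 a.2.
  rewrite /taylor_coef mulr_suml.
  transitivity (\sum_k \sum_l \sum_j \sum_b (p (k, l, j, b))%:~R * unit_coef n k l j b).
    apply: eq_bigr => k _; rewrite mulr_suml; apply: eq_bigr => l _.
    rewrite /coef_at !mulr_suml; apply: eq_bigr => j _; rewrite !mulr_suml.
    by apply: eq_bigr => b _; rewrite /unit_coef !mulrA.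
  by rewrite !pair_big /=; apply: eq_bigr => -[[[k l] j] b] _.
have -> : `|taylor_coef (coef_at (fun k l j b => p (k, l, j, b)) 'i%C (toC pi)) w n| * toC R1 ^+ n
   = `|\sum_(a : idx) (p a)%:~R * unit_coef n a.1.1.1 a.1.1.2 a.1.2 a.2|.
  by rewrite -tE normrM normrX normC_of_real (ger0_norm R1_ge0).
have intC (m : int) : (m%:~R : C) = toC m%:~R by rewrite rmorph_int.
apply: norm_Re_Im_le.
  have := pu (lshift M (Ordinal nM)); rewrite Re_sum; congr (`|_| <= _).
  apply: eq_bigr => a' _; rewrite /u; case: splitP => //= n' nn'; last
  by have := leq_addr n' M; rewrite -nn' leqNgt nM.
  have -> : n' = n :> nat by rewrite -nn'.
  by rewrite intC; case: (unit_coef _ _ _ _ _) => x y /=; rewrite mul0r subr0.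
have := pu (rshift M (Ordinal nM)); rewrite Im_sum; congr (`|_| <= _).
apply: eq_bigr => a' _; rewrite /u; case: splitP => //= n' nn'; first
  by have := ltn_ord n'; rewrite -nn' ltnNge leq_addr.
have -> : n' = n :> nat by apply/eqP; rewrite -(eqn_add2l M) -nn'.
by rewrite intC; case: (unit_coef _ _ _ _ _) => x y /=; rewrite mul0r addr0.
Qed.

Hypotheses (irrP : irreducible_poly P) (sP : size P = d.+1).
Hypothesis P0 : ~~ root P 0.
Hypothesis KT : (K <= T.+1)%N.
Hypothesis dims : forall n, (0 < n <= K)%N ->
  (n * (2 * L0) < minn (2 * S0).+1 n * (T - n.-1))%N.

Let root_neq0 (xi : C) : root (map_poly intr P) xi -> xi != 0.
Proof.
move=> rP; apply/eqP => xi0; move: rP P0.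
by rewrite xi0 /root !horner_coef0 coef_map /= intr_eq0 => ->.
Qed.

(* xi may have degree d/2 over Q(i), but the two signs of iota cannot both   *)
(* annihilate the coefficient sum_j (p_j0 + iota p_j1) xi^j.                 *)
Let coef_at_neq0 (p : 'I_K -> 'I_L -> 'I_d -> bool -> int) (xi : C) k l j b :
  root (map_poly intr P) xi -> p k l j b != 0 ->
  exists2 iota : C, iota ^+ 2 = -1 & coef_at p iota xi k l != 0.
Proof.
move=> rP pn0; pose Q b := \poly_(j < d) (if insub j is Some j' then p k l j' b else 0).
have sQ b' : (size (Q b') <= d)%N by exact: size_poly.
have Qval b' : (map_poly intr (Q b')).[xi] = \sum_(j < d) (p k l j b')%:~R * xi ^+ j.
  have sQ' : (size (map_poly intr (Q b') : {poly C}) <= d)%N.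
    by rewrite (leq_trans (size_poly _ _))// sQ.
  rewrite (horner_coef_wide _ sQ'); apply: eq_bigr => i _.
  by rewrite coef_map coef_poly ltn_ord /= insubT//= => h; congr ((p _ _ _ _)%:~R * _); apply: val_inj.
have coefE iota : coef_at p iota xi k l =
    (map_poly intr (Q false)).[xi] + iota * (map_poly intr (Q true)).[xi].
  rewrite /coef_at !Qval mulr_sumr -big_split; apply: eq_bigr => i _.
  by rewrite big_bool /= expr0 expr1; ring.
have Qb0 : Q b != 0.
  apply: contraNneq pn0 => /polyP/(_ j); rewrite coef_poly ltn_ord coef0 insubT//= => h.
  by move=> <-; apply/eqP; congr (p _ _ _ _); apply: val_inj.
have Qroot : ~~ root (map_poly intr (Q b)) xi.
  rewrite -(irreducible_coprime_root irrP rP Qb0); apply/negP => /(dvdp_leq Qb0).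
  by rewrite sP ltnNge sQ.
have i2 : ('i%C : C) ^+ 2 = -1 by exact: sqr_i.
have i2' : (- 'i%C : C) ^+ 2 = -1 by rewrite sqrrN i2.
have [c1|c1] := eqVneq (coef_at p 'i%C xi k l) 0; last by exists 'i%C.
have [c2|c2] := eqVneq (coef_at p (- 'i%C) xi k l) 0; last by exists (- 'i%C).
exfalso; move: Qroot; rewrite /root; apply/negP; rewrite negbK.
have i0 : ('i%C : C) != 0 by rewrite -normr_eq0 norm_i oner_eq0.
rewrite coefE in c1; rewrite coefE mulNr in c2.
have two0 : (2 : C) != 0 by rewrite pnatr_eq0.
have f0 : (map_poly intr (Q false)).[xi] = 0 :> C.
  apply: (mulfI two0); rewrite mulr0 -[RHS]addr0 -{1}c1 -c2; ring.
have t0 : (map_poly intr (Q true)).[xi] = 0 :> C.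
  by apply: (mulfI i0); rewrite mulr0 -[RHS]c1 f0 add0r.
by case: (b); apply/eqP.
Qed.

(** Otherwise the nonzero polynomial F with coefficients [coef_at] would have vanishing derivatives
    of all orders below T at the 2 S0 + 1 points (2 s xi, 1), distinct because xi is nonzero; [dims]
    contradicts [zero_estimate]. *)
Let nonvanishing (p : 'I_K -> 'I_L -> 'I_d -> bool -> int) (xi : C) :
  root (map_poly intr P) xi -> (exists k l j b, p k l j b != 0) ->
  exists iota : C, exists s : int, exists t : nat,
    [/\ iota ^+ 2 = -1, `|s| <= S0%:Z, (t < T)%N &
     \sum_(k < K) \sum_(l < L) coef_at p iota xi k l
     * (twist (- iota) ((2 * s)%:~R * xi) k (binp C t)).[l%:R - L0%:R] != 0].
Proof.
move=> rP [k [l [j [b pn0]]]].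
have xi0 := root_neq0 rP.
have [iota i2 cn0] := coef_at_neq0 rP pn0.
exists iota; apply: contrapT => hno.
have van (s : int) t : `|s| <= S0%:Z -> (t < T)%N ->
    \sum_(k < K) \sum_(l < L) coef_at p iota xi k l
     * (twist (- iota) ((2 * s)%:~R * xi) k (binp C t)).[l%:R - L0%:R] = 0.
  by move=> sS tT; apply/eqP; apply: contrapT => /negP h; apply: hno; exists s, t.
pose phi (k l : nat) : C := if insub k is Some k' then
  if insub l is Some l' then coef_at p iota xi k' l' else 0 else 0.
have phiE (k' : 'I_K) (l' : 'I_L) : phi k' l' = coef_at p iota xi k' l'.
  by rewrite /phi !valK.
pose F := \poly_(k < K) \poly_(l < L) phi k l.
have FE (k' : 'I_K) (l' : 'I_L) : F`_k'`_l' = coef_at p iota xi k' l'.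
  by rewrite coef_poly ltn_ord coef_poly ltn_ord phiE.
have Fn0 : F != 0.
  by apply: contraNneq cn0 => F0; rewrite -FE F0 !coef0.
have sF : (size F <= K)%N by exact: size_poly.
have sFk k' : (size (F`_k')%R <= L)%N.
  by rewrite coef_poly; case: ifP => _; rewrite ?size_poly0// size_poly.
have iota0 : - iota != 0.
  by rewrite oppr_eq0; apply/eqP => i0; move/eqP: i2; rewrite i0 expr0n eq_sym oppr_eq0 oner_eq0.
pose pts := [seq (2 * (i%:Z - S0%:Z))%:~R * xi | i <- seq.iota 0 (2 * S0).+1].
have upts : uniq pts.
  rewrite map_inj_uniq ?iota_uniq// => i1 i2' /(mulIf xi0)/intr_inj; exact: double_shift_inj.
have spts : size pts = (2 * S0).+1 by rewrite size_map size_iota.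
have vanF y : y \in pts -> forall t, (t < T)%N -> (iter t (dxy (- iota)) F).[y%:P].[1] = 0.
  move=> /mapP[i hi ->]; apply: (dxy_vanishing (a := L0%:R) sF sFk) => t tT.
  rewrite /pairing; under eq_bigr do under eq_bigr do rewrite FE.
  by apply: van => //; apply: shift_norm_le; rewrite mem_iota in hi.
have := zero_estimate iota0 Fn0 upts (L := (2 * L0)%N) sFk (leq_trans sF KT) vanF.
rewrite spts leqNgt dims//.
by rewrite size_poly_gt0 Fn0.
Qed.

Let real_horner (Q : {poly int}) (y : R) :
  (map_poly intr Q).[toC y] = toC (map_poly intr Q).[y].
Proof.
rewrite -horner_map /= -map_poly_comp; congr (_.[_]); apply: eq_map_poly => z /=.
by rewrite rmorph_int.
Qed.

Let coef_at_pi_le (p : 'I_K -> 'I_L -> 'I_d -> bool -> int) k l :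
  (forall k l j b, `|p k l j b| <= H%:Z) ->
  `|coef_at p 'i%C (toC pi) k l| <= toC Phi.
Proof.
move=> pH; have -> : toC Phi = \sum_(j < d) \sum_(b : bool) toC (H%:R * 4 ^+ d).
  by rewrite sumr_const card_ord sumr_const card_bool -mulrnA -rmorphMn /= /Phi mulnC mulr_natl.
rewrite (le_trans (ler_norm_sum _ _ _))// ler_sum// => j _.
rewrite (le_trans (ler_norm_sum _ _ _))// ler_sum// => b _.
rewrite !normrM !normrX norm_i expr1n mulr1 normC_of_real (ger0_norm pi0) rmorphM.
have pij : (pi : R) ^+ j <= 4 ^+ d.
  rewrite (@le_trans _ _ (4 ^+ j))//; first by rewrite lerXn2r ?nnegrE.
  by rewrite ler_weXn2l// ?ler1n// ltnW.
have pijC : toC pi ^+ j <= toC (4 ^+ d) by rewrite -rmorphXn lecR.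
have pC : `|(p k l j b)%:~R : C| <= toC H%:R.
  by rewrite -intr_norm rmorph_nat -[H%:R]/((H%:Z)%:~R) ler_int.
by apply: ler_pM => //; rewrite exprn_ge0// ler0c.
Qed.

(** At xi = pi and iota = i the sum is B_t(-i d/dx) f at 2 pi s, because -i times the frequency
    [w l] is l - L0. *)
Let value_at_pi_le (p : 'I_K -> 'I_L -> 'I_d -> bool -> int) (s : int) t :
  (forall k l j b, `|p k l j b| <= H%:Z) ->
  (forall n, (n < M)%N ->
    `|taylor_coef (coef_at p 'i%C (toC pi)) w n| * toC R1 ^+ n <= toC (eps + eps)) ->
  `|s| <= S0%:Z -> (t < T)%N ->
  `|\sum_(k < K) \sum_(l < L) coef_at p 'i%C (toC pi) k l
     * (twist (- 'i%C) ((2 * s)%:~R * toC pi) k (binp C t)).[l%:R - L0%:R]|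
   <= toC (2 ^+ T * (M%:R * (eps + eps) + (K * L)%:R * Phi * (R1 ^+ K * tau))).
Proof.
move=> pH psmall sS tT.
have xE : (2 * s)%:~R * toC pi = toC (s%:~R * (pi *+ 2)).
  by rewrite intrM !rmorphM /= rmorph_int rmorphMn /= -mulr_natl; ring.
have cw l : (- 'i%C) * w l = l%:R - L0%:R.
  have ii : ('i%C : C) * 'i%C = -1 by rewrite -expr2; exact: sqr_i.
  by rewrite /w mulrCA mulNr ii opprK mulr1 rmorphB.
have c1 : `|- 'i%C : C| = 1 by rewrite normrN norm_i.
have xR1 : `|toC (s%:~R * (pi *+ 2))| + 1 <= toC R1.
  have oneC : (1 : C) = toC 1 by rewrite rmorph1.
  rewrite normC_of_real oneC -rmorphD lecR normrM normrMn (ger0_norm pi0).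
  rewrite /R1 -natr1 lerD2r -intr_norm natrM.
  have sS' : (`|s|%:~R : R) <= S0%:R by rewrite -[S0%:R]/((S0%:Z)%:~R) ler_int.
  have s0 : 0 <= (`|s|%:~R : R) by rewrite ler0z.
  by move: pi4 pi0 => a b; rewrite -mulr_natr; nra.
have tail N : \sum_(m < N | (M - K <= m)%N) (toC L0%:R * toC R1) ^+ m / m`!%:R <= toC tau.
  have := @exp_tail_le R (L0%:R * R1) M'%:R M' N _ L0R1.
  rewrite mulr_ge0// => /(_ isT); rewrite -lecR; apply: le_trans.
  rewrite rmorph_sum le_eqVlt; apply/orP; left; apply/eqP; apply: eq_bigr => m _.
  have natC (a : nat) : (a%:R : C) = toC a%:R by rewrite rmorph_nat.
  by rewrite natC !rmorphM fmorphV !rmorphXn /= rmorphM.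
have Phi0 : 0 <= toC Phi by rewrite ler0c !mulr_ge0 ?exprn_ge0.
have Om0 : 0 <= toC L0%:R by rewrite ler0c.
have expw l : tends_to (fun N => (partial_exp N (w l)).[toC (s%:~R * (pi *+ 2))]) 1.
  exact: tends_to_exp_2pi_i.
have := twist_combination_le c1 xR1 Phi0 Om0 (fun k l => coef_at_pi_le k l pH) w_le expw tail psmall
  (ltnW (leq_trans tT TM)).
rewrite xE; under eq_bigr do under eq_bigr do rewrite cw.
move=> /le_trans; apply.
have eps0 : 0 <= eps.
  by rewrite /eps /B divr_ge0 ?mulr_ge0 ?exprn_ge0 ?expR_ge0.
have tau0 : 0 <= tau by rewrite /tau mulr_ge0 ?expR_ge0 ?exprn_ge0 ?divr_ge0 ?mulr_ge0.
have Phi0' : 0 <= Phi by rewrite /Phi !mulr_ge0 ?exprn_ge0.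
have E0 : 0 <= M%:R * (eps + eps) + (K * L)%:R * Phi * (R1 ^+ K * tau).
  apply: addr_ge0; first by apply: mulr_ge0 => //; apply: addr_ge0.
  apply: mulr_ge0; apply: mulr_ge0 => //; exact: exprn_ge0.
have -> : M%:R * toC (eps + eps) + (K * L)%:R * toC Phi * (toC R1 ^+ K * toC tau) =
   toC (M%:R * (eps + eps) + (K * L)%:R * Phi * (R1 ^+ K * tau)).
  have natC (a : nat) : (a%:R : C) = toC a%:R by rewrite rmorph_nat.
  by rewrite !natC [RHS](rmorphD (real_complex R)) !(rmorphM (real_complex R)) !(rmorphXn (real_complex R)).
rewrite [leRHS]rmorphM ler_wpM2r ?ler0c// rmorphXn rmorph_nat.
by rewrite ler_weXn2l ?ler1n// ltnW.
Qed.

Lemma criterion (Lam : R) : 1 <= Lam -> (poly_length P)%:~R <= Lam ->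
  1 <= (K + d)%:R * 4 ^+ (K + d) * Lam ^+ (K + d) * W%:R ^+ d * `|(map_poly intr P).[pi]|
     + d%:R * 4 ^+ d * Lam ^+ (K + d) * W%:R ^+ d.-1 * V.
Proof.
move=> Lam1 PLam.
have [xi rP] : exists xi : C, root (map_poly intr P) xi.
  apply/closed_rootP; rewrite size_map_inj_poly ?sP//; last exact: intr_inj.
  by case: (d) d0.
have [p [pn0 pH psmall]] := small_coefficients.
have [iota [s [t [i2 sS tT vn0]]]] := nonvanishing rP pn0.
have [m mP] := denom_binp_int C K L0 (ltnW tT).
have mE (l : 'I_L) (j : 'I_K) : (denom T K)%:R * (binp C t)^`(j).[l%:R - L0%:R] = (m l j)%:~R.
  by have [] := mP l j.
have mB (l : 'I_L) (j : 'I_K) : `|m l j| <= ((denom T K) * 2 ^ (T + L0))%N%:Z.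
  by have [] := mP l j.
have D0 : (denom T K)%:R != 0 :> C by rewrite pnatr_eq0 -lt0n denom_gt0.
(* At xi the combination Q_re + iota Q_im is nonzero, so one of the two polynomials survives there.
   At pi they are the real and imaginary parts of a single small number, so both are at most V. *)
have [g g1 [gxi gpi]] : exists2 g : nat -> int, (forall e, `|g e| <= 1) &
    ~~ root (map_poly intr (value_poly p s m g)) xi /\
    `|(map_poly intr (value_poly p s m g)).[pi]| <= V.
  have vxi := value_polyE p s xi i2 mE.
  have ii : ('i%C : C) ^+ 2 = -1 by exact: sqr_i.
  have vpi := value_polyE p s (toC pi) ii mE.
  have vb : `|(map_poly intr (value_poly p s m re_i4)).[toC pi]
   + 'i%C * (map_poly intr (value_poly p s m im_i4)).[toC pi]| <= toC V.
    rewrite vpi normrM normr_nat.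
    rewrite /V (rmorphM (real_complex R)) rmorph_nat; apply: ler_wpM2l => //.
    exact: value_at_pi_le.
  have [vre vim] : `|(map_poly intr (value_poly p s m re_i4)).[pi]| <= V /\
     `|(map_poly intr (value_poly p s m im_i4)).[pi]| <= V.
    have [] := Re_Im_le_norm vb; rewrite !real_horner.
    by rewrite /= !(mul0r, mulr0, mul1r, sub0r, add0r, oppr0, addr0, subr0).
  have [rre|] := boolP (root (map_poly intr (value_poly p s m re_i4)) xi); last first.
    by move=> h; exists re_i4 => // e; have [] := norm_i4_le1 e.
  have [rim|] := boolP (root (map_poly intr (value_poly p s m im_i4)) xi); last first.
    by move=> h; exists im_i4 => // e; have [] := norm_i4_le1 e.
  exfalso; move/eqP: vxi; rewrite (rootP rre) (rootP rim) mulr0 addr0 eq_sym.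
  by rewrite mulf_eq0 (negPf D0) (negPf vn0).
have W1 : 1 <= W%:R :> R.
  rewrite ler1n /W !muln_gt0 K0 d0 H0 denom_gt0 !expn_gt0 /=.
  by [].
have QW : (poly_length (value_poly p s m g))%:~R <= W%:R :> R.
  rewrite -[W%:R]/((W%:Z)%:~R) ler_int /W.
  exact: (length_value_poly pH sS mB g1).
have pA : `|pi : R| <= 4 by rewrite ger0_norm.
have A1 : (1 : R) <= 4 by rewrite ler1n.
have dP : (0 < (size P).-1)%N by rewrite sP.
have sQ : ((size (value_poly p s m g)).-1 <= K + d)%N.
  by rewrite (leq_trans (leq_pred _))// size_value_poly.
have := resultant_le A1 pA Lam1 W1 PLam QW dP sQ (irreducible_resultant_neq0 irrP rP gxi).
rewrite sP /= => /le_trans; apply; rewrite lerD2l ler_wpM2l//.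
by rewrite !mulr_ge0 ?exprn_ge0 ?(le_trans ler01 Lam1) ?(le_trans ler01 W1).
Qed.

End Criterion.

(** * Numerical estimates and the size of the common denominator *)

Section Numerics.
Variable R : realType.
Implicit Types (x y z : R).

Lemma pow_le_expR (x : R) n : 0 <= 1 + x -> (1 + x) ^+ n <= expR (x * n%:R).
Proof.
by move=> x1; rewrite expRM_natr lerXn2r ?nnegrE ?expR_ge0// expR_ge1Dx.
Qed.

Lemma exprn_mono (a b : R) n : 0 <= a -> a <= b -> a ^+ n <= b ^+ n.
Proof. by move=> a0 ab; rewrite lerXn2r ?nnegrE// (le_trans a0). Qed.

(** From 2 <= (1 + 1/100)^70 <= e^(7/10), with the power computed in two stages. *)
Lemma ln2_le : ln 2 <= 7 / 10 :> R.
Proof.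
rewrite -[leRHS]expRK ler_ln ?posrE ?expR_gt0//.
have h10 : 11046 / 10000 <= (1 + 1 / 100) ^+ 10 :> R by lra.
have h70 : 2 <= ((1 + 1 / 100) ^+ 10) ^+ 7 :> R.
  apply: (@le_trans _ _ ((11046 / 10000) ^+ 7)); first by clear; lra.
  apply: exprn_mono h10; clear; lra.
have x0 : 0 <= 1 + 1 / 100 :> R by clear; lra.
rewrite -exprM in h70; apply: (le_trans h70).
by rewrite (le_trans (pow_le_expR 70 x0))// ler_expR; clear; lra.
Qed.

Lemma harmonic_le K : (0 < K)%N -> \sum_(1 <= i < K.+1) (i%:R)^-1 <= 1 + ln K%:R :> R.
Proof.
elim: K => // -[|K] IH _; first by rewrite big_nat1 invr1 ln1 addr0.
rewrite big_nat_recr//=; have K1 : 0 < K.+1%:R :> R by rewrite ltr0n.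
have K2 : 0 < K.+2%:R :> R by rewrite ltr0n.
rewrite (le_trans (lerD (IH isT) (lexx _)))// -addrA lerD2l.
have := @le_ln1Dx R (- (K.+2%:R)^-1).
have -> : 1 - (K.+2%:R)^-1 = K.+1%:R / K.+2%:R :> R.
  have -> : K.+1%:R = K.+2%:R - 1 :> R by rewrite -[K.+2%:R]natr1 addrK.
  by move: K2 => /lt0r_neq0; move: K.+2%:R => b b0; field.
rewrite ln_div ?posrE// ltrN2 invf_lt1// ltr1n => /(_ isT).
by move: (ln _) (ln _) (_^-1) => a b c; lra.
Qed.

(** Each factor lcm(1..T/i) is at most 4^(T/i), and the exponents sum to T times a harmonic
    number. *)
Lemma ln_denom_le T K : (0 < K)%N ->
  ln (denom T K)%:R <= T%:R * ln 4 * (1 + ln K%:R) :> R.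
Proof.
move=> K0; have l4 : 0 <= ln 4 :> R by rewrite ln_ge0// ler1n.
apply: (@le_trans _ _ (\sum_(1 <= i < K) T%:R * ln 4 * (i%:R)^-1)); last first.
  rewrite -mulr_sumr ler_wpM2l ?mulr_ge0// (le_trans _ (harmonic_le K0))//.
  by rewrite big_nat_recr//= lerDl invr_ge0.
rewrite /denom; have lnprod (r : seq nat) : ln (\prod_(i <- r) lcm_upto (T %/ i))%:R =
    \sum_(i <- r) ln (lcm_upto (T %/ i))%:R :> R.
  elim: r => [|i r IH]; first by rewrite !big_nil ln1.
  rewrite !big_cons natrM lnM ?IH ?posrE ?ltr0n ?lcm_upto_gt0//.
  by apply: prodn_gt0 => j; exact: lcm_upto_gt0.
rewrite lnprod !big_nat; apply: ler_sum => i /andP[i0 _].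
have i0' : 0 < i%:R :> R by rewrite ltr0n.
rewrite (@le_trans _ _ (ln (4 ^+ (T %/ i))))//.
  by rewrite ler_ln ?posrE ?ltr0n ?lcm_upto_gt0 ?exprn_gt0// -natrX ler_nat lcm_upto_le.
rewrite lnXn// -[ln 4 *+ _]mulr_natl [leRHS]mulrAC ler_wpM2r//.
by rewrite ler_pdivlMr// -natrM ler_nat leq_trunc_div.
Qed.

End Numerics.

Lemma leq_double_pred n : (1 < n)%N -> (n <= 2 * n.-1)%N.
Proof. by move=> n1; lia. Qed.

Lemma leq4_S0 S0 : (0 < S0)%N -> (4 <= (8 * S0).+1)%N.
Proof. by move=> s; lia. Qed.

Lemma leq_sum_prod K d L0 : (0 < K)%N -> (0 < d)%N -> (0 < L0)%N ->
  (2 * (K + d) <= 64 * (K * L0) * d)%N.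
Proof.
move=> k1 d1 l1; have h1 := leq_pmulr K d1; have h2 := leq_pmull d k1.
have h3 := leq_pmulr (K * d) l1; have e : (64 * (K * L0) * d = 64 * (K * d * L0))%N by ring.
by rewrite e; lia.
Qed.

Section LowerBound.
Variable R : realType.
Variables (d K S0 L0 T H : nat) (P : {poly int}) (Lam g : R).
Let L := (2 * L0).+1.
Let M := (K * L0)%N.
Let M' := (M - K)%N.
Let R1 : R := (8 * S0).+1%:R.
Let W0 := (K * L * d * 2 * denom T K * 2 ^ (T + L0) * (2 * S0).+1 ^ K)%N.
(** The losses of the resultant other than powers of H. In 16^d, one 4^d comes from the resultant
    and one from the powers of pi in the coefficients; [W0] is the length bound without its factor
    H. *)
Let X : R := d%:R * 16 ^+ d * Lam ^+ (K + d) * R1 ^+ K * W0%:R ^+ d.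
Hypotheses (d0 : (0 < d)%N) (K0 : (0 < K)%N) (H0 : (0 < H)%N) (S00 : (0 < S0)%N) (L00 : (0 < L0)%N).
Hypothesis (TM : (T <= M)%N).
Hypothesis L0R1 : L0%:R * R1 <= M'%:R.
Hypotheses (irrP : irreducible_poly P) (sP : size P = d.+1) (P0 : ~~ root P 0).
Hypothesis KT : (K <= T.+1)%N.
Hypothesis dims : forall n, (0 < n <= K)%N ->
  (n * (2 * L0) < minn (2 * S0).+1 n * (T - n.-1))%N.
Hypotheses (Lam1 : 1 <= Lam) (PLam : (poly_length P)%:~R <= Lam).
Hypothesis gE : expR g = 64 * M%:R * expR (L0%:R * R1) * X.
Hypotheses (HgE : H%:R ^+ d <= expR g) (gHE : expR g <= H.+1%:R ^+ d).
Hypothesis tau_le : (L0%:R * R1 / M'%:R) ^+ M' * expR M'%:R <= expR (- (2 * g)) .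

(** The pigeonhole gains a factor q of order at least e^(2g), while the length of Q brings only H^d
    <= e^g into the resultant. Hence the term with Q(pi) in [criterion] is at most 1/2, and the
    coefficient of |P(pi)| is at most e^(2g) / 2. *)
Lemma horner_pi_ge : expR (- (2 * g)) <= `|(map_poly intr P).[pi]|.
Proof.
have := criterion d0 K0 H0 TM L0R1 irrP sP P0 KT dims Lam1 PLam.
rewrite -/M -/M' -/L -/R1.
have tau_le' := tau_le; set tau := _ * expR M'%:R in tau_le' *.
set q := (H.+1 ^ (2 * d)).-1.
set D := denom T K.
set W := (K * (L * _))%N.
have WE : W%:R = W0%:R * H%:R :> R by rewrite -natrM; congr _%:R; rewrite /W /W0 -/D; ring.
have X0 : 0 < X.
  rewrite /X !mulr_gt0 ?exprn_gt0 ?ltr0n ?(lt_le_trans ltr01 Lam1)//.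
  by rewrite !muln_gt0 K0 d0 denom_gt0 !expn_gt0.
have Lam0 : 0 <= Lam := le_trans ler01 Lam1.
have R11 : 1 <= R1 by rewrite ler1n.
have R10 : 0 <= R1 := le_trans ler01 R11.
have R1K0 : 0 <= R1 ^+ K by rewrite exprn_ge0.
have LamK : 0 <= Lam ^+ (K + d) by rewrite exprn_ge0// (le_trans ler01).
have M0 : 0 < M%:R :> R by rewrite ltr0n muln_gt0 K0.
have eL : 0 < expR (L0%:R * R1) by exact: expR_gt0.
have tau0 : 0 <= tau by rewrite /tau mulr_ge0 ?expR_ge0 ?exprn_ge0 ?divr_ge0 ?mulr_ge0.
have W00 : 0 <= W0%:R :> R by [].
have Hd0 : 0 <= H%:R ^+ d :> R by rewrite exprn_ge0.
have H1d : 0 < H.+1%:R ^+ d :> R by rewrite exprn_gt0 ?ltr0n.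
have q_ge : (H.+1%:R ^+ d) ^+ 2 <= 2 * q%:R :> R.
  rewrite -exprM mulnC -natrX -natrM ler_nat /q.
  apply: leq_double_pred.
  by have := @ltn_exp2r 1 H.+1 (2 * d); rewrite exp1n ltnS H0 muln_gt0 d0 => ->.
have q0 : 0 < q%:R :> R.
  have q2 : 0 < (H.+1%:R ^+ d) ^+ 2 :> R by rewrite exprn_gt0.
  by have := lt_le_trans q2 q_ge; rewrite pmulr_rgt0.
set eps := H%:R * _ / q%:R.
set V := D%:R * _.
have Vle : V <= W%:R * (4 ^+ d * R1 ^+ K * (2 * M%:R * expR (L0%:R * R1) / q%:R + tau)).
  have -> : V = (D%:R * 2 ^+ T * (K * L * d * 2)%:R * H%:R) *
     (4 ^+ d * R1 ^+ K * (2 * M%:R * expR (L0%:R * R1) / q%:R + tau)).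
    by rewrite /V /eps !natrM; field; rewrite gt_eqF.
  have N0 : 0 <= 2 * M%:R * expR (L0%:R * R1) :> R.
    by rewrite pmulr_lge0.
  have F0 : 0 <= 2 * M%:R * expR (L0%:R * R1) / q%:R + tau.
    by rewrite addr_ge0// divr_ge0.
  apply: ler_wpM2r; first by apply: mulr_ge0 => //; apply: mulr_ge0 => //; exact: exprn_ge0.
  rewrite -natrX -!natrM ler_nat /W -/D expnD.
  have s1 : (0 < 2 ^ L0)%N by rewrite expn_gt0.
  have s2 : (0 < (2 * S0).+1 ^ K)%N by rewrite expn_gt0.
  have -> : (K * (L * (d * (2 * (H * (D * (2 ^ T * 2 ^ L0)) * (2 * S0).+1 ^ K)))) =
     (D * 2 ^ T * (K * L * d * 2) * H) * (2 ^ L0 * (2 * S0).+1 ^ K))%N by ring.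
  by rewrite leq_pmulr// muln_gt0 s1 s2.
(* The pigeonhole part is e^g H^d / (32 q) <= 1/16; the tail part is at most e^g e^g e^(-2g) /
   64. *)
have second : d%:R * 4 ^+ d * Lam ^+ (K + d) * W%:R ^+ d.-1 * V <= 1 / 2.
  apply: (@le_trans _ _ (X * H%:R ^+ d * (2 * M%:R * expR (L0%:R * R1) / q%:R + tau))).
    apply: le_trans (ler_wpM2l _ Vle) _; first by rewrite !mulr_ge0 ?exprn_ge0.
    have WdE : W0%:R ^+ d * H%:R ^+ d = W%:R ^+ d.-1 * W%:R :> R.
      by rewrite -exprSr prednK// WE exprMn.
    have e16 : 16 ^+ d = 4 ^+ d * 4 ^+ d :> R by rewrite -exprMn -natrM.
    rewrite /X le_eqVlt; apply/orP; left; apply/eqP.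
    have -> : d%:R * 16 ^+ d * Lam ^+ (K + d) * R1 ^+ K * W0%:R ^+ d * H%:R ^+ d =
      d%:R * 16 ^+ d * Lam ^+ (K + d) * R1 ^+ K * (W0%:R ^+ d * H%:R ^+ d) by ring.
    by rewrite WdE e16; ring.
  have t2 : X * H%:R ^+ d * tau <= 1 / 64.
    have XM : 64 * X <= expR g.
      rewrite gE; apply: ler_wpM2r; first exact: ltW.
      rewrite -mulrA -[leLHS]mulr1; apply: ler_wpM2l => //; apply: mulr_ege1.
        by rewrite ler1n muln_gt0 K0.
      by rewrite -expR0 ler_expR mulr_ge0.
    have e2g : expR g * (expR g * expR (- (2 * g))) = 1.
      by rewrite -!expRD -[RHS]expR0; congr expR; ring.
    have s1 : H%:R ^+ d * tau <= expR g * expR (- (2 * g)) by rewrite ler_pM.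
    have s2 : 0 <= H%:R ^+ d * tau by rewrite mulr_ge0.
    have : 64 * X * (H%:R ^+ d * tau) <= 1.
      by rewrite -[leRHS]e2g; apply: ler_pM => //; apply: mulr_ge0 => //; exact: ltW.
    have -> : 64 * X * (H%:R ^+ d * tau) = 64 * (X * H%:R ^+ d * tau) by rewrite !mulrA.
    by move: (X * H%:R ^+ d * tau) => u; lra.
  have t1 : X * H%:R ^+ d * (2 * M%:R * expR (L0%:R * R1) / q%:R) <= 1 / 16.
    rewrite mulrA ler_pdivrMr//.
    have a1 : X * H%:R ^+ d * (2 * M%:R * expR (L0%:R * R1)) = expR g * H%:R ^+ d / 32.
      by rewrite gE; field.
    rewrite a1; have : expR g * H%:R ^+ d <= (H.+1%:R ^+ d) ^+ 2.
      rewrite expr2 ler_pM ?expR_ge0// lerXn2r ?nnegrE// ler_nat//.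
    by move: q_ge; move: (expR g * H%:R ^+ d) (_ ^+ 2) q%:R => u v w; lra.
  by rewrite mulrDr; move: t1 t2; move: (X * _ * (_ / _)) (X * _ * tau) => u v; lra.
have first : 2 * ((K + d)%:R * 4 ^+ (K + d) * Lam ^+ (K + d) * W%:R ^+ d) <= expR (2 * g).
  have -> : expR (2 * g) = expR g * expR g by rewrite -expRD; congr expR; ring.
  rewrite WE exprMn.
  have -> : 2 * ((K + d)%:R * 4 ^+ (K + d) * Lam ^+ (K + d) * (W0%:R ^+ d * H%:R ^+ d)) =
    (2 * (K + d)%:R * 4 ^+ (K + d)) * (Lam ^+ (K + d) * W0%:R ^+ d) * H%:R ^+ d :> R by ring.
  rewrite ler_pM ?mulr_ge0 ?exprn_ge0// gE /X.
  have -> : 64 * M%:R * expR (L0%:R * R1) * (d%:R * 16 ^+ d * Lam ^+ (K + d) * R1 ^+ K * W0%:R ^+ d) =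
    (64 * M%:R * expR (L0%:R * R1) * d%:R * 16 ^+ d * R1 ^+ K) * (Lam ^+ (K + d) * W0%:R ^+ d) by ring.
  rewrite ler_wpM2r ?mulr_ge0 ?exprn_ge0// exprD.
  have -> : 2 * (K + d)%:R * (4 ^+ K * 4 ^+ d) = (2 * (K + d)%:R) * 4 ^+ d * 4 ^+ K :> R by ring.
  have e1 : 1 <= expR (L0%:R * R1) by rewrite -expR0 ler_expR mulr_ge0.
  have k1 : 2 * (K + d)%:R <= 64 * M%:R * expR (L0%:R * R1) * d%:R.
    apply: (@le_trans _ _ (64 * M%:R * d%:R)).
      by rewrite -!natrM ler_nat leq_sum_prod.
    rewrite [leRHS]mulrAC ler_peMr// mulr_ge0//.
  rewrite ler_pM ?mulr_ge0 ?exprn_ge0//; last first.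
    by apply: exprn_mono => //; rewrite ler_nat leq4_S0.
  rewrite ler_pM ?mulr_ge0 ?exprn_ge0// lerXn2r ?nnegrE//; lra.
move=> crit.
have half : 1 <= expR (2 * g) * `|(map_poly intr P).[pi]|.
  apply: le_trans (ler_wpM2r (normr_ge0 _) first).
  rewrite -[leRHS]mulrA; move: second; set b := (X in X <= 1 / 2) => hb.
  move: crit; rewrite -/b; set a := (X in X + b).
  by rewrite -/a; move: a b hb => a b hb h; lra.
rewrite expRN -[leLHS]mul1r ler_pdivrMr ?expR_gt0//.
by rewrite mulrC.
Qed.

End LowerBound.

(** * Choice of the parameters *)

Lemma ln3_ge1 (R : realType) : 1 <= ln 3 :> R.
Proof.
rewrite -[leLHS]expRK ler_ln ?posrE ?expR_gt0//.
have x0 : 0 <= 1 + - (1 / 10) :> R by lra.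
have h3 : 3^-1 <= (1 + - (1 / 10)) ^+ 10 :> R by clear; lra.
have e : expR (- (1 / 10) * 10%:R) = (expR 1)^-1 :> R by rewrite -expRN; congr expR; clear; lra.
have := le_trans h3 (pow_le_expR 10 x0); rewrite e.
by rewrite lef_pV2 ?posrE ?expR_gt0.
Qed.

Lemma ln2_ge (R : realType) : 1 / 2 <= ln 2 :> R.
Proof.
have e : ln 4 = 2 * ln 2 :> R.
  have -> : 4 = 2 ^+ 2 :> R by lra.
  by rewrite lnXn// mulr_natl.
have : ln 3 <= ln 4 :> R by rewrite ler_ln ?posrE//; lra.
by have := ln3_ge1 R; lra.
Qed.

Lemma ln_le_pow2 (R : realType) (x : R) n : 0 < x -> x <= 2 ^+ n -> ln x <= 7 / 10 * n%:R.
Proof.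
move=> x0 x2; have : ln x <= ln (2 ^+ n) by rewrite ler_ln ?posrE ?exprn_gt0.
rewrite lnXn// -[ln 2 *+ n]mulr_natr => /le_trans; apply.
by rewrite ler_wpM2r// ln2_le.
Qed.

(** 0.1017 is the ratio allowed by [parameters_radius]. Of the exponent 9/4, one unit pays for the
    factor exp(M - K) in the tail bound and 5/4 remains. *)
Lemma exp_base_le (R : realType) : 1017 / 10000 <= expR (- (9 / 4)) :> R.
Proof.
have x0 : 0 <= 1 + - (9 / 400) :> R by lra.
have h10 : 7963 / 10000 <= (1 + - (9 / 400)) ^+ 10 :> R by lra.
have h : 1017 / 10000 <= (7963 / 10000) ^+ 10 :> R by clear; lra.
have h0 : 0 <= 7963 / 10000 :> R by clear; lra.
have h100 := le_trans h (exprn_mono 10 h0 h10); rewrite -exprM in h100.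
have e : - (9 / 4) = - (9 / 400) * 100%:R :> R by clear; lra.
rewrite e; exact: le_trans h100 (pow_le_expR 100 x0).
Qed.

(** For n <= 2 S0 + 1 the order T alone suffices. For larger n the left side is at most (2 S0 + 1)
    40 (2 L0), while at least 40 (2 L0 + 1) of T is left after losing n - 1 orders at each point. *)
Lemma dims_ltn S0 L0 n : (0 < n <= 40 * (2 * S0).+1)%N ->
  (n * (2 * L0) < minn (2 * S0).+1 n * (40 * (2 * L0).+1 + 40 * (2 * S0).+1 - n.-1))%N.
Proof.
move=> /andP[n0 nK]; have [nS|Sn] := leqP n (2 * S0).+1.
  by rewrite ltn_pmul2l//; lia.
rewrite (@leq_ltn_trans (40 * (2 * S0).+1 * (2 * L0)))// ?leq_mul2r ?nK ?orbT//.
rewrite (@leq_trans ((2 * S0).+1 * (40 * (2 * L0).+1)))//.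
  by rewrite [(40 * _)%N]mulnC -mulnA ltn_pmul2l// ltn_pmul2l.
by rewrite leq_mul2l; lia.
Qed.

Lemma order_le_taylor S0 L0 : (64 <= S0)%N -> (100 <= L0)%N ->
  (40 * (2 * L0).+1 + 40 * (2 * S0).+1 <= 40 * (2 * S0).+1 * L0)%N.
Proof. by move=> s l; nia. Qed.

Section ParameterChoice.
Variable R : realType.
Variables (d : nat) (lam : R).
Hypotheses (d0 : (0 < d)%N) (lam1 : 1 <= lam).
Let ell : R := ln d%:R.
Let y : R := 1 + ell / 3.
Let Y : R := d%:R * y.

(** The order K L0 must dominate all losses: K >= 5120 Y makes Y L0 small against K L0, and in L0
    the parts 100 Y and 4 lam dominate the losses K Y and K lam, the latter coming from the length
    of P. *)
Definition S0_of : nat := (Num.truncn (64 * Y)).+1.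
Definition L0_of : nat := (Num.truncn (100 * Y + 4 * lam)).+1.
Let S0 := S0_of.
Let L0 := L0_of.
Let K := (40 * (2 * S0).+1)%N.
Let T := (40 * (2 * L0).+1 + K)%N.

Let d1 : 1 <= d%:R :> R. Proof. by rewrite ler1n. Qed.
Let ell0 : 0 <= ell. Proof. exact: ln_ge0. Qed.
Let y1 : 1 <= y. Proof. by rewrite /y lerDl divr_ge0. Qed.
Let Yy : y <= Y. Proof. by rewrite /Y ler_peMl// (le_trans ler01). Qed.
Let Yd : d%:R <= Y. Proof. by rewrite /Y ler_peMr. Qed.
Let Y1 : 1 <= Y. Proof. exact: le_trans d1 Yd. Qed.

Lemma S0_of_itv : 64 * Y < S0%:R <= 64 * Y + 1.
Proof.
have Y0 : 0 <= 64 * Y by rewrite mulr_ge0// (le_trans ler01).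
have /andP[h1 h2] := truncn_itv Y0.
by rewrite /S0 /S0_of h2 -natr1 lerD2r.
Qed.

Lemma L0_of_itv : 100 * Y + 4 * lam < L0%:R <= 100 * Y + 4 * lam + 1.
Proof.
have Y0 : 0 <= 100 * Y + 4 * lam by rewrite addr_ge0// mulr_ge0// (le_trans ler01).
have /andP[h1 h2] := truncn_itv Y0.
by rewrite /L0 /L0_of h2 -natr1 lerD2r.
Qed.

Lemma S0_of_ge : (64 <= S0)%N.
Proof.
rewrite -(ler_nat R); have /andP[h _] := S0_of_itv.
by move: Y1 h; move: Y S0%:R => u v; lra.
Qed.

Lemma L0_of_ge : (100 <= L0)%N.
Proof.
rewrite -(ler_nat R); have /andP[h _] := L0_of_itv.
by move: Y1 lam1 h; move: Y L0%:R lam => u v w; lra.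
Qed.

Lemma parameters_dims n : (0 < n <= K)%N ->
  (n * (2 * L0) < minn (2 * S0).+1 n * (T - n.-1))%N.
Proof. exact: dims_ltn. Qed.

Lemma parameters_TM : (T <= K * L0)%N.
Proof. exact: order_le_taylor S0_of_ge L0_of_ge. Qed.

Let M' := (K * L0 - K)%N.

Lemma M'E : M'%:R = K%:R * (L0%:R - 1) :> R.
Proof.
rewrite /M' natrB; first by rewrite natrM mulrBr mulr1.
by rewrite leq_pmulr// (leq_trans _ L0_of_ge).
Qed.

Let s64 : 64 <= S0%:R :> R. Proof. by rewrite ler_nat S0_of_ge. Qed.
Let l100 : 100 <= L0%:R :> R. Proof. by rewrite ler_nat L0_of_ge. Qed.
Let KE : K%:R = 40 * (2 * S0%:R + 1) :> R.
Proof. by rewrite /K natrM -[(2 * S0).+1%:R]natr1 natrM. Qed.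

(** K = 40 (2 S0 + 1) makes K L0 at least ten times the left side; the excess of 0.1017 over 1/10
    covers the ratio L0 / (L0 - 1). *)
Lemma parameters_radius : L0%:R * (8 * S0).+1%:R <= 1017 / 10000 * M'%:R :> R.
Proof.
rewrite M'E KE -[(8 * S0).+1%:R]natr1 natrM; move: s64 l100; move: S0%:R L0%:R => u v hu hv.
have h1 : v * (8 * u + 1) <= 4 * (2 * u + 1) * v by nra.
apply: (le_trans h1).
have h2 : 40 * v <= 4068 / 100 * (v - 1) by lra.
have h3 : 0 <= 2 * u + 1 by lra.
have := ler_wpM2l h3 h2; lra.
Qed.

Lemma parameters_tail :
  (L0%:R * (8 * S0).+1%:R / M'%:R) ^+ M' * expR M'%:R <= expR (- (5 / 4 * M'%:R)) :> R.
Proof.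
have M0 : 0 < M'%:R :> R.
  rewrite M'E KE; move: s64 l100; move: S0%:R L0%:R => u v hu hv.
  by rewrite mulr_gt0//; lra.
have rad := parameters_radius.
have -> : - (5 / 4 * M'%:R) = - (9 / 4) * M'%:R + M'%:R :> R.
  by move: M'%:R => u; lra.
rewrite expRD ler_wpM2r ?expR_ge0// expRM_natr; apply: exprn_mono.
  by rewrite divr_ge0.
by apply: le_trans (exp_base_le R); rewrite ler_pdivrMr.
Qed.

(** ln Y = ell + ln(1 + ell/3) <= 4 ell / 3, and each factor 2 costs at most 7/10. *)
Let lnY_le (a : R) n : a <= 2 ^+ n * Y -> 0 < a ->
  ln a <= 7 / 10 * n%:R + 4 / 3 * ell.
Proof.
move=> aA a0; have Y0 : 0 < Y by exact: lt_le_trans ltr01 Y1.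
have A0 : 0 < 2 ^+ n :> R by rewrite exprn_gt0.
have y0 : 0 < y by exact: lt_le_trans ltr01 y1.
have AY0 : 0 < 2 ^+ n * Y by exact: mulr_gt0.
have : ln a <= ln (2 ^+ n * Y) by rewrite ler_ln ?posrE.
have dp : 0 < d%:R :> R by rewrite ltr0n.
rewrite (lnM A0 Y0) (lnM dp y0) -/ell => h.
have h1 := ln_le_pow2 A0 (lexx _).
have h2 : ln y <= ell / 3.
  by rewrite /y le_ln1Dx// (lt_le_trans _ (divr_ge0 ell0 (ler0n _ _)))// ltrN10.
by move: h h1 h2; move: (ln a) (ln (2 ^+ n)) (ln y) ell (7 / 10 * _) => u v t w z; lra.
Qed.

Let S0_le : S0%:R <= 64 * Y + 1. Proof. by have /andP[] := S0_of_itv. Qed.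

Lemma lnK_le : ln K%:R <= 91 / 10 + 4 / 3 * ell.
Proof.
have -> : 91 / 10 = 7 / 10 * 13%:R :> R by lra.
apply: lnY_le; rewrite KE.
  by move: Y1 S0_le; move: Y S0%:R => u v; lra.
by move: s64; move: S0%:R => u; lra.
Qed.

Lemma lnR1_le : ln (8 * S0).+1%:R <= 7 + 4 / 3 * ell.
Proof.
have -> : 7 = 7 / 10 * 10%:R :> R by lra.
apply: lnY_le; last by rewrite ltr0n.
by rewrite -[(8 * S0).+1%:R]natr1 natrM; move: Y1 S0_le; move: Y S0%:R => u v; lra.
Qed.

Lemma lnS_le : ln (2 * S0).+1%:R <= 56 / 10 + 4 / 3 * ell.
Proof.
have -> : 56 / 10 = 7 / 10 * 8%:R :> R by lra.
apply: lnY_le; last by rewrite ltr0n.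
by rewrite -[(2 * S0).+1%:R]natr1 natrM; move: Y1 S0_le; move: Y S0%:R => u v; lra.
Qed.

End ParameterChoice.

(* The left-hand side is twice the bound of [ln_sum_le] on g, the logarithm    *)
(* of the coefficient bound, with k = K, l0 = L0 and t = T = 40 L + K; on the  *)
(* right, k (l0 - 1) = M - K is the order of smallness of f.                   *)
Lemma exponent_le (R : realType) (k l0 d y Y lam : R) :
  1 <= d -> 1 <= y -> y <= Y -> d <= Y -> Y = d * y -> 1 <= lam ->
  5120 * Y <= k -> 100 * Y + 4 * lam <= l0 ->
  2 * (42 / 10 + 91 / 10 * y + l0 + k * l0 / 10 + 3 * y + 28 / 10 * d
    + (k + d) * lam + 7 * k * y
    + d * (91 / 10 * y + (2 * l0 + 1) + 3 * y + 7 / 10)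
    + 1484 / 100 * ((40 * (2 * l0 + 1) + k) * Y) + 7 / 10 * (d * l0) + 56 / 10 * (k * Y))
  <= 5 / 4 * (k * (l0 - 1)).
Proof.
move=> d1 y1 yY dY YE lam1 kY l0E.
have Y1 : 1 <= Y by exact: le_trans y1 yY.
have k0 : 5120 <= k by lra.
have l00 : 100 <= l0 by clear -Y1 l0E lam1; lra.
have [kp lp] : 0 <= k /\ 0 <= l0 by split; clear -k0 l00; lra.
have [Yp lamp] : 0 <= Y /\ 0 <= lam by split; clear -Y1 lam1; lra.
have p1 : d * lam <= k * lam / 5120.
  have : d * lam <= Y * lam by apply: ler_wpM2r => //.
  have : 5120 * Y * lam <= k * lam by apply: ler_wpM2r => //.
  rewrite -[5120 * Y * lam]mulrA; clear; move: (d * lam) (Y * lam) (k * lam) => a b c; lra.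
have p2 : k * y <= k * Y by apply: ler_wpM2l => //.
have p3 : 5120 * (Y * l0) <= k * l0.
  by rewrite mulrA; apply: ler_wpM2r => //.
have p4 : d * l0 <= Y * l0 by apply: ler_wpM2r => //.
have p5 : 5120 * l0 <= k * l0 by apply: ler_wpM2r => //.
have p6 : 5120 * Y <= k * Y by apply: ler_wpM2r => //.
have p7 : 100 * (k * Y) + 4 * (k * lam) <= k * l0.
  have : k * (100 * Y + 4 * lam) <= k * l0 by apply: ler_wpM2l => //.
  by rewrite mulrDr !(mulrCA k).
have p8 : k <= k * Y by rewrite ler_peMr//.
have p9 : 5120 * lam <= k * lam by apply: ler_wpM2r => //.
have -> : d * (91 / 10 * y + (2 * l0 + 1) + 3 * y + 7 / 10) =
   91 / 10 * Y + 2 * (d * l0) + d + 3 * Y + 7 / 10 * d by rewrite YE; ring.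
have -> : (40 * (2 * l0 + 1) + k) * Y = 80 * (Y * l0) + 40 * Y + k * Y by ring.
have -> : (k + d) * lam = k * lam + d * lam by ring.
have -> : 7 * k * y = 7 * (k * y) by ring.
have -> : k * (l0 - 1) = k * l0 - k by ring.
(* With the products renamed as atoms, the claim is linear in them and follows from the comparisons
   above, which lead back to k l0. *)
move: p1 p2 p3 p4 p5 p6 p7 p8 p9; clear YE d1 kp lp Yp lamp.
move: (d * lam) (k * lam) (k * y) (k * Y) (Y * l0) (d * l0) (k * l0) => a b c e f g h.
by lra.
Qed.

Lemma exponent_measure_le (R : realType) (d : nat) (lam k l0 : R) :
  let ell := ln d%:R in let Y := d%:R * (1 + ell / 3) in
  (0 < d)%N -> 1 <= lam -> 0 <= k -> k <= 5240 * Y -> l0 <= 100 * Y + 4 * lam + 1 ->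
  5 / 4 * (k * (l0 - 1)) <= 10 ^+ 6 * d%:R * (lam + d%:R * ell) * (1 + ell).
Proof.
move=> ell Y d0 lam1 k0 kY l0Y.
have d1 : 1 <= d%:R :> R by rewrite ler1n.
have ell0 : 0 <= ell by rewrite ln_ge0.
have Y0 : 0 <= Y by rewrite mulr_ge0// addr_ge0// divr_ge0.
(* Since 6550 = 5/4 times 5240, the inequality [step] needs 0.655 d to be at most lam + d ell less
   0.0262 lam + 0.2184 d ell. For d >= 3 it follows from ell >= 1; d = 1 and d = 2 also use lam >=
   1. *)
have main : 655 / 1000 * d%:R <= 97 / 100 * lam + 78 / 100 * (d%:R * ell).
  have [d3|] := leqP 3 d.
    have ell1 : 1 <= ell.
      by rewrite (le_trans (ln3_ge1 R))// ler_ln ?posrE ?ltr0n// ler_nat.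
    have : d%:R <= d%:R * ell by rewrite ler_peMr.
    by move: (d%:R * ell) => u; lra.
  rewrite /ell; case: (d) d0 => [|[|[|]]]// _ _.
    by rewrite ln1 mulr0; lra.
  by have := ln2_ge R; move: (ln 2) => u; lra.
have step : 6550 * (100 * Y + 4 * lam) <= 10 ^+ 6 * (lam + d%:R * ell).
  rewrite /Y; have -> : d%:R * (1 + ell / 3) = d%:R + d%:R * ell / 3 by ring.
  have de0 : 0 <= d%:R * ell by rewrite mulr_ge0.
  by move: main de0; move: (d%:R * ell) d%:R => u v; lra.
have s1 : 5 / 4 * (k * (l0 - 1)) <= 5 / 4 * (5240 * Y * (100 * Y + 4 * lam)).
  rewrite ler_wpM2l//.
  apply: (@le_trans _ _ (k * (100 * Y + 4 * lam))).
    by apply: ler_wpM2l => //; clear -l0Y; lra.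
  by apply: ler_wpM2r => //; clear -Y0 lam1; lra.
apply: (le_trans s1).
have -> : 5 / 4 * (5240 * Y * (100 * Y + 4 * lam)) = Y * (6550 * (100 * Y + 4 * lam)) by field.
apply: (le_trans (ler_wpM2l Y0 step)).
have YM : Y <= d%:R * (1 + ell).
  by apply: ler_wpM2l => //; clear -ell0; lra.
have P0 : 0 <= 10 ^+ 6 * (lam + d%:R * ell).
  by rewrite mulr_ge0 ?exprn_ge0// addr_ge0 ?mulr_ge0//; clear -lam1; lra.
have -> : 10 ^+ 6 * d%:R * (lam + d%:R * ell) * (1 + ell) =
  d%:R * (1 + ell) * (10 ^+ 6 * (lam + d%:R * ell)) by ring.
exact: ler_wpM2r.
Qed.

Lemma ln_prod_nat (R : realType) (K L d D a b c e : nat) :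
  (0 < K)%N -> (0 < L)%N -> (0 < d)%N -> (0 < D)%N -> (0 < b)%N ->
  ln (K * L * d * 2 * D * 2 ^ a * b ^ c)%:R =
  ln K%:R + ln L%:R + ln d%:R + ln 2 + ln D%:R + a%:R * ln 2 + c%:R * ln b%:R :> R.
Proof.
move=> K0 L0 d0 D0 b0.
rewrite !natrM !natrX.
by rewrite !lnM ?lnXn ?posrE ?mulr_gt0 ?exprn_gt0 ?ltr0n// -!(mulr_natl (ln _)).
Qed.

Lemma ln_prod_real (R : realType) (M E d16 a b c : R) (d K n : nat) :
  0 < M -> (0 < d)%N -> 0 < a -> 0 < b -> 0 < c ->
  ln (64 * M * expR E * (d%:R * 16 ^+ d * a ^+ n * b ^+ K * c ^+ d)) =
  ln 64 + ln M + E + (ln d%:R + d%:R * ln 16 + n%:R * ln a + K%:R * ln b + d%:R * ln c).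
Proof.
move=> M0 d0 a0 b0 c0.
have ? : 0 < d%:R :> R by rewrite ltr0n.
have ? : 0 < 16 ^+ d :> R by rewrite exprn_gt0.
have ? : 0 < a ^+ n by rewrite exprn_gt0.
have ? : 0 < b ^+ K by rewrite exprn_gt0.
have ? : 0 < c ^+ d by rewrite exprn_gt0.
have ? : 0 < expR E by rewrite expR_gt0.
by rewrite !lnM ?lnXn ?posrE ?mulr_gt0// expRK -!(mulr_natl (ln _)).
Qed.

(** Logarithms enter as plain variables, bounded one by one, so that only polynomial inequalities
    remain. The coefficient 14.84 of t Y is 1.4 times 10.1 from the common denominator plus 0.7 from
    the powers of 2. *)
Lemma ln_sum_le (R : realType) (k l0 d y Y lam ell t : R)
  (l64 lM E l16 lR1 lK lL l2 lD lS : R) :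
  0 <= d -> 0 <= k -> 0 <= l0 -> 0 <= t -> 0 <= Y -> d <= Y -> Y = d * y -> y = 1 + ell / 3 -> 0 <= ell ->
  l64 <= 42 / 10 -> lM <= lK + l0 -> E <= k * l0 / 10 -> l16 <= 28 / 10 ->
  lR1 <= 7 + 4 / 3 * ell -> lK <= 91 / 10 + 4 / 3 * ell -> lL <= 2 * l0 + 1 ->
  l2 <= 7 / 10 -> lD <= t * (2 * l2) * (1 + lK) -> lS <= 56 / 10 + 4 / 3 * ell ->
  0 <= l2 -> 0 <= lK ->
  l64 + lM + E + (ell + d * l16 + (k + d) * lam + k * lR1 +
    d * (lK + lL + ell + l2 + lD + (t + l0) * l2 + k * lS)) <=
  42 / 10 + 91 / 10 * y + l0 + k * l0 / 10 + 3 * y + 28 / 10 * d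
    + (k + d) * lam + 7 * k * y
    + d * (91 / 10 * y + (2 * l0 + 1) + 3 * y + 7 / 10)
    + 1484 / 100 * (t * Y) + 7 / 10 * (d * l0) + 56 / 10 * (k * Y).
Proof.
move=> d0 k0 l00 t0 Y0 dY YE yE ell0 h64 hM hE h16 hR1 hK hL h2 hD hS l20 lK0.
have hy1 : 91 / 10 + 4 / 3 * ell <= 91 / 10 * y by rewrite yE; lra.
have hy2 : 7 + 4 / 3 * ell <= 7 * y by rewrite yE; lra.
have hy3 : 56 / 10 + 4 / 3 * ell <= 56 / 10 * y by rewrite yE; lra.
have hy4 : ell <= 3 * y by rewrite yE; lra.
have hy5 : 1 <= y by rewrite yE; lra.
have hK' := le_trans hK hy1; have hR1' := le_trans hR1 hy2; have hS' := le_trans hS hy3.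
have q1 : d * l16 <= d * (28 / 10) by exact: ler_wpM2l.
have q2 : k * lR1 <= k * (7 * y) by exact: ler_wpM2l.
have q3 : k * lS <= k * (56 / 10 * y) by exact: ler_wpM2l.
have q4 : (t + l0) * l2 <= (t + l0) * (7 / 10) by rewrite ler_wpM2l// addr_ge0.
have q5 : t * (2 * l2) * (1 + lK) <= t * (14 / 10) * (101 / 10 * y).
  apply: ler_pM.
  - by rewrite mulr_ge0// mulr_ge0.
  - by rewrite addr_ge0.
  - by rewrite ler_wpM2l//; clear -h2; lra.
  - by clear -hK' hy5; lra.
have q6 : t * d <= t * Y by exact: ler_wpM2l.
have in1 : lK + lL + ell + l2 + lD + (t + l0) * l2 + k * lS <=
   91 / 10 * y + (2 * l0 + 1) + 3 * y + 7 / 10 + t * (14 / 10) * (101 / 10 * y)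
     + (t + l0) * (7 / 10) + k * (56 / 10 * y).
  by rewrite !lerD// (le_trans hD).
have in2 := ler_wpM2l d0 in1.
have e1 : d * (91 / 10 * y + (2 * l0 + 1) + 3 * y + 7 / 10 + t * (14 / 10) * (101 / 10 * y)
     + (t + l0) * (7 / 10) + k * (56 / 10 * y)) =
   d * (91 / 10 * y + (2 * l0 + 1) + 3 * y + 7 / 10) + 1414 / 100 * (t * Y) + 7 / 10 * (t * d) +
     7 / 10 * (d * l0) + 56 / 10 * (k * Y).
  by rewrite YE; field.
rewrite e1 in in2; clear -in2 q1 q2 q6 h64 hM hE hK' hy4.
have -> : 7 * k * y = k * (7 * y) by rewrite mulrCA mulrA.
move: in2 q1 q2 q6 hE; move: (d * (_ + k * lS)) (d * (_ + 7 / 10)) (d * l16) ((k + d) * lam)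
  (k * lR1) (k * (7 * y)) (t * Y) (t * d) (d * l0) (k * Y) (k * l0) => a1 a2 a3 a4 a5 a6 a7 a8 a9 b1 b2 *.
by lra.
Qed.

Lemma weight_gt0 (K L d T a b c : nat) : (0 < K)%N -> (0 < d)%N ->
  (0 < K * L.+1 * d * 2 * denom T K * 2 ^ a * b.+1 ^ c)%N.
Proof. by move=> K0 d0; rewrite !muln_gt0 K0 d0 denom_gt0 !expn_gt0. Qed.

Lemma measure_prod_ge1 (R : realType) (M d b c n k : nat) (E a : R) :
  (0 < M)%N -> (0 < d)%N -> (0 < b)%N -> (0 < c)%N -> 0 <= E -> 1 <= a ->
  1 <= 64 * M%:R * expR E * (d%:R * 16 ^+ d * a ^+ n * b%:R ^+ k * c%:R ^+ d).
Proof.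
move=> M0 d0 b0 c0 E0 a1; have e1 : 1 <= expR E by rewrite -expR0 ler_expR.
by rewrite !mulr_ege1 ?exprn_ege1 ?ler1n.
Qed.

Lemma ln64_le (R : realType) : ln 64 <= 42 / 10 :> R.
Proof.
have e : 64 <= 2 ^+ 6 :> R by lra.
by apply: le_trans (ln_le_pow2 _ e) _; lra.
Qed.

Lemma ln16_le (R : realType) : ln 16 <= 28 / 10 :> R.
Proof.
have e : 16 <= 2 ^+ 4 :> R by lra.
by apply: le_trans (ln_le_pow2 _ e) _; lra.
Qed.

Lemma radius_le (R : realType) (u v : R) : 0 <= v ->
  v * (8 * u + 1) <= 40 * (2 * u + 1) * v / 10.
Proof.
move=> v0; have -> : 40 * (2 * u + 1) * v / 10 = v * (8 * u + 1) + 3 * v by field.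
by rewrite lerDl mulr_ge0.
Qed.

Lemma frac_le (R : realType) (a : R) (m : nat) : a <= 1017 / 10000 * m%:R -> a <= m%:R.
Proof. by have := ler0n R m; lra. Qed.

Lemma range_le (R : realType) (u Y : R) : 1 <= Y -> 64 * Y < u <= 64 * Y + 1 ->
  5120 * Y <= 40 * (2 * u + 1) <= 5240 * Y.
Proof. by move=> Y1 /andP[u1 u2]; apply/andP; split; lra. Qed.

(** * The measure for an irreducible polynomial *)

Section IrreducibleMeasure.
Variable R : realType.
Variables (d : nat) (P : {poly int}) (Lam : R).
Hypotheses (irrP : irreducible_poly P) (sP : size P = d.+1).
Hypotheses (Lam1 : 1 <= ln Lam) (Lam_gt0 : 0 < Lam) (PLam : (poly_length P)%:~R <= Lam).
Let lam := ln Lam.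
Let ell : R := ln d%:R.
Let y : R := 1 + ell / 3.
Let Y : R := d%:R * y.
Let S0 := S0_of R d.
Let L0 := L0_of d lam.
Let K := (40 * (2 * S0).+1)%N.
Let T := (40 * (2 * L0).+1 + K)%N.
Let M := (K * L0)%N.
Let M' := (M - K)%N.
Let W0 := (K * (2 * L0).+1 * d * 2 * denom T K * 2 ^ (T + L0) * (2 * S0).+1 ^ K)%N.
Let R1 : R := (8 * S0).+1%:R.
Let A : R := 64 * M%:R * expR (L0%:R * R1) *
  (d%:R * 16 ^+ d * Lam ^+ (K + d) * R1 ^+ K * W0%:R ^+ d).
Let g := ln A.

Let d0 : (0 < d)%N. Proof. by case: irrP => + _; rewrite sP. Qed.
Let d1 : 1 <= d%:R :> R. Proof. by rewrite ler1n. Qed.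
Let ell0 : 0 <= ell. Proof. exact: ln_ge0. Qed.
Let y1 : 1 <= y. Proof. by rewrite /y lerDl divr_ge0. Qed.
Let Yy : y <= Y. Proof. by rewrite /Y ler_peMl// (le_trans ler01). Qed.
Let Yd : d%:R <= Y. Proof. by rewrite /Y ler_peMr. Qed.
Let Y0 : 0 <= Y. Proof. by apply: le_trans Yy; exact: le_trans y1. Qed.
Let S00 : (0 < S0)%N. Proof. exact: leq_trans (S0_of_ge R d0). Qed.
Let L00 : (0 < L0)%N. Proof. exact: leq_trans (L0_of_ge d0 Lam1). Qed.
Let K0 : (0 < K)%N. Proof. by []. Qed.
Let KE : K%:R = 40 * (2 * S0%:R + 1) :> R.
Proof. by rewrite /K natrM -[(2 * S0).+1%:R]natr1 natrM. Qed.
Let K_itv : 5120 * Y <= K%:R <= 5240 * Y.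
Proof. by rewrite KE range_le ?(le_trans d1)// S0_of_itv. Qed.
Let TE : T%:R = 40 * (2 * L0%:R + 1) + K%:R :> R.
Proof. by rewrite /T natrD natrM -[(2 * L0).+1%:R]natr1 natrM. Qed.
Let W00 : (0 < W0)%N.
Proof. exact: weight_gt0. Qed.
Let Lam_ge1 : 1 <= Lam.
Proof. by rewrite -[leRHS]lnK ?posrE// -expR0 ler_expR (le_trans ler01). Qed.
Let M0 : (0 < M)%N. Proof. by rewrite muln_gt0 K0. Qed.
Let A_ge1 : 1 <= A. Proof. by apply: measure_prod_ge1 => //; exact: mulr_ge0. Qed.
Let A_gt0 : 0 < A. Proof. exact: lt_le_trans ltr01 A_ge1. Qed.

Let ln_pow2E (n : nat) : ln (2 ^+ n) = n%:R * ln 2 :> R.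
Proof. by rewrite lnXn// mulr_natl. Qed.

(** The Taylor tail must fall below e^(-2g); this is the condition that the parameters are chosen to
    meet. *)
Let g_le : 2 * g <= 5 / 4 * M'%:R.
Proof.
rewrite (M'E d lam).
have /andP[s1 _] := K_itv; have /andP[l1 _] := L0_of_itv d0 Lam1.
apply: le_trans (@exponent_le R K%:R L0%:R d%:R y Y lam d1 y1 Yy Yd erefl Lam1 s1 (ltW l1)) => //.
rewrite ler_wpM2l// -TE /g /A ln_prod_real ?ltr0n ?M0 ?W00//.
rewrite natrM (lnM (x := K%:R)) ?posrE ?ltr0n// ln_prod_nat ?denom_gt0//.
rewrite [(K + d)%:R]natrD [(T + L0)%:R]natrD -/ell -/lam.
have l2 := ln2_le R.
have lnle (n : nat) : ln n.+1%:R <= n.+1%:R :> R by rewrite ltW// ln_sublinear// ltr0n.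
apply: ln_sum_le => //.
- exact: ln64_le.
- have h : ln L0%:R <= L0%:R :> R by rewrite -(prednK L00).
  by rewrite lerD2l.
- by rewrite /R1 KE -[(8 * S0).+1%:R]natr1 natrM; exact: radius_le.
- exact: ln16_le.
- exact: lnR1_le.
- exact: lnK_le.
- by rewrite (le_trans (lnle _))// -natr1 natrM.
- have -> : 2 * ln 2 = ln 4 :> R by rewrite -ln_pow2E -natrX.
  exact: ln_denom_le.
- exact: lnS_le.
- by rewrite ln_ge0// ler1n.
- by rewrite ln_ge0// ler1n.
Qed.

(** The largest integer with H^d <= e^g. *)
Let H := Num.truncn (expR (g / d%:R)).

Let g_ge0 : 0 <= g. Proof. exact: ln_ge0. Qed.

Let rad : L0%:R * R1 <= M'%:R.
Proof. exact: frac_le (parameters_radius d0 Lam1). Qed.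

Lemma irreducible_measure_neq0 : ~~ root P 0 ->
  expR (- (10 ^+ 6 * d%:R * (lam + d%:R * ell) * (1 + ell))) <= `|(map_poly intr P).[pi]|.
Proof.
move=> P0.
have eH : expR (g / d%:R) ^+ d = expR g.
  by rewrite -expRM_natr divfK// gt_eqF// ltr0n.
have /andP[H1 H2] := truncn_itv (expR_ge0 (g / d%:R)).
have gA : expR g = A by rewrite lnK.
apply: (@le_trans _ _ (expR (- (2 * g)))); last first.
  have H0 : (0 < H)%N by rewrite truncn_gt0 -expR0 ler_expR divr_ge0.
  have KT : (K <= T.+1)%N by rewrite ltnW// ltnS leq_addl.
  apply: (horner_pi_ge d0 K0 H0 S00 L00 (parameters_TM d0 Lam1) rad irrP sP P0 KT
    (@parameters_dims R d lam) Lam_ge1 PLam gA).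
  - by rewrite -eH lerXn2r ?nnegrE ?expR_ge0.
  - by rewrite -eH lerXn2r ?nnegrE ?expR_ge0// ltW.
  - apply: le_trans (parameters_tail d0 Lam1) _.
    by rewrite ler_expR lerN2.
rewrite ler_expR lerN2 (le_trans g_le)// (M'E d lam).
have /andP[_ s2] := K_itv; have /andP[_ l2] := L0_of_itv d0 Lam1.
apply: exponent_measure_le => //.
Qed.

End IrreducibleMeasure.

(** Such a P is c X with c a nonzero integer, and pi > 1. *)
Lemma horner_pi_ge1_of_root0 (R : realType) (P : {poly int}) :
  irreducible_poly P -> root P 0 -> 1 <= `|(map_poly intr P).[pi]| :> R.
Proof.
move=> irrP /factor_theorem[q PE]; rewrite subr0 in PE.
have XP : 'X %| P by rewrite PE dvdp_mull.
have P0 : P != 0 by rewrite -size_poly_gt0 ltnW// irrP.1.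
have q0 : q != 0 by apply: contraNneq P0 => q0; rewrite PE q0 mul0r.
have sP := eqp_size (irrP.2 'X _ XP); rewrite size_polyX in sP.
have sq : size q = 1%N by move: (sP isT); rewrite PE size_mulX// => -[].
have qE := size1_polyC (eq_leq sq); set c := q`_0 in qE.
have c0 : c != 0 by apply: contraNneq q0 => c0; rewrite qE c0.
rewrite PE qE rmorphM /= map_polyC map_polyX hornerM hornerC hornerX normrM /=.
rewrite mulr_ege1//.
  by rewrite -intr_norm ler1z -gtz0_ge1 normr_gt0.
by rewrite ger0_norm ?pi_ge0// (le_trans _ (@pi_ge2 R))// ler1n.
Qed.

Lemma irreducible_measure (R : realType) (d : nat) (P : {poly int}) (Lam : R) :
  irreducible_poly P -> size P = d.+1 -> 1 <= ln Lam -> 0 < Lam ->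
  (poly_length P)%:~R <= Lam ->
  expR (- (10 ^+ 6 * d%:R * (ln Lam + d%:R * ln d%:R) * (1 + ln d%:R)))
    <= `|(map_poly intr P).[pi]|.
Proof.
move=> irrP sP Lam1 Lam0 PLam.
have [P0|P0] := boolP (root P 0); last exact: irreducible_measure_neq0.
apply: le_trans (horner_pi_ge1_of_root0 R irrP P0).
have d0 : (0 < d)%N by case: irrP => + _; rewrite sP.
have ell0 : 0 <= ln d%:R :> R by rewrite ln_ge0 ?ler1n.
have lam0 : 0 <= ln Lam := le_trans ler01 Lam1.
rewrite -[leRHS]expR0 ler_expR oppr_le0 !mulr_ge0 ?exprn_ge0 ?addr_ge0//.
by rewrite mulr_ge0.
Qed.

(** * From polynomial values at pi to distances from algebraic numbers *)

Lemma distrX_le (R : realDomainType) (x y B : R) n :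
  1 <= B -> `|x| <= B -> `|y| <= B -> `|x ^+ n - y ^+ n| <= `|x - y| * (n%:R * B ^+ n).
Proof.
move=> B1 xB yB; rewrite subrXX normrM ler_wpM2l//.
apply: (le_trans (ler_norm_sum _ _ _)).
have -> : n%:R * B ^+ n = \sum_(i < n) B ^+ n by rewrite sumr_const card_ord mulr_natl.
apply: ler_sum => i _; rewrite normrM !normrX.
have B0 : 0 <= B by exact: le_trans ler01 B1.
apply: (@le_trans _ _ (B ^+ (n.-1 - i) * B ^+ i)).
  by rewrite ler_pM ?exprn_ge0 ?lerXn2r ?nnegrE.
by rewrite -exprD ler_weXn2l//; have := ltn_ord i; lia.
Qed.

Lemma horner_dist_le (R : realType) (P : {poly int}) (x y B : R) (d : nat) :
  (size P <= d.+1)%N -> 1 <= B -> `|x| <= B -> `|y| <= B ->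
  `|(map_poly intr P).[x] - (map_poly intr P).[y]| <=
    `|x - y| * ((poly_length P)%:~R * (d%:R * B ^+ d)).
Proof.
move=> sP B1 xB yB.
have sP' := size_map_inj_poly (@intr_inj R) (rmorph0 _) P.
rewrite !horner_coef sP' -sumrB; apply: (le_trans (ler_norm_sum _ _ _)).
rewrite /poly_length rmorph_sum /= mulr_suml mulr_sumr; apply: ler_sum => i _.
rewrite coef_map /= -mulrBr normrM mulrCA -intr_norm ler_wpM2l//.
apply: (le_trans (distrX_le i B1 xB yB)); rewrite ler_wpM2l//.
have id : (i <= d)%N by rewrite -ltnS (leq_trans (ltn_ord i)).
apply: ler_pM => //; first exact: exprn_ge0 (le_trans ler01 B1).
  by rewrite ler_nat.
exact: ler_weXn2l.
Qed.

Lemma ln5_le (R : realType) : ln 5 <= 21 / 10 :> R.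
Proof.
have e : 5 <= 2 ^+ 3 :> R by lra.
by apply: le_trans (ln_le_pow2 _ e) _; lra.
Qed.

Lemma pi_norm_le4 (R : realType) : `|pi| <= 4 :> R.
Proof. by rewrite ger0_norm ?pi_ge0//; have := pihalf_lt2 R; lra. Qed.

(** The factor Lam d 5^d lost in [algebraic_measure] is paid by the difference 0.2 between the
    constants 1.2 and 1; [l5] stands for ln 5. *)
Lemma exponent_slack (R : realType) (lam ell d l5 : R) :
  1 <= lam -> 0 <= ell -> 1 <= d -> l5 <= 21 / 10 ->
  lam + ell + d * l5 <= 2 / 10 * 10 ^+ 6 * (d * (lam + d * ell) * (1 + ell)).
Proof.
move=> lam1 ell0 d1 h5; set m := d * _ * _.
have lam0 : 0 <= lam by exact: le_trans ler01 lam1.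
have d0 : 0 <= d by exact: le_trans ler01 d1.
have m1 : d * lam * (1 + ell) <= m.
  rewrite ler_wpM2r ?addr_ge0// ler_wpM2l// lerDl mulr_ge0//.
have dl1 : 1 <= d * lam by rewrite mulr_ege1.
have m2 : d * lam <= m by rewrite (le_trans _ m1)// ler_peMr ?lerDl// (le_trans ler01).
have m3 : ell <= m by rewrite (le_trans _ m1)// (@le_trans _ _ (1 + ell)) ?lerDr// ler_peMl// addr_ge0.
have m4 : lam <= m by rewrite (le_trans _ m2)// ler_peMl.
have m5 : d <= m by rewrite (le_trans _ m2)// ler_peMr.
have m6 : d * l5 <= 21 / 10 * m.
  by rewrite mulrC; apply: (@le_trans _ _ (21 / 10 * d)); rewrite ?ler_wpM2r ?ler_wpM2l.
have m0 : 0 <= m by exact: le_trans m5.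
move: m3 m4 m6 m0; clear; move: m (d * l5) => m z *; lra.
Qed.

(** If |pi - xi| < 1, both numbers are at most 5 in absolute value and |P(pi)| = |P(pi) - P(xi)| <=
    |pi - xi| Lam d 5^d. Otherwise the claim holds because its left side is at most 1. *)
Lemma algebraic_measure (R : realType) (xi Lam : R) (d : nat) (P : {poly int}) :
  irreducible_poly P -> root (map_poly intr P) xi -> size P = d.+1 -> 1 <= ln Lam -> 0 < Lam ->
  (poly_length P)%:~R <= Lam ->
  expR (- (12 / 10 * 10 ^+ 6 * d%:R * (ln Lam + d%:R * ln d%:R) * (1 + ln d%:R)))
    <= `|pi - xi|.
Proof.
move=> irrP rP sP Lam1 Lam0 PLam.
have d0 : (0 < d)%N by case: irrP => + _; rewrite sP.
have d1 : 1 <= d%:R :> R by rewrite ler1n.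
have ell0 : 0 <= ln d%:R :> R by rewrite ln_ge0.
have slack := exponent_slack Lam1 ell0 d1 (ln5_le R).
have mE c : c * d%:R * (ln Lam + d%:R * ln d%:R) * (1 + ln d%:R) =
    c * (d%:R * (ln Lam + d%:R * ln d%:R) * (1 + ln d%:R)) by rewrite !mulrA.
have meas := irreducible_measure irrP sP Lam1 Lam0 PLam; rewrite mE in meas.
rewrite mE; set m := d%:R * (_ + _) * _ in slack meas *.
have B0 : 0 < Lam * (d%:R * 5 ^+ d).
  by rewrite !mulr_gt0 ?exprn_gt0 ?ltr0n.
have lnB : ln (Lam * (d%:R * 5 ^+ d)) = ln Lam + ln d%:R + d%:R * ln 5.
  by rewrite !lnM ?posrE ?mulr_gt0 ?exprn_gt0 ?ltr0n// lnXn// addrA mulr_natl.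
have [far|near] := leP 1 `|pi - xi|.
  apply: le_trans far; rewrite -[leRHS]expR0 ler_expR oppr_le0.
  move: slack; have : 0 <= d%:R * ln 5 :> R by rewrite mulr_ge0// ln_ge0// ler1n.
  by move: Lam1 ell0; clear; move: (d%:R * ln 5) => z; lra.
have xi5 : `|xi| <= 5.
  have -> : xi = pi - (pi - xi) by ring.
  apply: (le_trans (ler_normB _ _)); have := pi_norm_le4 R.
  by move: near; clear; lra.
have pi5 : `|pi| <= 5 :> R by have := pi_norm_le4 R; lra.
have := @horner_dist_le R P pi xi 5 d (eq_leq sP) _ pi5 xi5.
rewrite (rootP rP) subr0 ler1n => /(_ isT) hle.
have key : expR (- (10 ^+ 6 * m)) <= `|pi - xi| * (Lam * (d%:R * 5 ^+ d)).
  apply: (le_trans meas); apply: (le_trans hle); rewrite ler_wpM2l//.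
  by rewrite ler_wpM2r// mulr_ge0 ?exprn_ge0.
rewrite -ler_pdivrMr// in key; apply: le_trans key.
rewrite -[Lam * (d%:R * 5 ^+ d)]lnK ?posrE// -expRN -expRD ler_expR lnB.
by move: slack; clear; move: m => m; lra.
Qed.

(** * Mahler measure and factorization *)

Section Landau.
Variable C : numClosedFieldType.
Implicit Types (p q : {poly C}) (z : C) (r : seq C).

Let norm1 p : C := \sum_(i < size p) `|p`_i|.
Let norm2 p : C := \sum_(i < size p) `|p`_i| ^+ 2.
(** max(1, |z|), written as a test because the order on C is partial. *)
Let max1 z : C := if 1 <= `|z| then `|z| else 1.

Let coef_sum_wide (f : C -> C) p n : f 0 = 0 -> (size p <= n)%N ->
  \sum_(i < size p) f p`_i = \sum_(i < n) f p`_i.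
Proof.
move=> f0 pn; rewrite -!(big_mkord xpredT (fun i => f p`_i)) (big_cat_nat _ pn)//=.
rewrite [X in _ = _ + X]big1_seq ?addr0// => i /andP[_].
by rewrite mem_index_iota => /andP[pi _]; rewrite nth_default// f0.
Qed.

Let norm1_wide p n : (size p <= n)%N -> norm1 p = \sum_(i < n) `|p`_i|.
Proof. by move=> pn; rewrite /norm1 (@coef_sum_wide (fun x => `|x|) _ n) ?normr0. Qed.

Let norm2_wide p n : (size p <= n)%N -> norm2 p = \sum_(i < n) `|p`_i| ^+ 2.
Proof.
by move=> pn; rewrite /norm2 (@coef_sum_wide (fun x => `|x| ^+ 2) _ n) ?normr0 ?expr0n.
Qed.

Let max1_ge1 z : 1 <= max1 z. Proof. by rewrite /max1; case: ifP. Qed.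

Let max1_cases z : max1 z = `|z| \/ (max1 z = 1 /\ `|z| <= 1).
Proof.
rewrite /max1; case: ifP => h; [by left | right; split => //].
by have := real_leVge (@real1 C) (normr_real z); rewrite h.
Qed.

Let add1_le_max1 z : 1 + `|z| <= 2 * max1 z.
Proof.
rewrite mulr_natl mulr2n; apply: lerD; first exact: max1_ge1.
by case: (max1_cases z) => [->|[-> ]].
Qed.

(* Reflecting a root in the unit circle preserves the L2 norm, so that all    *)
(* roots can be moved into the closed disc: this gives M(p) <= L(p).          *)
Let norm2_reflect q z :
  norm2 (('X - z%:P) * q) = norm2 ((Num.conj z *: 'X - 1) * q).
Proof.
set n := size q.
have s1 : (size (('X - z%:P) * q)%R <= n.+1)%N.
  by rewrite (leq_trans (size_polyMleq _ _))// size_XsubC.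
have s2 : (size ((Num.conj z *: 'X - 1) * q)%R <= n.+1)%N.
  rewrite (leq_trans (size_polyMleq _ _))// -/n.
  have : (size (Num.conj z *: 'X - 1 : {poly C})%R <= 2)%N.
    rewrite (leq_trans (size_polyD _ _))// geq_max (leq_trans (size_scale_leq _ _)) ?size_polyX//.
    by rewrite size_polyN size_poly1.
  by move: (size _) => k; lia.
rewrite (norm2_wide s1) (norm2_wide s2); apply/eqP; rewrite -subr_eq0 -sumrB; apply/eqP.
transitivity (\sum_(i < n.+1) (1 - `|z| ^+ 2) * (`|('X * q)`_i| ^+ 2 - `|q`_i| ^+ 2)).
  apply: eq_bigr => i _; rewrite !mulrBl !coefB mul1r -scalerAl coefZ coefCM.
  by rewrite !normCK !rmorphB !rmorphM /= !conjCK; ring.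
rewrite -mulr_sumr sumrB big_ord_recl coefXM eqxx normr0 expr0n add0r.
rewrite [\sum_(i < n.+1) _]big_ord_recr /= [q`_n]nth_default// normr0 expr0n addr0.
rewrite (eq_bigr (fun i : 'I_n => `|q`_i| ^+ 2)) ?subrr ?mulr0// => i _.
by rewrite coefXM /bump.
Qed.

(** Induction on the roots: a root with [max1] equal to |z| is reflected, which multiplies the
    leading coefficient by the conjugate of z; any other root merely joins q. *)
Let norm2_prod_ge q r :
  `|lead_coef q| ^+ 2 * \prod_(z <- r) max1 z ^+ 2 <=
  norm2 (q * \prod_(z <- r) ('X - z%:P)).
Proof.
elim: r q => [|z r IH] q.
  rewrite !big_nil !mulr1; have [->|q0] := eqVneq q 0.
    by rewrite lead_coef0 normr0 expr0n sumr_ge0// => i _; rewrite exprn_ge0.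
  rewrite /norm2 lead_coefE -size_poly_gt0 in q0 *.
  case: (size q) q0 => //= n _.
  by rewrite big_ord_recr /= lerDr sumr_ge0// => i _; rewrite exprn_ge0.
rewrite !big_cons.
case: (max1_cases z) => [->|[-> _]]; last first.
  rewrite expr1n mul1r [X in norm2 X]mulrA; apply: le_trans (IH _).
  by rewrite lead_coefM lead_coefXsubC mulr1.
rewrite [X in norm2 X]mulrCA norm2_reflect mulrCA [X in norm2 X]mulrA.
apply: le_trans (IH _); rewrite lead_coefM normrM exprMn mulrA ler_wpM2r//.
  by apply: prodr_ge0 => w _; rewrite exprn_ge0// (le_trans ler01).
apply: ler_wpM2r; first exact: exprn_ge0.
have [->|z0] := eqVneq z 0; first by rewrite normr0 expr0n exprn_ge0.
rewrite lead_coefDl ?lead_coefZ ?lead_coefX ?mulr1 ?norm_conjC//.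
by rewrite size_polyN size_poly1 size_scale ?size_polyX ?conjC_eq0.
Qed.

Let norm2_le p : norm2 p <= norm1 p ^+ 2.
Proof.
rewrite /norm1 /norm2; elim: (size p) => [|n IH]; first by rewrite !big_ord0 expr0n.
rewrite !big_ord_recr /= sqrrD (le_trans (lerD IH (lexx _)))// lerD2r lerDl.
by rewrite mulrn_wge0// mulr_ge0// sumr_ge0.
Qed.

Let landau c r :
  `|c| * \prod_(z <- r) max1 z <= norm1 (c *: \prod_(z <- r) ('X - z%:P)).
Proof.
have p0 : 0 <= \prod_(z <- r) max1 z.
  by apply: prodr_ge0 => z _; exact: le_trans ler01 (max1_ge1 z).
rewrite -(ler_sqr (x := _ * _)) ?nnegrE ?mulr_ge0 ?sumr_ge0//.
apply: le_trans (norm2_le _); rewrite -mul_polyC.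
by apply: le_trans (norm2_prod_ge _ _); rewrite lead_coefC exprMn -prodrXl.
Qed.

Let norm1_le c r :
  norm1 (c *: \prod_(z <- r) ('X - z%:P)) <= `|c| * \prod_(z <- r) (1 + `|z|).
Proof.
elim: r c => [|z r IH] c.
  by rewrite !big_nil mulr1 alg_polyC (@norm1_wide _ 1) ?size_polyC ?leq_b1// big_ord1 coefC.
rewrite !big_cons scalerAr mulrCA.
set q := c *: _; rewrite (@norm1_wide _ (size q).+1); last first.
  by rewrite (leq_trans (size_polyMleq _ _))// size_XsubC.
apply: (@le_trans _ _ ((1 + `|z|) * norm1 q)); last first.
  by apply: ler_wpM2l; [exact: addr_ge0 | exact: IH].
apply: (@le_trans _ _ (\sum_(i < (size q).+1) (`|('X * q)`_i| + `|z| * `|q`_i|))).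
  apply: ler_sum => i _; rewrite mulrBl coefB coefCM -normrM; exact: ler_normB.
rewrite big_split /= -mulr_sumr mulrDl mul1r lerD//.
  rewrite big_ord_recl coefXM eqxx normr0 add0r le_eqVlt; apply/orP; left; apply/eqP.
  by apply: eq_bigr => i _; rewrite coefXM /bump.
by rewrite -norm1_wide.
Qed.

Definition mahler p : C :=
  `|lead_coef p| * \prod_(z <- sval (closed_field_poly_normal p)) max1 z.

Lemma length_le_mahler p : norm1 p <= 2 ^+ (size p).-1 * mahler p.
Proof.
rewrite /mahler; case: closed_field_poly_normal => r /= pE.
rewrite {1}pE; apply: (le_trans (norm1_le _ _)).
have [->|p0] := eqVneq p 0; first by rewrite lead_coef0 normr0 !mul0r mulr0.
have -> : (size p).-1 = size r.
  by rewrite pE size_scale ?lead_coef_eq0// size_prod_XsubC.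
rewrite mulrCA ler_wpM2l//.
have -> : 2 ^+ size r = \prod_(z <- r) 2 :> C by rewrite big_const_seq count_predT iter_mulr_1.
rewrite -big_split /=; apply: ler_prod => z _.
by rewrite addr_ge0//= add1_le_max1.
Qed.

Lemma mahler_ge_lead p : `|lead_coef p| <= mahler p.
Proof.
rewrite /mahler ler_peMr//.
elim: sval => [|z r IH]; first by rewrite big_nil.
by rewrite big_cons mulr_ege1.
Qed.

(** [landau] is applied once, to the product of the leading coefficients and the concatenated root
    lists; this is where multiplicativity of the Mahler measure enters. *)
Lemma prod_mahler_le (s : seq {poly C}) :
  \prod_(p <- s) mahler p <= norm1 (\prod_(p <- s) p).
Proof.
pose rt p := sval (closed_field_poly_normal p).
have pE p : p = lead_coef p *: \prod_(z <- rt p) ('X - z%:P).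
  by rewrite /rt; case: closed_field_poly_normal.
have h := landau (\prod_(p <- s) lead_coef p) (flatten [seq rt p | p <- s]).
apply: le_trans (le_trans h _).
  rewrite normr_prod /mahler big_split /= big_flatten /= big_map.
  by [].
rewrite le_eqVlt; apply/orP; left; apply/eqP; congr norm1.
rewrite big_flatten /= big_map -scaler_prod.
by apply: eq_bigr => p _; rewrite -pE.
Qed.
End Landau.

Lemma norm1_map_int (C : numClosedFieldType) (p : {poly int}) :
  \sum_(i < size (map_poly intr p : {poly C})) `|(map_poly intr p : {poly C})`_i| =
  (poly_length p)%:~R.
Proof.
rewrite size_map_inj_poly; [|exact: intr_inj|exact: rmorph0].
rewrite /poly_length rmorph_sum; apply: eq_bigr => i _.
by rewrite coef_map /= intr_norm.
Qed.

(** For nonconstant p, both L(p) <= 2^deg M(p) and 3 are at most 3^deg M(p), since M(p) is at least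
    the absolute value of the leading coefficient. The maximum with 3 makes the lengths admissible
    for [irreducible_measure]. *)
Lemma prod_length_le (s : seq {poly int}) :
  all (fun p : {poly int} => 1 < size p)%N s ->
  \prod_(p <- s) Num.max 3 (poly_length p) <=
  3 ^+ (\sum_(p <- s) (size p).-1) * poly_length (\prod_(p <- s) p).
Proof.
move=> /allP s1; rewrite -(ler_int algC) rmorphM rmorph_prod rmorphXn /=.
pose toC (p : {poly int}) : {poly algC} := map_poly intr p.
have lead1 p : p \in s -> 1 <= mahler (toC p).
  move=> /s1 ps; apply: le_trans (mahler_ge_lead _).
  have p0 : p != 0 by rewrite -size_poly_gt0 ltnW.
  rewrite /toC lead_coef_map_inj; [|exact: intr_inj|exact: rmorph0].
  by rewrite -intr_norm ler1z -gtz0_ge1 normr_gt0 lead_coef_eq0.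
apply: (@le_trans _ _ (\prod_(p <- s) (3 ^+ (size p).-1 * mahler (toC p)))).
  rewrite !big_seq; apply: ler_prod => p ps; have M1 := lead1 _ ps.
  have M0 : 0 <= mahler (toC p) := le_trans ler01 M1.
  apply/andP; split; first by rewrite ler0z le_max.
  case: leP => _.
    have h := length_le_mahler (toC p); rewrite norm1_map_int in h.
    apply: (le_trans h); rewrite size_map_inj_poly; [|exact: intr_inj|exact: rmorph0].
    by rewrite ler_wpM2r// lerXn2r ?nnegrE// ler_nat.
  rewrite -[leLHS]mulr1 ler_pM//.
  have := s1 _ ps; case: (size p) => [|[|k]]//= _.
  by rewrite exprS ler_peMr// exprn_ege1// ler1n.
rewrite big_split /= -(big_morph _ (fun m n => exprD 3 m n) (expr0 _)).
apply: ler_wpM2l; first exact: exprn_ge0.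
have := prod_mahler_le [seq toC p | p <- s]; rewrite !big_map => h.
apply: (le_trans h); rewrite le_eqVlt; apply/orP; left; apply/eqP.
by rewrite -norm1_map_int rmorph_prod.
Qed.

(** Induction on the size. A proper divisor over the rationals is replaced by its primitive part,
    which divides P over the integers by Gauss's lemma. *)
Lemma irreducible_factorization (P : {poly int}) : P != 0 ->
  exists (c : int) (s : seq {poly int}),
    [/\ c != 0, forall p, p \in s -> irreducible_poly p & P = c *: \prod_(p <- s) p].
Proof.
have [n] := ubnP (size P); elim: n P => // n IH P sP P0.
have [irr|nirr] := pselect (irreducible_poly P).
  exists 1, [:: P]; split => //; last by rewrite big_seq1 scale1r.
  by move=> p; rewrite inE => /eqP->.
have [s1|s1] := leqP (size P) 1.
  exists P`_0, [::]; split => //; last by rewrite big_nil alg_polyC -size1_polyC.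
  by apply: contraNneq P0 => c0; rewrite (size1_polyC s1) c0.
have [q [q1 qP qnP]] : exists q : {poly int}, [/\ size q != 1, q %| P & ~~ (q %= P)].
  apply: contrapT => h; apply: nirr; split => // q q1 qP.
  by apply/negPn/negP => qn; apply: h; exists q.
have q0 : q != 0 by apply: contraNneq P0 => q0; rewrite q0 dvd0p in qP.
have [r PE] := dvdpP_int qP.
have r0 : r != 0 by apply: contraNneq P0 => r0; rewrite PE r0 mulr0.
have zq0 : zprimitive q != 0 by rewrite zprimitive_eq0.
have sPE : size P = (size q + size r).-1 by rewrite PE size_mul// size_zprimitive.
have sq0 : (0 < size q)%N by rewrite size_poly_gt0.
have sr0 : (0 < size r)%N by rewrite size_poly_gt0.
have sqP : (size q < size P)%N.
  rewrite ltn_neqAle dvdp_leq// andbT; apply: contra qnP => /eqP qP'.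
  by rewrite -dvdp_size_eqp// qP'.
have srP : (size r < size P)%N by rewrite sPE; move: q1 sq0; lia.
have [|c1 [u1 [c10 h1 e1]]] := IH (zprimitive q) _ zq0.
  by rewrite size_zprimitive (leq_trans sqP).
have [|c2 [u2 [c20 h2 e2]]] := IH r _ r0.
  by rewrite (leq_trans srP).
exists (c1 * c2), (u1 ++ u2); split.
- by rewrite mulf_neq0.
- by move=> p; rewrite mem_cat => /orP[/h1|/h2].
- by rewrite PE e1 e2 big_cat -scalerAl -scalerAr scalerA.
Qed.

(** * Reduction to the irreducible case *)

(** Absorbs the 3^d lost in [prod_length_le]; for d = 2 it amounts to 3 <= 4. *)
Lemma mul_ln3_le (R : realType) (d : nat) : (0 < d)%N ->
  d%:R * ln 3 <= ln 3 + d%:R * ln d%:R :> R.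
Proof.
have h1 := ln3_ge1 R; have [d3 _|] := leqP 3 d.
  have h : d%:R * ln 3 <= d%:R * ln d%:R :> R.
    by rewrite ler_wpM2l// ler_ln ?posrE ?ltr0n ?(leq_trans _ d3)// ler_nat.
  by apply: (le_trans h); rewrite lerDr (le_trans ler01).
case: d => [|[|[|]]]// _ _; first by rewrite ln1; lra.
have : ln 3 <= ln (2 ^+ 2) :> R by rewrite ler_ln ?posrE; lra.
by rewrite lnXn// -mulr_natl; lra.
Qed.

(** Replacing ln(n_i) by ln d and the outer n_i by d makes the summands linear in l_i and n_i. Their
    total involves (d ln 3 + lam) + d ln d <= 2 (lam + d ln d), the source of the doubled
    constant. *)
Lemma sum_exponent_le (R : realType) (d : nat) (lam : R) (I : eqType) (s : seq I)
    (n : I -> nat) (l : I -> R) :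
  (0 < d)%N -> (\sum_(i <- s) n i <= d)%N -> (forall i, i \in s -> (0 < n i)%N) ->
  (forall i, i \in s -> 0 <= l i) -> ln 3 <= lam ->
  \sum_(i <- s) l i <= d%:R * ln 3 + lam ->
  \sum_(i <- s) 10 ^+ 6 * (n i)%:R * (l i + (n i)%:R * ln (n i)%:R) * (1 + ln (n i)%:R) <=
  2 * 10 ^+ 6 * d%:R * (lam + d%:R * ln d%:R) * (1 + ln d%:R).
Proof.
move=> d0 sd n0 l0 lam3 sl.
have nd i : i \in s -> (n i <= d)%N.
  by move=> is_; apply: leq_trans sd; rewrite (big_rem i)//= leq_addr.
have lnd0 : 0 <= ln d%:R :> R by rewrite ln_ge0// ler1n.
set c := 10 ^+ 6 * d%:R * (1 + ln d%:R) : R.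
have c0 : 0 <= c by rewrite !mulr_ge0 ?exprn_ge0 ?addr_ge0.
apply: (@le_trans _ _ (\sum_(i <- s) c * (l i + (n i)%:R * ln d%:R))).
  rewrite !big_seq; apply: ler_sum => i is_.
  have ni := nd i is_; have n1 := n0 i is_; have l1 := l0 i is_.
  have lni : ln (n i)%:R <= ln d%:R :> R by rewrite ler_ln ?posrE ?ltr0n ?ler_nat.
  have lni0 : 0 <= ln (n i)%:R :> R by rewrite ln_ge0// ler1n.
  rewrite mulrAC; apply: ler_pM.
  - by rewrite !mulr_ge0 ?exprn_ge0 ?addr_ge0.
  - by rewrite addr_ge0 ?mulr_ge0.
  - rewrite /c; apply: ler_pM; rewrite ?mulr_ge0 ?exprn_ge0 ?addr_ge0//.
      by rewrite ler_wpM2l ?exprn_ge0 ?ler_nat.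
    by rewrite lerD2l.
  - by rewrite lerD2l ler_wpM2l.
rewrite -mulr_sumr big_split /= -mulr_suml -natr_sum.
have h1 : (\sum_(i <- s) n i)%:R * ln d%:R <= d%:R * ln d%:R :> R.
  by rewrite ler_wpM2r// ler_nat.
have h2 := mul_ln3_le R d0.
have h3 : \sum_(i <- s) l i + (\sum_(i <- s) n i)%:R * ln d%:R <= 2 * (lam + d%:R * ln d%:R).
  have gen (u v w m : R) : u <= w + v -> w <= m -> (u + m) + v <= 2 * (m + v).
    by clear; lra.
  by apply: (le_trans (lerD sl h1)); exact: gen h2 lam3.
apply: (le_trans (ler_wpM2l c0 h3)); rewrite /c le_eqVlt; apply/orP; left; apply/eqP; ring.
Qed.

Lemma size_prod_nonconst (A : idomainType) (s : seq {poly A}) :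
  all (fun p : {poly A} => 1 < size p)%N s ->
  size (\prod_(p <- s) p)%R = (\sum_(p <- s) (size p).-1).+1.
Proof.
elim: s => [|p s IH] /=; first by rewrite !big_nil size_poly1.
move=> /andP[p1 /IH sE]; rewrite !big_cons size_mul ?sE; last 2 first.
- by rewrite -size_poly_gt0 ltnW.
- by rewrite -size_poly_gt0 sE.
by case: (size p) p1 => [|k]//= _; rewrite addnS.
Qed.

Lemma polynomial_measure (R : realType) (d : nat) (L : R) (P : {poly int}) :
  (1 <= d)%N -> 3 <= L -> P != 0 -> ((size P).-1 <= d)%N ->
  (poly_length P)%:~R <= L ->
  expR (- (2 * 10 ^+ 6 * d%:R * (ln L + d%:R * ln d%:R) * (1 + ln d%:R)))
    <= `|(map_poly intr P).[pi]|.
Proof.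
move=> d0 L3 P0 sP PL.
have [c [s [c0 irr PE]]] := irreducible_factorization P0.
have s1 p : p \in s -> (1 < size p)%N by move=> /irr[].
pose n (p : {poly int}) := (size p).-1.
pose Lam p : R := (Num.max 3 (poly_length p))%:~R.
have n0 p : p \in s -> (0 < n p)%N by move=> /s1; rewrite /n; case: (size p) => [|[]].
have Lam3 p : 3 <= Lam p by rewrite /Lam -[3]/(3%:~R) ler_int le_max lexx.
have Lam0 p : 0 < Lam p by apply: lt_le_trans (Lam3 p).
have Lam1 p : 1 <= ln (Lam p).
  by apply: (le_trans (ln3_ge1 R)); rewrite ler_ln ?posrE.
set Q := \prod_(p <- s) p in PE.
have Q0 : Q != 0 by apply: contraNneq P0 => Q0; rewrite PE Q0 scaler0.
have sQ : size P = size Q by rewrite PE size_scale.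
have dQ : (\sum_(p <- s) n p <= d)%N.
  apply: leq_trans sP; rewrite sQ /Q size_prod_nonconst//.
  by apply/allP.
have lQ : poly_length Q <= poly_length P.
  rewrite {2}/poly_length sQ; apply: ler_sum => i _.
  by rewrite PE coefZ normrM ler_peMl// -gtz0_ge1 normr_gt0.
have sumln : \sum_(p <- s) ln (Lam p) <= d%:R * ln 3 + ln L.
  have prodE : \sum_(p <- s) ln (Lam p) = ln (\prod_(p <- s) Lam p).
    by elim: (s) => [|p u IH]; rewrite ?big_nil ?ln1// !big_cons IH lnM ?posrE// prodr_gt0.
  have L0 : 0 < L by apply: lt_le_trans L3.
  have -> : d%:R * ln 3 + ln L = ln (3 ^+ d * L) by rewrite lnM ?posrE ?exprn_gt0// lnXn// mulr_natl.
  rewrite prodE ler_ln ?posrE ?mulr_gt0 ?exprn_gt0 ?prodr_gt0//.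
  have := @prod_length_le s _; rewrite -(ler_int R) rmorph_prod => h.
  apply: (le_trans (h _)); first by apply/allP.
  rewrite rmorphM rmorphXn /=; apply: ler_pM; rewrite ?exprn_ge0 ?ler0z ?poly_length_ge0//.
    by rewrite ler_weXn2l// ler1n.
  by rewrite (le_trans _ PL)// ler_int.
(* The constant factor c is a nonzero integer and can only increase the value. *)
apply: (@le_trans _ _ (\prod_(p <- s) `|(map_poly intr p).[pi]|)); last first.
  rewrite PE map_polyZ /= hornerZ normrM rmorph_prod /= horner_prod normr_prod.
  by rewrite ler_peMl ?prodr_ge0// -intr_norm ler1z -gtz0_ge1 normr_gt0.
have step : expR (- \sum_(p <- s)
      10 ^+ 6 * (n p)%:R * (ln (Lam p) + (n p)%:R * ln (n p)%:R) * (1 + ln (n p)%:R)) <=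
    \prod_(p <- s) `|(map_poly intr p).[pi]| :> R.
  rewrite -sumrN expR_sum !big_seq; apply: ler_prod => p ps; rewrite expR_ge0 /=.
  apply: irreducible_measure => //; first exact: irr.
    by rewrite /n prednK// ltnW// s1.
  by rewrite /Lam ler_int le_max lexx orbT.
apply: le_trans step; rewrite ler_expR lerN2.
apply: sum_exponent_le => //.
  by move=> p _; exact: le_trans ler01 (Lam1 p).
by rewrite ler_ln ?posrE// (lt_le_trans _ L3).
Qed.

Theorem theorem2 (R : realType) :
  (forall (xi : R) (d : nat) (L : R),
     algebraicOver (ratr : rat -> R) xi ->
     d = alg_degree xi ->
     3 <= L ->
     (alg_length xi)%:~R <= L ->
     expR (- (12 / 10 * 10 ^+ 6 * d%:R *
              (ln L + d%:R * ln d%:R) * (1 + ln d%:R)))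
       <= `|pi - xi|)
  /\
  (forall (d : nat) (L : R) (P : {poly int}),
     (1 <= d)%N ->
     3 <= L ->
     P != 0 ->
     ((size P).-1 <= d)%N ->
     (poly_length P)%:~R <= L ->
     expR (- (2 * 10 ^+ 6 * d%:R *
              (ln L + d%:R * ln d%:R) * (1 + ln d%:R)))
       <= `|(map_poly intr P).[pi]|).
Proof.
have ln_ge1 (L : R) : 3 <= L -> 1 <= ln L /\ 0 < L.
  move=> L3; have L0 : 0 < L by exact: lt_le_trans L3.
  by rewrite (le_trans (ln3_ge1 R))// ler_ln ?posrE.
split=> [xi d L alg dE L3 lL|]; last exact: polynomial_measure.
have [irrP _ rootP] := minpolyZP alg; have [L1 L0] := ln_ge1 L L3.
apply: (algebraic_measure irrP rootP) => //.
by rewrite dE /alg_degree prednK// ltnW// irrP.1.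
Qed.
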